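(* Let $N\ge 1$, $s\in(0,1)$, $p>1$, and let $h\in C([0,\infty))$ be a nonnegative function. Consider the Cauchy problem $$\partial_t u-\mathscr L u=h(t)\,u^p\ \text{ in }\mathbb R^N\times(0,\infty),\qquad u(x,0)=u_0(x)\ge 0\ \text{ in }\mathbb R^N,\qquad (\ast)$$ where $\mathscr L=\Delta-(-\Delta)^s$. Assume that $h\in\mathcal M(\gamma)$ for some $\gamma>-1$. Then the following holds: (i) If $p<1+\dfrac{2s(\gamma+1)}{N}$, then every nonnegative (nontrivial) solution of $(\ast)$ blows up in finite time. (ii) If $p>1+\dfrac{2s(\gamma+1)}{N}$, then $(\ast)$ admits a global-in-time solution for sufficiently small initial data.
   Context: **Class $\mathcal M(\gamma)$.** A measurable function $U:(0,\infty)\to(0,\infty)$ that is bounded on finite intervals belongs to $\mathcal M(\gamma)$ if $\lim_{x\to\infty}\dfrac{\log U(x)}{\log x}=\gamma$. **Operator and semigroup.** $(-\Delta)^s$ is the fractional Laplacian (Fourier symbol $|\xi|^{2s}$). $e^{t\mathscr L}$ ($t>0$) denotes the semigroup generated by $\mathscr L=\Delta-(-\Delta)^s$, i.e. convolution with the kernel whose Fourier transform in $x$ is $e^{-t(|\xi|^2+|\xi|^{2s})}$. **Solutions.** A mild solution of $(\ast)$ is a function $u$ satisfying the Duhamel formula $$u(t)=e^{t\mathscr L}u_0+\int_0^t h(\sigma)\,e^{(t-\sigma)\mathscr L}\big(u(\sigma)^p\big)\,d\sigma .$$ It is global in time if this holds for all $t>0$. *)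

(* Defs.v *)
From HB Require Import structures.
From mathcomp Require Import all_boot all_order all_algebra.
From mathcomp Require Import all_classical all_reals all_analysis.
Set Implicit Arguments.
Unset Strict Implicit.
Unset Printing Implicit Defensive.
Import Order.TTheory GRing.Theory Num.Theory.
Import numFieldNormedType.Exports.
Local Open Scope classical_set_scope.
Local Open Scope ring_scope.

(* R^n with its product Borel sigma-algebra. *)
Notation Rn R n := (n.-tuple (measurableTypeR R)).

Definition dotRn (R : realType) (n : nat) (x y : Rn R n) : R :=
  \sum_(i < n) (tnth x i : R) * tnth y i.

Definition normRn (R : realType) (n : nat) (x : Rn R n) : R :=
  Num.sqrt (dotRn x x).

Definition subRn (R : realType) (n : nat) (x y : Rn R n) : Rn R n :=
  [tuple (tnth x i : R) - tnth y i | i < n].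

Definition consRn (R : realType) (n : nat)
    (z : measurableTypeR R * Rn R n) : Rn R n.+1 :=
  [the n.+1.-tuple (measurableTypeR R) of z.1 :: z.2].

Lemma measurable_consRn (R : realType) (n : nat) :
  measurable_fun setT (@consRn R n).
Proof. exact: measurable_cons. Qed.

(* The library has Lebesgue measure on R only.  On R^n.+1 it is the image of
   the product of Lebesgue measures on R and on R^n under [consRn]. *)
Definition consRn_measure (R : realType) (n : nat)
    (mu : {sigma_finite_measure set (Rn R n) -> \bar R})
    : set (Rn R n.+1) -> \bar R :=
  pushforward (@lebesgue_measure R \x mu)%E (@consRn R n).

Lemma consRn_measure0 (R : realType) (n : nat)
    (mu : {sigma_finite_measure set (Rn R n) -> \bar R}) :
  consRn_measure mu set0 = 0%E.
Proof. by rewrite /consRn_measure /pushforward preimage_set0 measure0. Qed.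

Lemma consRn_measure_ge0 (R : realType) (n : nat)
    (mu : {sigma_finite_measure set (Rn R n) -> \bar R}) A :
  (0 <= consRn_measure mu A)%E.
Proof. by rewrite /consRn_measure /pushforward. Qed.

Lemma consRn_measure_sigma_additive (R : realType) (n : nat)
    (mu : {sigma_finite_measure set (Rn R n) -> \bar R}) :
  semi_sigma_additive (consRn_measure mu).
Proof.
have mf := @measurable_consRn R n.
exact: (@measure_semi_sigma_additive _ _ _ (pushforward _ _)).
Qed.

HB.instance Definition _ (R : realType) (n : nat)
    (mu : {sigma_finite_measure set (Rn R n) -> \bar R}) :=
  isMeasure.Build _ _ _ (consRn_measure mu) (consRn_measure0 mu)
    (consRn_measure_ge0 mu) (@consRn_measure_sigma_additive R n mu).

Lemma consRn_measure_sigma_finite (R : realType) (n : nat)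
    (mu : {sigma_finite_measure set (Rn R n) -> \bar R}) :
  sigma_finite setT (consRn_measure mu).
Proof.
have /sigma_finiteP[F [TF ndF Foo]] := sigma_finiteT (@lebesgue_measure R).
have /sigma_finiteP[G [TG ndG Goo]] := sigma_finiteT mu.
have mth : measurable_fun setT (fun x : Rn R n.+1 => tnth x ord0).
  exact: measurable_tnth.
have mbh : measurable_fun setT (fun x : Rn R n.+1 => [tuple of behead x]).
  exact: measurable_behead.
exists (fun k => (fun x : Rn R n.+1 => tnth x ord0) @^-1` F k `&`
                 (fun x : Rn R n.+1 => [tuple of behead x]) @^-1` G k).
  apply/seteqP; split=> [x _|//].
  have [i _ Fi] : (\bigcup_i F i) (tnth x ord0) by rewrite -TF.
  have [j _ Gj] : (\bigcup_i G i) [tuple of behead x] by rewrite -TG.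
  exists (maxn i j) => //; split => /=.
  - exact: (subsetPset _ _ (ndF _ _ (leq_maxl i j))).
  - exact: (subsetPset _ _ (ndG _ _ (leq_maxr i j))).
move=> k; have [mF Fk] := Foo k; have [mG Gk] := Goo k; split.
  apply: measurableI; rewrite -[X in measurable X]setTI.
  - exact: mth.
  - exact: mbh.
rewrite /consRn_measure /pushforward.
rewrite (_ : _ @^-1` _ = F k `*` G k); last first.
  apply/funext => -[a b]; rewrite /preimage/setI/setX /=; congr (F k _ /\ G k _).
  exact: val_inj.
by rewrite product_measure1E// lte_mul_pinfty// ge0_fin_numE.
Qed.

HB.instance Definition _ (R : realType) (n : nat)
    (mu : {sigma_finite_measure set (Rn R n) -> \bar R}) :=
  Measure_isSigmaFinite.Build _ _ _ (consRn_measure mu)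
    (consRn_measure_sigma_finite mu).

Fixpoint lebesgueRn (R : realType) (n : nat)
    : {sigma_finite_measure set (Rn R n) -> \bar R} :=
  match n with
  | 0 => dirac ([tuple] : Rn R 0)
  | m.+1 => consRn_measure (lebesgueRn R m)
  end.

(* The function with Fourier transform exp (- t (|xi|^2 + |xi|^(2s))), given by
   Fourier inversion for the convention int f(x) exp (- i x . xi) dx; this
   symbol is even in xi, so only the cosine part of exp (i x . xi) contributes. *)
Definition mixed_kernel (R : realType) (N : nat) (s t : R) (x : Rn R N) : R :=
  (2 * pi) ^- N *
  \int[lebesgueRn R N]_xi
    (cos (dotRn x xi) *
     expR (- t * (normRn xi ^+ 2 + normRn xi `^ (2 * s)))).

Definition mixed_semigroup (R : realType) (N : nat) (s t : R)
    (f : Rn R N -> R) (x : Rn R N) : \bar R :=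
  (\int[lebesgueRn R N]_y (mixed_kernel s t (subRn x y) * f y)%:E)%E.

Definition classM (R : realType) (gamma : R) (U : R -> R) : Prop :=
  [/\ forall x : R, 0 < x -> 0 < U x,
      measurable_fun (`]0, +oo[ : set R) U,
      forall b : R, exists M : R, forall x : R, 0 < x <= b -> U x <= M
    & ln (U x) / ln x @[x --> +oo] --> gamma].

(* Nonnegative mild solution on R^N x (0, T), with T = +oo allowed.
   Nonnegativity is part of the notion because u ^ p is only meaningful for
   u >= 0; all the integrals are then integrals of nonnegative functions.  The
   values of u at times outside (0, T) are irrelevant: u0 enters through the
   Duhamel formula only. *)
Definition mild_solution (R : realType) (N : nat) (s p : R) (h : R -> R)
    (u0 : Rn R N -> R) (T : \bar R) (u : R -> Rn R N -> R) : Prop :=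
  [/\ (0 < T)%E,
      measurable_fun
        [set z : measurableTypeR R * Rn R N | (0 < z.1)%R /\ (z.1%:E < T)%E]
        (fun z => u z.1 z.2),
      forall (t : R) x, 0 < t -> (t%:E < T)%E -> 0 <= u t x
    & forall t : R, 0 < t -> (t%:E < T)%E ->
        {ae lebesgueRn R N, forall x,
          ((u t x)%:E = mixed_semigroup s t u0 x
            + \int[lebesgue_measure]_(r in `]0%R, t[)
                ((h r)%:E
                 * mixed_semigroup s (t - r) (fun y => (u r y `^ p)%R) x))%E}].

Definition global_mild_solution (R : realType) (N : nat) (s p : R) (h : R -> R)
    (u0 : Rn R N -> R) (u : R -> Rn R N -> R) : Prop :=
  mild_solution s p h u0 +oo%E u.

Definition maximal_mild_solution (R : realType) (N : nat) (s p : R)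
    (h : R -> R) (u0 : Rn R N -> R) (T : \bar R) (u : R -> Rn R N -> R) : Prop :=
  mild_solution s p h u0 T u /\
  forall (T' : \bar R) (u' : R -> Rn R N -> R),
    (T < T')%E -> mild_solution s p h u0 T' u' ->
    ~ (forall t : R, 0 < t -> (t%:E < T)%E ->
         {ae lebesgueRn R N, forall x, u' t x = u t x}).

Definition nontrivial_on (R : realType) (N : nat) (T : \bar R)
    (u : R -> Rn R N -> R) : Prop :=
  exists t : R, [/\ 0 < t, (t%:E < T)%E
    & ~ {ae lebesgueRn R N, forall x, u t x = 0}].

(* To be used with u maximal on (0, T): T is finite and the essential supremum
   of u t over R^N is unbounded as t tends to T from below. *)
Definition blows_up_in_finite_time (R : realType) (N : nat) (T : \bar R)
    (u : R -> Rn R N -> R) : Prop :=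
  exists2 b : R, T = b%:E &
    limf_esup (fun t : R => 'N[lebesgueRn R N]_+oo[EFin \o u t])%E b^'- = +oo%E.

(* Main.v *)
(* Write [l = |xi|^2] and let [K_t] be the kernel with symbol [exp (- t (l + l^s))].
   Call [psi] positive definite if every [exp (- a l) psi l] has a nonnegative
   cosine transform.  Such functions are stable under products with Gaussians,
   nonnegative sums and bounded limits, hence under multiplication by
   [exp (- c (1 - exp (- tau l)))].  The sums over [k] in Z of
   [q^(- s k) (1 - exp (- q^k l))], normalized at [l = 1], tend to [l^s] as [q]
   tends to 1, so [exp (- t l^s)] is positive definite and [K_t >= 0].  The [K_t]
   are then probability densities forming a convolution semigroup, with
   [K_t <= C t^(- N / 2 s)] and, on bounded sets and for large [t],
   [K_t >= c t^(- N / 2 s)].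

   (i) For a solution on (0, tau], put [G t = (e^((tau - t) L) (u t)) x].  By Jensen
   [G t' - G t >= kappa (t' - t) (G t)^p] when [h >= kappa] on [[t, t']], while
   [G (tau / 2) >= c tau^(- N / 2 s)].  The successive doublings of [G] take times
   that form a geometric series, so [kappa tau (G (tau / 2))^(p - 1)] is bounded; as
   [kappa >= tau^(gamma - e)] up to a constant, this fails for large [tau] in the
   subcritical case.  Hence the maximal time is finite, and a solution bounded near
   it could be continued by a Picard iteration.

   (ii) Since [e^(t L) u0 <= delta min (1, C t^(- N / 2 s))] and
   [h t min (1, C t^(- N / 2 s))^(p - 1)] is integrable, [2 e^(t L) u0] is a
   supersolution for small [delta], below which Picard iteration converges. *)
Require Import Defs.
From HB Require Import structures.
From mathcomp Require Import all_boot all_order all_algebra.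
From mathcomp Require Import all_classical all_reals all_analysis.
From mathcomp Require Import measurable_realfun ess_sup_inf.
From mathcomp Require Import ring lra.
Import Order.TTheory GRing.Theory Num.Theory.
Import numFieldNormedType.Exports.
Set Implicit Arguments.
Unset Strict Implicit.
Unset Printing Implicit Defensive.
Local Open Scope classical_set_scope.
Local Open Scope ring_scope.

(** * Integration on R^n *)

Section lebesgueRn_integral.
Context (R : realType).

(** The kernel is given only as a cosine integral, so its sign is the first obstacle: once it is
    nonnegative, Tonelli and monotone convergence justify every later exchange, whatever the size of
    the data. The lacunary sum is a geometric Riemann sum for the representation of [l^s] as a
    multiple of the integral of [(1 - exp (- tau l)) tau^(- 1 - s)] over [tau > 0]. Its exact
    scaling under [l -> q l] and its monotonicity pin the normalized sum between [q^(- s) l^s] and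
    [q^s l^s], so letting [q] tend to 1 requires no error estimate. In (i) the datum is merely
    measurable and nonnegative, hence no norm of [u t] is available. [G] is therefore read at a
    single point [x] where the Duhamel formula holds at time [tau]: there [G <= u tau x < +oo] at
    all times before [tau], and the doublings contradict this finiteness. The formula at the other
    times holds only almost everywhere, which is enough because [G] averages the slices. *)

Lemma ge0_integral_RnS n (f : Rn R n.+1 -> \bar R) :
  measurable_fun setT f -> (forall x, 0 <= f x)%E ->
  (\int[lebesgueRn R n.+1]_x f x =
   \int[lebesgue_measure]_a \int[lebesgueRn R n]_b f (consRn (a, b)))%E.
Proof.
move=> mf f0.
rewrite (_ : \int[lebesgueRn R n.+1]_x f x =
  \int[pushforward (@lebesgue_measure R \x lebesgueRn R n)%E (@consRn R n)]_x f x)%E //.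
rewrite ge0_integral_pushforward//=; last exact: measurable_consRn.
rewrite preimage_setT (fubini_tonelli1 (f \o @consRn R n))//; last by move=> x; exact: f0.
by apply: measurableT_comp => //; exact: measurable_consRn.
Qed.

Lemma integral_RnS n (f : Rn R n.+1 -> \bar R) :
  (lebesgueRn R n.+1).-integrable setT f ->
  (\int[lebesgueRn R n.+1]_x f x =
   \int[lebesgue_measure]_a \int[lebesgueRn R n]_b f (consRn (a, b)))%E.
Proof.
move=> intf.
have mc := @measurable_consRn R n.
have mf := measurable_int _ intf.
have icf : (@lebesgue_measure R \x lebesgueRn R n)%E.-integrable setT (f \o @consRn R n).
  apply/integrableP; split; first exact: measurableT_comp.
  move/integrableP : intf => [_].
  rewrite (_ : \int[lebesgueRn R n.+1]_x _ =
  \int[pushforward (@lebesgue_measure R \x lebesgueRn R n)%E (@consRn R n)]_x `|f x|)%E //.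
  rewrite ge0_integral_pushforward//=.
  exact: measurableT_comp.
rewrite (_ : \int[lebesgueRn R n.+1]_x f x =
  \int[pushforward (@lebesgue_measure R \x lebesgueRn R n)%E (@consRn R n)]_x f x)%E //.
rewrite (@integral_pushforward _ _ _ _ _ _ mc)//=.
by rewrite preimage_setT -(integral12_prod_meas1 icf).
Qed.

Lemma integral_Rn0 (f : Rn R 0 -> \bar R) : (\int[lebesgueRn R 0]_x f x = f [tuple])%E.
Proof.
have ff : f = cst (f [tuple]) by apply/funext => x; rewrite (tuple0 x).
by rewrite ff integral_cst//= diracT mule1.
Qed.

Lemma tnth_consRn0 n (a : R) (b : Rn R n) : tnth (consRn (a, b)) ord0 = a.
Proof. by []. Qed.

Lemma tnth_consRnS n (a : R) (b : Rn R n) i : tnth (consRn (a, b)) (lift ord0 i) = tnth b i.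
Proof. by rewrite !(tnth_nth a). Qed.

Lemma dot_consRn n (a c : R) (b d : Rn R n) :
  dotRn (consRn (a, b)) (consRn (c, d)) = a * c + dotRn b d.
Proof.
rewrite /dotRn big_ord_recl !tnth_consRn0; congr (_ + _).
by apply: eq_bigr => i _; rewrite !tnth_consRnS.
Qed.

Lemma consRn_eta n (x : Rn R n.+1) : x = consRn (tnth x ord0, [tuple of behead x]).
Proof.
by apply: val_inj => /=; case: x => -[|a l]// Hs /=; rewrite (tnth_nth a).
Qed.

Lemma tnth_subRn n (x y : Rn R n) i : tnth (subRn x y) i = (tnth x i : R) - tnth y i.
Proof. by rewrite tnth_mktuple. Qed.

Lemma dotRnC n (x y : Rn R n) : dotRn x y = dotRn y x.
Proof. by apply: eq_bigr => i _; rewrite mulrC. Qed.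

Lemma dotRnBl n (x y z : Rn R n) : dotRn (subRn x y) z = dotRn x z - dotRn y z.
Proof.
rewrite /dotRn -sumrB; apply: eq_bigr => i _.
by rewrite tnth_mktuple mulrBl.
Qed.

Lemma dotRnBr n (x y z : Rn R n) : dotRn z (subRn x y) = dotRn z x - dotRn z y.
Proof. by rewrite !(dotRnC z) dotRnBl. Qed.

Lemma dotRn_ge0 n (x : Rn R n) : 0 <= dotRn x x.
Proof. by apply: sumr_ge0 => i _; rewrite -expr2 sqr_ge0. Qed.

Lemma dotRn_ge_coord n (x : Rn R n) i : (tnth x i : R) ^+ 2 <= dotRn x x.
Proof.
rewrite /dotRn (bigD1 i)//= -expr2 lerDl; apply: sumr_ge0 => j _.
by rewrite -expr2 sqr_ge0.
Qed.

Lemma measurable_dotRn_comp d (T : measurableType d) n (f g : T -> Rn R n) :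
  measurable_fun setT f -> measurable_fun setT g ->
  measurable_fun setT (fun t => dotRn (f t) (g t) : R).
Proof.
move=> mf mg; apply: measurable_sum => i; apply: measurable_funM.
- exact: (measurableT_comp (measurable_tnth i) mf).
- exact: (measurableT_comp (measurable_tnth i) mg).
Qed.

Lemma measurable_subRn_comp d (T : measurableType d) n (f g : T -> Rn R n) :
  measurable_fun setT f -> measurable_fun setT g ->
  measurable_fun setT (fun t => subRn (f t) (g t)).
Proof.
move=> mf mg; apply/measurable_fun_tnthP => i.
rewrite (_ : _ \o _ = fun t => (tnth (f t) i : R) - tnth (g t) i); last first.
  by apply/funext => t /=; rewrite tnth_mktuple.
apply: (@measurable_funB _ _ _ setT (fun t => tnth (f t) i : R) (fun t => tnth (g t) i : R)).
- exact: (measurableT_comp (measurable_tnth i) mf).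
- exact: (measurableT_comp (measurable_tnth i) mg).
Qed.

Lemma ge0_integral_prod_Rn n (f : 'I_n -> R -> R) (c : 'I_n -> R) :
  (forall i, measurable_fun setT (f i)) -> (forall i x, 0 <= f i x) ->
  (forall i, \int[lebesgue_measure]_x (f i x)%:E = (c i)%:E)%E ->
  (\int[lebesgueRn R n]_x (\prod_(i < n) f i (tnth x i))%:E = (\prod_(i < n) c i)%:E)%E.
Proof.
elim: n f c => [|n IH] f c mf f0 fc.
  by rewrite integral_Rn0 !big_ord0.
rewrite ge0_integral_RnS; last 2 first.
- apply/measurable_EFinP; apply: measurable_prod => i _.
  exact: (measurableT_comp (mf i) (measurable_tnth i)).
- by move=> x; rewrite lee_fin prodr_ge0.
under eq_integral => a _.
  under eq_integral => b _.
    rewrite big_ord_recl tnth_consRn0 EFinM.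
    under eq_bigr do rewrite tnth_consRnS.
    over.
  rewrite ge0_integralZl//=; last 3 first.
  - apply/measurable_EFinP; apply: measurable_prod => i _.
    exact: (measurableT_comp (mf _) (measurable_tnth i)).
  - by move=> x _; rewrite lee_fin prodr_ge0.
  - by rewrite lee_fin.
  rewrite (IH (fun i => f (lift ord0 i)) (fun i => c (lift ord0 i)))//.
  over.
rewrite /= ge0_integralZr//=; last 3 first.
- by apply/measurable_EFinP; exact: mf.
- by move=> x _; rewrite lee_fin.
- rewrite lee_fin prodr_ge0// => i _; rewrite -lee_fin -fc integral_ge0// => x _.
  by rewrite lee_fin.
by rewrite fc -EFinM big_ord_recl.
Qed.

End lebesgueRn_integral.

(** * Gaussian integrals *)

Section gaussian_integral.
Context (R : realType).
Implicit Types (e z c m y : R).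
Notation mu := (@lebesgue_measure R).

(** The normal density of mean [m] and variance [1 / (2 e)] has mass 1, and its peak is the
    reciprocal of the right-hand side. *)
Lemma gauss_shift_integral e m : 0 < e ->
  (\int[mu]_x (expR (- (e * (x - m) ^+ 2)))%:E = (Num.sqrt (pi / e))%:E)%E.
Proof.
move=> e0; pose s := Num.sqrt (2 * e)^-1.
have s2 : s ^+ 2 = (2 * e)^-1 by rewrite sqr_sqrtr// invr_ge0 mulr_ge0// ltW.
have s0 : s != 0 by rewrite gt_eqF// sqrtr_gt0 invr_gt0 mulr_gt0.
have e0' : e != 0 by rewrite gt_eqF.
have := @integral_normal_pdf R m s.
have -> : (fun x => (normal_pdf m s x)%:E) =
   (fun x => (normal_peak s)%:E * (expR (- (e * (x - m) ^+ 2)))%:E)%E.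
  apply/funext => x; rewrite normal_pdfE// /normal_fun EFinM; congr (_ * (expR _)%:E)%E.
  by rewrite s2 mulNr; congr (- _); field.
rewrite ge0_integralZl//=; last 2 first.
- apply/measurable_EFinP; apply: measurableT_comp => //; apply: measurable_funN => //.
  by apply: measurable_funM => //; apply: measurable_funX; exact: measurable_funB.
- by rewrite lee_fin normal_peak_ge0.
have p0 := @normal_peak_gt0 R s s0.
move=> H.
have -> : (Num.sqrt (pi / e))%:E = ((Num.sqrt (pi / e))%:E * 1)%E by rewrite mule1.
rewrite -H muleA -EFinM (_ : _ * _ = 1) ?mul1e//.
rewrite /normal_peak s2 (_ : (2 * e)^-1 * pi *+ 2 = pi / e); last by field.
by rewrite divff// gt_eqF// sqrtr_gt0 divr_gt0// pi_gt0.
Qed.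

Lemma measurable_gauss e : measurable_fun setT (fun y => expR (- (e * y ^+ 2)) : R).
Proof.
apply: measurableT_comp => //; apply: measurable_funN => //.
by apply: measurable_funM => //; exact: measurable_funX.
Qed.

Lemma integrable_gauss e : 0 < e ->
  mu.-integrable setT (fun y => (expR (- (e * y ^+ 2)))%:E).
Proof.
move=> e0; apply/integrableP; split.
  by apply/measurable_EFinP; exact: measurable_gauss.
under eq_integral do rewrite gee0_abs ?lee_fin ?expR_ge0// -[X in _ * X ^+ 2]subr0.
by rewrite gauss_shift_integral// ltry.
Qed.

(** Half of the exponent absorbs the polynomial through [1 + u <= exp u] with [u = e y^2 / 2]. The
    bound dominates the differentiated integrand in [integral_cos_gauss]. *)
Lemma gauss_moment_le e y : 0 < e ->
  (1 + y ^+ 2) * expR (- (e * y ^+ 2)) <= (1 + 2 / e) * expR (- (e / 2 * y ^+ 2)).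
Proof.
move=> e0.
have -> : - (e * y ^+ 2) = - (e / 2 * y ^+ 2) - (e / 2 * y ^+ 2) by field.
rewrite expRD mulrA ler_pM2r ?expR_gt0// expRN ler_pdivrMr ?expR_gt0//.
set u := e / 2 * y ^+ 2.
have u0 : 0 <= u by rewrite mulr_ge0 ?sqr_ge0// divr_ge0// ltW.
have -> : y ^+ 2 = 2 / e * u by rewrite /u; field; rewrite gt_eqF.
have h1 := expR_ge1Dx u.
have : 0 < 2 / e by rewrite divr_gt0.
move: (2 / e) => k k0.
rewrite mulrDl mul1r lerD//; first by lra.
by rewrite ler_pM2l//; lra.
Qed.

(** Integration by parts on the line: the fundamental theorem of calculus on [[- n - 1, n + 1]],
    then dominated convergence in [n]. *)
Lemma integral_derive_vanishing (F f : R -> R) :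
  continuous f -> (forall y, is_derive y 1 F (f y)) ->
  mu.-integrable setT (EFin \o f) ->
  F n%:R @[n --> \oo] --> 0 -> F (- n%:R) @[n --> \oo] --> 0 ->
  \int[mu]_y f y = 0.
Proof.
move=> cf Ff intf F1 F2.
have mf : measurable_fun setT f by exact: continuous_measurable_fun.
pose g := fun (n : nat) y => ((f y)%:E * (\1_`[- n.+1%:R, n.+1%:R] y)%:E)%E.
have [] := @dominated_convergence _ _ _ mu setT measurableT g (EFin \o f) (fun y => `|(f y)%:E|%E).
- move=> n; apply/measurable_EFinP; apply: measurable_funM => //.
- exact/measurable_EFinP.
- apply: aeW => y _; apply: cvg_near_cst.
  exists (Num.bound `|y|) => // n /= hn.
  rewrite /g indicE mem_set ?mule1//= in_itv/= -ler_norml.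
  apply: (le_trans (ltW (archi_boundP (normr_ge0 y)))).
  by rewrite ler_nat (leq_trans hn).
- exact: integrable_abse.
- apply: aeW => y n _; rewrite /g abseM -[leRHS]mule1 lee_wpmul2l//.
  by rewrite indicE; case: (_ \in _); rewrite /= ?normr1 ?normr0 lee_fin.
move=> _ _ H.
have E n : (\int[mu]_y g n y = (F n.+1%:R - F (- n.+1%:R))%:E)%E.
  have := @continuous_FTC2 R f F (- n.+1%:R) n.+1%:R.
  rewrite EFinB => <-.
  - rewrite [RHS]integral_mkcond; apply: eq_integral => y _.
    by rewrite /g restrict_EFin /= patch_indic /= EFinM.
  - by rewrite gtrN.
  - exact: continuous_subspaceT.
  - split.
    + by move=> y _; exact: ex_derive.
    + apply: cvg_at_right_filter.
      by apply: differentiable_continuous; apply/derivable1_diffP; exact: ex_derive.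
    + apply: cvg_at_left_filter.
      by apply: differentiable_continuous; apply/derivable1_diffP; exact: ex_derive.
  - by move=> y _; rewrite derive1E; exact: derive_val.
have H2 : (fun n => \int[mu]_y g n y)%E @ \oo --> 0%E.
  under eq_fun do rewrite E.
  apply/cvg_EFin; first exact: nearW.
  rewrite -[X in _ --> X](subrr 0); apply: cvgB.
    by rewrite (@cvg_shiftS _ (fun n => F n%:R)).
  by rewrite (@cvg_shiftS _ (fun n => F (- n%:R))).
have := cvg_unique _ H H2.
by rewrite /Rintegral => -> //.
Qed.

End gaussian_integral.

Section gaussian_cosine.
Context (R : realType).
Implicit Types (e z c m y : R).
Notation mu := (@lebesgue_measure R).

Lemma measurable_cos : measurable_fun setT (@cos R).
Proof. by apply: continuous_measurable_fun; exact: continuous_cos. Qed.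

Lemma measurable_sin : measurable_fun setT (@sin R).
Proof. by apply: continuous_measurable_fun; exact: continuous_sin. Qed.

Lemma integrable_gauss_dominated e (f : R -> R) k : 0 < e -> 0 <= k ->
  measurable_fun setT f ->
  (forall y, `|f y| <= k * expR (- (e * y ^+ 2))) ->
  mu.-integrable setT (EFin \o f).
Proof.
move=> e0 k0 mf fk.
apply: (le_integrable measurableT _ _ (integrableZl measurableT k (integrable_gauss e0))).
- exact/measurable_EFinP.
- move=> y _ /=; rewrite lee_fin [leRHS]ger0_norm ?fk//.
  by rewrite mulr_ge0// expR_ge0.
Qed.

Lemma cvg_gauss e : 0 < e -> expR (- (e * n%:R ^+ 2)) @[n --> \oo] --> (0 : R).
Proof.
move=> e0.
have H : (expR (- e)) ^+ n @[n --> \oo] --> (0 : R).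
  by apply: cvg_expr; rewrite ger0_norm ?expR_ge0// expR_lt1 oppr_lt0.
apply: (squeeze_cvgr _ (cvg_cst 0) H); apply: nearW => n.
rewrite expR_ge0/= -expRM_natl ler_expR mulrN lerN2 mulrC ler_pM2l//.
by rewrite -natrX ler_nat; case: n => // n; rewrite -[leqLHS]expn1 leq_pexp2l.
Qed.

(** As a function of [z] the integral [F] satisfies [F' = - z / (2 e) F], by differentiation under
    the integral followed by integration of the derivative of [sin (y z + c) exp (- e y^2)]. Hence
    [F z exp (z^2 / (4 e))] is constant. *)
Lemma integral_cos_gauss e z c : 0 < e ->
  \int[mu]_y (cos (y * z + c) * expR (- (e * y ^+ 2))) =
  cos c * (Num.sqrt (pi / e) * expR (- (z ^+ 2 / (4 * e)))).
Proof.
move=> e0.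
pose F z := \int[mu]_y (cos (y * z + c) * expR (- (e * y ^+ 2))).
have ne0 : e != 0 by rewrite gt_eqF.
have mlin z' : measurable_fun setT (fun y => y * z' + c) by apply: measurable_funD => //; exact: measurable_funM.
have mgs : measurable_fun setT (fun y => expR (- (e * y ^+ 2)) : R) by exact: measurable_gauss.
have ic z' : mu.-integrable setT (EFin \o (fun y => cos (y * z' + c) * expR (- (e * y ^+ 2)))).
  apply: (integrable_gauss_dominated e0 ler01).
    apply: measurable_funM => //; apply: measurableT_comp => //; exact: measurable_cos.
  move=> y; rewrite normrM [X in _ * X]ger0_norm ?expR_ge0// ler_pM2r ?expR_gt0//.
  by rewrite ler_norml cos_geN1 cos_le1.
have k0 : 0 <= 1 + 2 / e by rewrite addr_ge0// divr_ge0// ltW.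
have e20 : 0 < e / 2 by rewrite divr_gt0.
have ynorm y : `|y| <= 1 + y ^+ 2.
  rewrite -real_normK ?num_real//; have := normr_ge0 y; move: `|y| => a a0; nra.
have is_ z' : mu.-integrable setT (EFin \o (fun y => - y * sin (y * z' + c) * expR (- (e * y ^+ 2)))).
  apply: (integrable_gauss_dominated e20 k0).
    apply: measurable_funM => //; apply: measurable_funM; first exact: measurable_funN.
    apply: measurableT_comp => //; exact: measurable_sin.
  move=> y; apply: le_trans (gauss_moment_le y e0).
  rewrite normrM [X in _ * X]ger0_norm ?expR_ge0// ler_pM2r ?expR_gt0//.
  rewrite normrM normrN -[leRHS]mulr1 ler_pM//.
  by rewrite ler_norml sin_geN1 sin_le1.
have dF (z' : R) : is_derive z' (1 : R) (F : R -> R) (\int[mu]_y (- y * sin (y * z' + c) * expR (- (e * y ^+ 2)))).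
  pose f z y := cos (y * z + c) * expR (- (e * y ^+ 2)).
  have df (x y : R) : is_derive x (1 : R) (f ^~ y : R -> R) (- y * sin (y * x + c) * expR (- (e * y ^+ 2))).
    by apply: is_derive_eq; rewrite /GRing.scale /=; ring.
  have Iz : `]z' - 1, z' + 1[%classic z'.
    by rewrite /= in_itv/=; lra.
  have dE x y : partial1of2 f x y = - y * sin (y * x + c) * expR (- (e * y ^+ 2)).
    by rewrite /partial1of2 derive1E; exact: derive_val.
  have h1 x : `]z' - 1, z' + 1[%classic x -> mu.-integrable setT (EFin \o f x).
    by move=> _; exact: ic.
  have h2 x y : `]z' - 1, z' + 1[%classic x -> setT y -> derivable (f^~ y) x 1.
    by move=> _ _; exact: ex_derive.
  pose G y := (1 + 2 / e) * expR (- (e / 2 * y ^+ 2)).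
  have G0 y : 0 <= G y by rewrite mulr_ge0// expR_ge0.
  have iG : mu.-integrable setT (EFin \o G).
    by have := integrableZl measurableT (1 + 2 / e) (integrable_gauss e20).
  have h3 x y : `]z' - 1, z' + 1[%classic x -> setT y -> `|partial1of2 f x y| <= G y.
    move=> _ _; rewrite dE; apply: le_trans (gauss_moment_le y e0).
    rewrite normrM [X in _ * X]ger0_norm ?expR_ge0// ler_pM2r ?expR_gt0//.
    rewrite normrM normrN -[leRHS]mulr1 ler_pM//.
    by rewrite ler_norml sin_geN1 sin_le1.
  apply: DeriveDef.
    exact: (derivable_under_integral measurableT Iz h1 h2 G0 iG h3).
  rewrite -derive1E (differentiation_under_integral measurableT Iz h1 h2 G0 iG h3).
  by apply: eq_Rintegral => y _; rewrite dE.
have vanish (g : R -> R) : sin (g n%:R) * expR (- (e * n%:R ^+ 2)) @[n --> \oo] --> (0 : R).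
  apply: norm_cvg0; apply: (squeeze_cvgr _ (cvg_cst 0) (cvg_gauss e0)); apply: nearW => n.
  rewrite normr_ge0/= normrM [X in _ * X]ger0_norm ?expR_ge0// ler_piMl ?expR_ge0//.
  by rewrite ler_norml sin_geN1 sin_le1.
have ibp z' : \int[mu]_y (- y * sin (y * z' + c) * expR (- (e * y ^+ 2))) = - (z' / (2 * e)) * F z'.
  pose g y := (2 * e) * (- y * sin (y * z' + c) * expR (- (e * y ^+ 2))) +
      z' * (cos (y * z' + c) * expR (- (e * y ^+ 2))).
  have g0 : \int[mu]_y g y = 0.
    apply: (@integral_derive_vanishing R (fun y => sin (y * z' + c) * expR (- (e * y ^+ 2)))).
    - move=> y; apply: differentiable_continuous; apply/derivable1_diffP.
      by rewrite /g; exact: ex_derive.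
    - move=> y; apply: is_derive_eq.
      by rewrite /g /GRing.scale /=; ring.
    - exact: (integrableD measurableT (integrableZl measurableT (2 * e) (is_ z')) (integrableZl measurableT z' (ic z'))).
    - exact: (vanish (fun y => y * z' + c)).
    - by have := vanish (fun y => - y * z' + c); under eq_fun do rewrite -[in X in _ * X]sqrrN.
  move: g0; rewrite /g RintegralD//; last 2 first.
  - by have := integrableZl measurableT (2 * e) (is_ z').
  - by have := integrableZl measurableT z' (ic z').
  rewrite RintegralZl// RintegralZl// -/(F z').
  move/eqP; rewrite addr_eq0 => /eqP H.
  apply: (@mulfI _ (2 * e)); first by rewrite mulf_neq0.
  by rewrite H; field.
pose H z := F z * expR (z ^+ 2 / (4 * e)).
have dH (z' : R) : is_derive z' (1 : R) (H : R -> R) 0.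
  have dF' := dF z'.
  apply: is_derive_eq; rewrite ibp /GRing.scale /=.
  by field.
have := is_derive_0_is_cst z 0 dH.
rewrite /H expr0n /= mul0r expR0 mulr1 => H0.
have F0 : F 0 = cos c * Num.sqrt (pi / e).
  rewrite /F; under eq_Rintegral do rewrite mulr0 add0r.
  rewrite RintegralZl//; last exact: integrable_gauss.
  congr (_ * _); rewrite /Rintegral -[RHS]/(fine (Num.sqrt (pi / e))%:E).
  by rewrite -(gauss_shift_integral 0 e0); congr fine; under eq_integral do rewrite -[X in X ^+ 2]subr0.
by rewrite -/(F z) mulrA -F0 -H0 -mulrA -expRD subrr expR0 mulr1.
Qed.

End gaussian_cosine.

(** For [s < 1] the power is not differentiable at 0, so the limit 0 is treated by hand, with the
    modulus [e^(1 / s)]. *)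
Lemma powR_continuous_ge0 (R : realType) (s a : R) (T : Type) (F : set_system T) (f : T -> R) :
  Filter F -> 0 < s -> (forall x, 0 <= f x) -> 0 <= a ->
  f x @[x --> F] --> a -> f x `^ s @[x --> F] --> a `^ s.
Proof.
move=> FF s0 f0; rewrite le_eqVlt => /predU1P[<-|a0] fa; last first.
  have ca : {for a, continuous (fun x : R => x `^ s)}.
    apply: differentiable_continuous; apply/derivable1_diffP; apply: derivable_powR.
    by rewrite in_itv/= a0.
  exact: (continuous_cvg _ ca fa).
rewrite powR0 ?gt_eqF//; apply/cvgr0Pnorm_lt => e e0.
have e1 : 0 < e `^ s^-1 by exact: powR_gt0.
move/cvgr0Pnorm_lt : fa => /(_ _ e1); apply: filterS => x.
rewrite !ger0_norm ?powR_ge0// => h.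
rewrite -(powRr1 (ltW e0)) -(mulVf (lt0r_neq0 s0)) powRrM.
by rewrite gt0_ltr_powR// nnegrE// ?powR_ge0.
Qed.

Section gaussian_Rn.
Context (R : realType) (n : nat).
Implicit Types (e c : R) (x y z : Rn R n).
Notation mu := (lebesgueRn R n).
Notation D x y := (dotRn (subRn x y) (subRn x y)).

Lemma dotRn_normsq_sum x y : D x y = \sum_(i < n) ((tnth x i : R) - tnth y i) ^+ 2.
Proof. by apply: eq_bigr => i _; rewrite !tnth_subRn expr2. Qed.

Lemma measurable_distRn y : measurable_fun setT (fun x => D x y).
Proof. by apply: measurable_dotRn_comp; apply: measurable_subRn_comp. Qed.

Lemma measurable_normRnsq : measurable_fun setT (fun x => dotRn x x).
Proof. by apply: measurable_dotRn_comp. Qed.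

Lemma gauss_shift_integral_Rn e y : 0 < e ->
  (\int[mu]_x (expR (- (e * D x y)))%:E = (Num.sqrt (pi / e) ^+ n)%:E)%E.
Proof.
move=> e0.
under eq_integral => x _.
  rewrite dotRn_normsq_sum mulr_sumr -sumrN expR_sum.
  over.
rewrite (ge0_integral_prod_Rn (f := fun i a => expR (- (e * (a - tnth y i) ^+ 2)))
  (c := fun=> Num.sqrt (pi / e))).
- by rewrite prodr_const card_ord.
- move=> i; apply: measurableT_comp => //; apply: measurable_funN => //.
  by apply: measurable_funM => //; apply: measurable_funX; exact: measurable_funB.
- by move=> i x; exact: expR_ge0.
- by move=> i; exact: gauss_shift_integral.
Qed.

Lemma gauss_integral_Rn e : 0 < e ->
  (\int[mu]_x (expR (- (e * dotRn x x)))%:E = (Num.sqrt (pi / e) ^+ n)%:E)%E.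
Proof.
move=> e0.
rewrite -(gauss_shift_integral_Rn [tuple 0 | i < n] e0).
apply: eq_integral => x _; congr (expR (- (_ * _)))%:E.
rewrite dotRn_normsq_sum; apply: eq_bigr => i _.
by rewrite tnth_mktuple subr0 expr2.
Qed.

Lemma measurable_gauss_Rn e y : measurable_fun setT (fun x => expR (- (e * D x y)) : R).
Proof.
apply: measurableT_comp => //; apply: measurable_funN => //.
by apply: measurable_funM => //; exact: measurable_distRn.
Qed.

Lemma measurable_gauss0_Rn e : measurable_fun setT (fun x => expR (- (e * dotRn x x)) : R).
Proof.
apply: measurableT_comp => //; apply: measurable_funN => //.
by apply: measurable_funM => //; exact: measurable_normRnsq.
Qed.

Lemma integrable_gauss_shift_Rn e y : 0 < e ->
  mu.-integrable setT (fun x => (expR (- (e * D x y)))%:E).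
Proof.
move=> e0; apply/integrableP; split.
  by apply/measurable_EFinP; exact: measurable_gauss_Rn.
under eq_integral do rewrite gee0_abs ?lee_fin ?expR_ge0//.
by rewrite gauss_shift_integral_Rn// ltry.
Qed.

Lemma integrable_gauss_Rn e : 0 < e ->
  mu.-integrable setT (fun x => (expR (- (e * dotRn x x)))%:E).
Proof.
move=> e0; apply/integrableP; split.
  by apply/measurable_EFinP; exact: measurable_gauss0_Rn.
under eq_integral do rewrite gee0_abs ?lee_fin ?expR_ge0//.
by rewrite gauss_integral_Rn// ltry.
Qed.

Lemma integrable_gauss_dominated_Rn e (f : Rn R n -> R) k : 0 < e -> 0 <= k ->
  measurable_fun setT f ->
  (forall x, `|f x| <= k * expR (- (e * dotRn x x))) ->
  mu.-integrable setT (EFin \o f).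
Proof.
move=> e0 k0 mf fk.
apply: (le_integrable measurableT _ _ (integrableZl measurableT k (integrable_gauss_Rn e0))).
- exact/measurable_EFinP.
- move=> y _ /=; rewrite lee_fin [leRHS]ger0_norm ?fk//.
  by rewrite mulr_ge0// expR_ge0.
Qed.

Lemma measurable_cos_dotRn z c : measurable_fun setT (fun x => cos (dotRn x z + c) : R).
Proof.
apply: measurableT_comp; first exact: measurable_cos.
by apply: measurable_funD => //; exact: measurable_dotRn_comp.
Qed.

Lemma integrable_cos_gauss_Rn e z c : 0 < e ->
  mu.-integrable setT (EFin \o (fun x => cos (dotRn x z + c) * expR (- (e * dotRn x x)))).
Proof.
move=> e0; apply: (integrable_gauss_dominated_Rn e0 ler01).
  by apply: measurable_funM; [exact: measurable_cos_dotRn|exact: measurable_gauss0_Rn].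
move=> x; rewrite normrM [X in _ * X]ger0_norm ?expR_ge0// ler_pM2r ?expR_gt0//.
by rewrite ler_norml cos_geN1 cos_le1.
Qed.

End gaussian_Rn.

(** In the induction on the dimension the phase of the inner integral absorbs the outer coordinate
    as [c + a z0]; this is why [c] is arbitrary, and it keeps sine integrals out. *)
Lemma integral_cos_gauss_Rn (R : realType) n (e c : R) (z : Rn R n) : 0 < e ->
  (\int[lebesgueRn R n]_x (cos (dotRn x z + c) * expR (- (e * dotRn x x)))%:E =
  (cos c * (Num.sqrt (pi / e) ^+ n * expR (- (dotRn z z / (4 * e)))))%:E)%E.
Proof.
move=> e0; elim: n c z => [|n IH] c z.
  by rewrite integral_Rn0 /dotRn !big_ord0 mul0r mulr0 oppr0 add0r expR0 !mulr1.
rewrite integral_RnS; last exact: integrable_cos_gauss_Rn.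
rewrite (consRn_eta z); set z0 : R := tnth z ord0; set z' : Rn R n := [tuple of behead z].
under eq_integral => a _.
  under eq_integral => b _.
    rewrite !dot_consRn mulrDr opprD expRD -expr2 [a * z0 + _]addrC -addrA mulrCA EFinM.
    over.
  rewrite integralZl//=; last exact: integrable_cos_gauss_Rn.
  rewrite IH -EFinM mulrA [expR _ * cos _]mulrC EFinM.
  over.
have ig : lebesgue_measure.-integrable setT (EFin \o (fun y => cos (y * z0 + c) * expR (- (e * y ^+ 2)))).
  apply: (integrable_gauss_dominated e0 ler01).
    apply: measurable_funM => //; last exact: measurable_gauss.
    apply: measurableT_comp; first exact: measurable_cos.
    by apply: measurable_funD => //; exact: measurable_funM.
  move=> x; rewrite normrM [X in _ * X]ger0_norm ?expR_ge0// ler_pM2r ?expR_gt0//.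
  by rewrite ler_norml cos_geN1 cos_le1.
rewrite integralZr//=.
have := integral_cos_gauss z0 c e0; rewrite /Rintegral => H.
rewrite -(fineK (integrable_fin_num _ ig))// H -EFinM; congr _%:E.
have -> : - (dotRn (consRn (z0, z')) (consRn (z0, z')) / (4 * e)) =
    - (z0 ^+ 2 / (4 * e)) - dotRn z' z' / (4 * e).
  by rewrite dot_consRn mulrDl opprD -expr2.
by rewrite expRD [_ ^+ n.+1]exprS; ring.
Qed.

(** * Gaussian approximate identity *)

Section approximate_identity.
Context (R : realType) (n : nat).
Notation mu := (lebesgueRn R n).
Notation D x y := (dotRn (subRn x y) (subRn x y)).

(** Euclidean neighbourhoods, with the squared radius as parameter to avoid square roots. *)
Definition nbhsRn (y : Rn R n) : set_system (Rn R n) :=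
  filter_from [set r : R | 0 < r] (fun r => [set x | D x y < r]).

Global Instance nbhsRn_filter y : Filter (nbhsRn y).
Proof.
apply: filter_from_filter; first by exists 1 => /=.
move=> i j /= i0 j0; exists (Num.min i j) => /=; first by rewrite lt_min i0.
by move=> x /=; rewrite lt_min => /andP.
Qed.

Lemma cvg_tnth_nbhsRn y i : (tnth x i : R) @[x --> nbhsRn y] --> (tnth y i : R).
Proof.
apply/cvgrPdist_lt => e e0; exists (e ^+ 2) => /=; first exact: exprn_gt0.
move=> x /= h; rewrite distrC -(ltr_pXn2r (ltn0Sn 1)) ?nnegrE// ?ltW// real_normK ?num_real//.
by apply: le_lt_trans h; have := dotRn_ge_coord (subRn x y) i; rewrite tnth_subRn.
Qed.

Lemma cvg_dotRnl_nbhsRn y z : dotRn z x @[x --> nbhsRn y] --> dotRn z y.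
Proof.
apply: cvg_big => [|i _]; first exact: add_continuous.
apply: cvgM; first exact: cvg_cst.
exact: cvg_tnth_nbhsRn.
Qed.

Lemma cvg_normsq_nbhsRn y : dotRn x x @[x --> nbhsRn y] --> dotRn y y.
Proof. by apply: cvg_big => [|i _]; [exact: add_continuous|apply: cvgM]; exact: cvg_tnth_nbhsRn. Qed.

(** Continuity near [y] and boundedness elsewhere merge into the single inequality
    [|f x - f y| <= d / 2 + C |x - y|^2], whose last term has a Gaussian mean of order [1 / k]. *)
Lemma gauss_approx_identity (f : Rn R n -> R) (B : R) y :
  measurable_fun setT f -> (forall x, `|f x| <= B) ->
  f x @[x --> nbhsRn y] --> f y ->
  (fun k => (Num.sqrt (pi / k.+1%:R) ^+ n)^-1 *
    \int[mu]_x (f x * expR (- (k.+1%:R * D x y)))) @ \oo --> f y.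
Proof.
move=> mf fB fc.
have int1 k (g : Rn R n -> R) C : measurable_fun setT g -> (forall x, `|g x| <= C) ->
    mu.-integrable setT (EFin \o (fun x => g x * expR (- (k.+1%:R * D x y)))).
  move=> mg gC.
  have C0 : 0 <= C by apply: le_trans (gC y); exact: normr_ge0.
  apply: (le_integrable measurableT _ _ (integrableZl measurableT C (integrable_gauss_shift_Rn y (ltr0Sn R k)))).
    by apply/measurable_EFinP; apply: measurable_funM => //; exact: measurable_gauss_Rn.
  move=> x _ /=; rewrite lee_fin !normrM ler_pM2r ?normr_gt0 ?gt_eqF ?expR_gt0//.
  by rewrite (ger0_norm C0).
have B0 : 0 <= B by apply: le_trans (fB y); exact: normr_ge0.
apply/cvgrPdist_le => d d0.
have d20 : 0 < d / 2 by rewrite divr_gt0.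
move/cvgrPdist_lt : fc => /(_ _ d20)[r /= r0 Hr].
(* Outside the ball of squared radius [r] this gives [C |x - y|^2 >= 2 B], the trivial bound of the
   oscillation. *)
pose C := 2 * B / r.
have C0 : 0 <= C by rewrite divr_ge0 ?mulr_ge0// ltW.
have fle x : `|f x - f y| <= d / 2 + C * D x y.
  have [xr|xr] := ltP (D x y) r.
    by apply: ler_wpDr; [rewrite mulr_ge0 ?dotRn_ge0|rewrite distrC; exact: ltW (Hr x xr)].
  apply: (@le_trans _ _ (2 * B)).
    by rewrite (le_trans (ler_normB _ _))// mulr_natl mulr2n lerD.
  apply: ler_wpDl; first exact: ltW.
  by rewrite /C mulrAC ler_pdivlMr// ler_wpM2l// mulr_ge0.
clearbody C.
have key k : `|f y - (Num.sqrt (pi / k.+1%:R) ^+ n)^-1 *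
    \int[mu]_x (f x * expR (- (k.+1%:R * D x y)))| <= d / 2 + C * 2 * Num.sqrt 2 ^+ n / k.+1%:R.
  set a := k.+1%:R; have a0 : 0 < a :> R by [].
  have a20 : 0 < a / 2 by rewrite divr_gt0.
  set c := Num.sqrt (pi / a) ^+ n.
  have c0 : 0 < c by rewrite exprn_gt0// sqrtr_gt0 divr_gt0// pi_gt0.
  have I1 : \int[mu]_x expR (- (a * D x y)) = c.
    by rewrite /Rintegral gauss_shift_integral_Rn.
  have ig := integrable_gauss_shift_Rn y a0.
  have ig2 := integrable_gauss_shift_Rn y a20.
  have -> : f y = c^-1 * \int[mu]_x (f y * expR (- (a * D x y))).
    rewrite RintegralZl// I1; field; exact: lt0r_neq0.
  have if1 : mu.-integrable setT (EFin \o (fun x => f y * expR (- (a * D x y)))).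
    by have := integrableZl measurableT (f y) ig.
  have if2 := int1 k f B mf fB.
  rewrite -mulrBr -RintegralB// normrM [`|c^-1|]gtr0_norm ?invr_gt0//.
  rewrite ler_pdivrMl//.
  have if3 : mu.-integrable setT (EFin \o (fun x => f y * expR (- (a * D x y)) - f x * expR (- (a * D x y)))).
    exact: (integrableB measurableT if1 if2).
  apply: le_trans (le_normr_Rintegral measurableT if3) _.
  have if4 : mu.-integrable setT (EFin \o (fun x => d / 2 * expR (- (a * D x y)) + C * (2 / a) * expR (- (a / 2 * D x y)))).
    exact: (integrableD measurableT (integrableZl measurableT (d / 2) ig) (integrableZl measurableT (C * (2 / a)) ig2)).
  apply: (@le_trans _ _ (\int[mu]_x (d / 2 * expR (- (a * D x y)) + C * (2 / a) * expR (- (a / 2 * D x y))))).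
    apply: le_Rintegral => //; first exact: (integrable_norm if3).
    move=> x _; rewrite -mulrBl normrM distrC [X in _ * X]ger0_norm ?expR_ge0//.
    apply: (@le_trans _ _ ((d / 2 + C * D x y) * expR (- (a * D x y)))).
      by rewrite ler_pM2r ?expR_gt0.
    rewrite mulrDl lerD2l -!mulrA ler_wpM2l//.
    have -> : - (a * D x y) = - (a / 2 * D x y) - (a / 2 * D x y) by field.
    rewrite expRD !mulrA ler_pM2r ?expR_gt0// expRN ler_pdivrMr ?expR_gt0//.
    set u := a / 2 * D x y.
    have -> : D x y = 2 / a * u by rewrite /u; field; exact: lt0r_neq0.
    rewrite ler_pM2l ?divr_gt0//.
    by have := expR_ge1Dx u; lra.
  rewrite RintegralD//; last 2 first.
  - by have := integrableZl measurableT (d / 2) ig.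
  - by have := integrableZl measurableT (C * (2 / a)) ig2.
  rewrite !RintegralZl// I1 mulrDr [c * _]mulrC lerD2l.
  rewrite /Rintegral gauss_shift_integral_Rn//=.
  have -> : pi / (a / 2) = 2 * (pi / a) by field; exact: lt0r_neq0.
  by rewrite sqrtrM// exprMn -/c le_eqVlt; apply/orP; left; apply/eqP; field; exact: lt0r_neq0.
pose K := C * 2 * Num.sqrt 2 ^+ n.
have K0 : 0 <= K by rewrite mulr_ge0 ?mulr_ge0// exprn_ge0.
near=> k; apply: le_trans (key k) _.
rewrite -/K [leRHS](splitr d) lerD2l ler_pdivrMr// -ler_pdivrMl//.
apply: (@le_trans _ _ k%:R); last by rewrite ler_nat.
by near: k; exact: nbhs_infty_ger.
Unshelve. all: by end_near. Qed.

End approximate_identity.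

(** * Positivity of the kernel *)

Section positive_definite_profiles.
Context (R : realType) (n : nat).
Notation mu := (lebesgueRn R n).
Implicit Types (psi : R -> R) (x xi : Rn R n).

Lemma measurable_cos_dotRn0 x : measurable_fun setT (fun xi => cos (dotRn x xi) : R).
Proof.
by under eq_fun do rewrite dotRnC -[X in cos X]addr0; exact: measurable_cos_dotRn.
Qed.

Lemma integrable_cos_profile psi B a x : measurable_fun setT psi ->
  (forall l, 0 <= l -> `|psi l| <= B) -> 0 < a ->
  mu.-integrable setT (EFin \o (fun xi =>
    cos (dotRn x xi) * (expR (- (a * dotRn xi xi)) * psi (dotRn xi xi)))).
Proof.
move=> mpsi psiB a0.
have B0 : 0 <= B by apply: le_trans (psiB 0 _) => //; exact: normr_ge0.
apply: (integrable_gauss_dominated_Rn a0 B0).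
  apply: measurable_funM; first exact: measurable_cos_dotRn0.
  apply: measurable_funM; first exact: measurable_gauss0_Rn.
  by apply: measurableT_comp => //; exact: measurable_normRnsq.
move=> xi; rewrite !normrM [`|expR _|]ger0_norm ?expR_ge0// mulrCA mulrC.
rewrite ler_pM2r ?expR_gt0// -[leRHS]mul1r ler_pM//.
  by rewrite ler_norml cos_geN1 cos_le1.
by rewrite psiB// dotRn_ge0.
Qed.

(* psi stands for the radial function xi |-> psi (|xi|^2); the Gaussian factors
   make all the integrals converge, and multiplying psi by a Gaussian only
   shifts a. *)
Definition pos_def_profile psi :=
  [/\ measurable_fun setT psi,
      exists B, forall l, 0 <= l -> `|psi l| <= B
    & forall a x, 0 < a -> 0 <= \int[mu]_xi
        (cos (dotRn x xi) * (expR (- (a * dotRn xi xi)) * psi (dotRn xi xi)))].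

Lemma pos_def_profile1 : pos_def_profile (cst 1).
Proof.
split => //; first by exists 1 => l _; rewrite normr1.
move=> a x a0; rewrite /Rintegral.
under eq_integral do rewrite mulr1 dotRnC -[X in cos X]addr0.
by rewrite integral_cos_gauss_Rn//= cos0 mul1r mulr_ge0// ?exprn_ge0// expR_ge0.
Qed.

Lemma pos_def_profile_gauss psi tau : 0 <= tau -> pos_def_profile psi ->
  pos_def_profile (fun l => psi l * expR (- (tau * l))).
Proof.
move=> tau0 [mpsi [B psiB] psi0]; split.
- apply: measurable_funM => //; apply: measurableT_comp => //.
  by apply: measurable_funN => //; exact: measurable_funM.
- exists B => l l0; rewrite normrM [`|expR _|]ger0_norm ?expR_ge0//.
  rewrite -[leRHS]mulr1 ler_pM// ?psiB// ?expR_ge0//.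
  by rewrite -[leRHS]expR0 ler_expR oppr_le0 mulr_ge0.
- move=> a x a0; have a1 : 0 < a + tau by rewrite ltr_wpDr.
  rewrite (@eq_Rintegral _ _ _ mu setT (fun xi => cos (dotRn x xi) *
    (expR (- ((a + tau) * dotRn xi xi)) * psi (dotRn xi xi)))) ?psi0//.
  by move=> xi _; rewrite mulrDl opprD expRD; ring.
Qed.

Lemma pos_def_profileD psi1 psi2 : pos_def_profile psi1 -> pos_def_profile psi2 ->
  pos_def_profile (fun l => psi1 l + psi2 l).
Proof.
move=> [m1 [B1 b1] p1] [m2 [B2 b2] p2]; split; first exact: measurable_funD.
- by exists (B1 + B2) => l l0; rewrite (le_trans (ler_normD _ _))// lerD ?b1 ?b2.
- move=> a x a0.
  rewrite (@eq_Rintegral _ _ _ mu setT (fun xi => cos (dotRn x xi) * (expR (- (a * dotRn xi xi)) * psi1 (dotRn xi xi)) +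
    cos (dotRn x xi) * (expR (- (a * dotRn xi xi)) * psi2 (dotRn xi xi)))); last first.
    by move=> xi _; ring.
  rewrite RintegralD//; [|exact: (integrable_cos_profile x m1 b1 a0)|exact: (integrable_cos_profile x m2 b2 a0)].
  by rewrite addr_ge0 ?p1 ?p2.
Qed.

Lemma pos_def_profileZ psi c : 0 <= c -> pos_def_profile psi ->
  pos_def_profile (fun l => c * psi l).
Proof.
move=> c0 [m1 [B1 b1] p1]; split; first exact: measurable_funM.
- by exists (c * B1) => l l0; rewrite normrM ger0_norm// ler_wpM2l// b1.
- move=> a x a0.
  rewrite (@eq_Rintegral _ _ _ mu setT (fun xi => c * (cos (dotRn x xi) * (expR (- (a * dotRn xi xi)) * psi (dotRn xi xi))))); last first.
    by move=> xi _; ring.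
  rewrite RintegralZl//; last exact: (integrable_cos_profile x m1 b1 a0).
  by rewrite mulr_ge0 ?p1.
Qed.

Lemma pos_def_profile_sum (psi_ : nat -> R -> R) k : (forall i, pos_def_profile (psi_ i)) ->
  pos_def_profile (fun l => \sum_(0 <= i < k) psi_ i l).
Proof.
move=> pp; elim: k => [|k IH].
  under eq_fun do rewrite big_geq//.
  have := pos_def_profileZ (lexx 0) pos_def_profile1.
  by under eq_fun do rewrite mul0r.
by under eq_fun do rewrite big_nat_recr//=; exact: pos_def_profileD.
Qed.

Lemma pos_def_profile_lim (psi_ : nat -> R -> R) psi B :
  measurable_fun setT psi ->
  (forall k, pos_def_profile (psi_ k)) -> (forall k l, 0 <= l -> `|psi_ k l| <= B) ->
  (forall l, 0 <= l -> psi_ k l @[k --> \oo] --> psi l) ->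
  pos_def_profile psi.
Proof.
move=> mpsi pp pB pl.
have B0 : 0 <= B by apply: le_trans (pB 0 0 _) => //; exact: normr_ge0.
have psiB l : 0 <= l -> `|psi l| <= B.
  move=> l0; have pn : `|psi_ k l| @[k --> \oo] --> `|psi l| by apply: cvg_norm; exact: pl.
  rewrite -(cvg_lim _ pn)//; apply: limr_le; first by apply/cvg_ex; exists `|psi l|.
  by apply: nearW => k; exact: pB.
split => //; first by exists B.
move=> a x a0.
pose f k xi := cos (dotRn x xi) * (expR (- (a * dotRn xi xi)) * psi_ k (dotRn xi xi)).
have mf k : measurable_fun setT (EFin \o f k).
  by have [m1 _ _] := pp k; exact: (measurable_int mu (integrable_cos_profile x m1 (pB k) a0)).
have ii := integrable_cos_profile x mpsi psiB a0.
have [] := @dominated_convergence _ _ _ mu setT measurableT (fun k => EFin \o f k)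
  (EFin \o (fun xi => cos (dotRn x xi) * (expR (- (a * dotRn xi xi)) * psi (dotRn xi xi))))
  (fun xi => B%:E * (expR (- (a * dotRn xi xi)))%:E)%E mf (measurable_int mu ii).
- apply: aeW => xi _; apply/cvg_EFin; first exact: nearW.
  by apply: cvgMr; apply: cvgMr; exact: pl (dotRn_ge0 xi).
- exact: (integrableZl measurableT B (integrable_gauss_Rn n a0)).
- apply: aeW => xi k _; rewrite lee_fin /f !normrM [`|expR _|]ger0_norm ?expR_ge0// mulrCA mulrC.
  rewrite ler_pM2r ?expR_gt0// -[leRHS]mul1r ler_pM//.
    by rewrite ler_norml cos_geN1 cos_le1.
  by rewrite pB// dotRn_ge0.
move=> _ _ H.
rewrite -lee_fin /Rintegral fineK; last exact: (integrable_fin_num _ ii).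
rewrite -(cvg_lim _ H)//; apply: lime_ge; first by apply/cvg_ex; eexists; exact: H.
apply: nearW => k; have [m1 _ p1] := pp k.
have ik := integrable_cos_profile x m1 (pB k) a0.
by have := p1 a x a0; rewrite -lee_fin /Rintegral fineK//; exact: (integrable_fin_num _ ik).
Qed.

(* [exp (- c (1 - e))] is a Poisson mixture of the powers of the Gaussian [e]. *)
Lemma pos_def_profile_poisson psi c tau : 0 <= c -> 0 <= tau -> pos_def_profile psi ->
  pos_def_profile (fun l => psi l * expR (- (c * (1 - expR (- (tau * l)))))).
Proof.
move=> c0 tau0 pp; have [mpsi [B psiB] _] := pp.
pose term i l := (expR (- c) * (c ^+ i / i`!%:R)) * (psi l * expR (- (tau * i%:R * l))).
have termE i l : term i l = psi l * expR (- c) * exp_coeff (c * expR (- (tau * l))) i.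
  rewrite /term /exp_coeff /= exprMn -expRM_natl.
  have -> : i%:R * (- (tau * l)) = - (tau * i%:R * l) by ring.
  by ring.
have sE k l : \sum_(0 <= i < k) term i l = psi l * expR (- c) * series (exp_coeff (c * expR (- (tau * l)))) k.
  by rewrite /series/= mulr_sumr; apply: eq_bigr => i _; exact: termE.
have cge0 l : 0 <= c * expR (- (tau * l)) by rewrite mulr_ge0// expR_ge0.
have scvg l : series (exp_coeff (c * expR (- (tau * l)))) k @[k --> \oo] --> expR (c * expR (- (tau * l))).
  exact: is_cvg_series_exp_coeff.
apply: (@pos_def_profile_lim (fun k l => \sum_(0 <= i < k) term i l) _ B).
- apply: measurable_funM => //; apply: measurableT_comp => //.
  apply: measurable_funN => //; apply: measurable_funM => //; apply: measurable_funB => //.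
  by apply: measurableT_comp => //; apply: measurable_funN => //; exact: measurable_funM.
- move=> k; apply: pos_def_profile_sum => i.
  apply: pos_def_profileZ; first by rewrite mulr_ge0 ?expR_ge0// divr_ge0// exprn_ge0.
  by apply: pos_def_profile_gauss => //; rewrite mulr_ge0.
- move=> k l l0; rewrite sE -mulrA normrM -[leRHS]mulr1 ler_pM// ?psiB//.
  have s0 : 0 <= series (exp_coeff (c * expR (- (tau * l)))) k.
    by apply: sumr_ge0 => i _; exact: exp_coeff_ge0.
  rewrite ger0_norm ?mulr_ge0 ?expR_ge0// expRN ler_pdivrMl ?expR_gt0// mulr1.
  apply: (@le_trans _ _ (expR (c * expR (- (tau * l))))).
    apply: nondecreasing_cvgn_le; last exact: is_cvg_series_exp_coeff.
    by apply: nondecreasing_series => i _ _; exact: exp_coeff_ge0.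
  by rewrite ler_expR ler_piMr// -[leRHS]expR0 ler_expR oppr_le0 mulr_ge0.
- move=> l l0; under eq_fun do rewrite sE.
  have -> : psi l * expR (- (c * (1 - expR (- (tau * l))))) =
     psi l * expR (- c) * expR (c * expR (- (tau * l))).
    by rewrite -mulrA -expRD; congr (_ * expR _); ring.
  by apply: cvgMr; exact: scvg.
Qed.

Lemma pos_def_profile_poisson_sum psi (c tau : nat -> R) k :
  (forall i, 0 <= c i) -> (forall i, 0 <= tau i) -> pos_def_profile psi ->
  pos_def_profile (fun l => psi l * expR (- \sum_(0 <= i < k) c i * (1 - expR (- (tau i * l))))).
Proof.
move=> c0 tau0 pp; elim: k => [|k IH].
  by under eq_fun do rewrite big_geq// oppr0 expR0 mulr1.
under eq_fun do rewrite big_nat_recr//= opprD expRD mulrA.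
exact: pos_def_profile_poisson.
Qed.

End positive_definite_profiles.

(** * The stable profile as a limit of lacunary sums *)

Section stable_profile.
Context (R : realType) (s : R) (s0 : 0 < s) (s1 : s < 1).

(* The terms of [lacunary q l = \sum_(k in Z) q ^ (- s k) (1 - exp (- q ^ k l))];
   the shift [k -> k + 1] gives [lacunary q (q l) = q ^ s lacunary q l]. *)
Definition lacunary_term (q k l : R) := q `^ (- (s * k)) * (1 - expR (- (q `^ k * l))).

Definition lacunary_up (q l : R) : R ^nat := fun i => lacunary_term q i%:R l.

Definition lacunary_down (q l : R) : R ^nat := fun i => lacunary_term q (- i.+1%:R) l.

Definition lacunary (q l : R) :=
  limn (series (lacunary_up q l)) + limn (series (lacunary_down q l)).

Section fixed_ratio.
Context (q : R) (q1 : 1 < q).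

Notation term := (lacunary_term q).
Notation up := (lacunary_up q).
Notation down := (lacunary_down q).
Notation phi := (lacunary q).

Let q0 : 0 < q. Proof. exact: lt_trans q1. Qed.

Let powR_lt1 r : r < 0 -> q `^ r < 1.
Proof. by move=> r0; rewrite /powR (gt_eqF q0) expR_lt1 pmulr_llt0// ln_gt0. Qed.

Let term_ge0 k l : 0 <= l -> 0 <= term k l.
Proof.
move=> l0; rewrite mulr_ge0 ?powR_ge0// subr_ge0 -[leRHS]expR0 ler_expR oppr_le0.
by rewrite mulr_ge0 ?powR_ge0.
Qed.

Let le_term k l l' : l <= l' -> term k l <= term k l'.
Proof.
move=> ll'; rewrite ler_wpM2l ?powR_ge0// lerD2l lerN2 ler_expR lerN2.
by rewrite ler_wpM2l// powR_ge0.
Qed.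

Let term_shift k l : term k (q * l) = q `^ s * term (k + 1) l.
Proof.
rewrite /lacunary_term [RHS]mulrA -powRD; last by rewrite (gt_eqF q0) implybT.
have -> : s - s * (k + 1) = - (s * k) by ring.
by rewrite powRD ?(gt_eqF q0) ?implybT// powRr1 ?(ltW q0)// [q * l]mulrC mulrA mulrAC.
Qed.

(** Upward the factor [1 - exp] is at most 1 and the ratio is [q^(- s)]; downward it is at most its
    argument and the ratio is [q^(s - 1)]. The two halves thus converge by [0 < s] and by [s < 1]
    respectively. *)
Let cvg_up l : 0 <= l -> cvgn (series (up l)).
Proof.
move=> l0; apply: (@series_le_cvg _ _ (geometric 1 (q `^ (- s)))).
- by move=> i; exact: term_ge0.
- by move=> i; rewrite /= mul1r exprn_ge0// powR_ge0.
- move=> i; rewrite /= mul1r -powR_mulrn ?powR_ge0// -powRrM mulNr.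
  rewrite -[leRHS]mulr1 ler_wpM2l ?powR_ge0// gerBl expR_ge0//.
- apply: is_cvg_geometric_series; rewrite ger0_norm ?powR_ge0//.
  by rewrite powR_lt1// oppr_lt0.
Qed.

Let cvg_down l : 0 <= l -> cvgn (series (down l)).
Proof.
move=> l0; apply: (@series_le_cvg _ _ (geometric (l * q `^ (s - 1)) (q `^ (s - 1)))).
- by move=> i; exact: term_ge0.
- by move=> i; rewrite /= !mulr_ge0 ?exprn_ge0 ?powR_ge0.
- move=> i; rewrite /= -mulrA -exprS -powR_mulrn ?powR_ge0// -powRrM.
  apply: (@le_trans _ _ (q `^ (- (s * - i.+1%:R)) * (q `^ (- i.+1%:R) * l))).
    rewrite ler_wpM2l ?powR_ge0//.
    by have := expR_ge1Dx (- (q `^ (- i.+1%:R) * l)); lra.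
  rewrite mulrA -powRD ?(gt_eqF q0) ?implybT// mulrC.
  by rewrite (_ : - (s * - i.+1%:R) - i.+1%:R = (s - 1) * i.+1%:R)//; ring.
- apply: is_cvg_geometric_series; rewrite ger0_norm ?powR_ge0//.
  by rewrite powR_lt1// subr_lt0.
Qed.

(** The shift moves the term of index 0 from the upper half to the lower one, so it occurs in [E1]
    and [E2] with opposite signs. *)
Let phi_shift l : 0 <= l -> phi (q * l) = q `^ s * phi l.
Proof.
move=> l0; have ql0 : 0 <= q * l by rewrite mulr_ge0// ltW.
have E1 : limn (series (up (q * l))) = q `^ s * (limn (series (up l)) - term 0 l).
  apply/cvg_lim => //.
  have -> : series (up (q * l)) = (fun n => q `^ s * (series (up l) n.+1 - term 0 l)).
    apply/funext => n; rewrite /series/= big_nat_recl//= addrAC subrr add0r mulr_sumr.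
    by apply: eq_bigr => i _; rewrite /lacunary_up term_shift natr1.
  apply: cvgMr; apply: cvgB; last exact: cvg_cst.
  by rewrite (@cvg_shiftS _ (series (up l))); exact: cvg_up.
have E2 : limn (series (down (q * l))) = q `^ s * (limn (series (down l)) + term 0 l).
  apply/cvg_lim => //; rewrite -(@cvg_shiftS _ (series (down (q * l)))).
  have -> : (fun n => series (down (q * l)) n.+1) = (fun n => q `^ s * (series (down l) n + term 0 l)).
    apply/funext => n; rewrite /series/= big_nat_recl//= addrC mulrDr mulr_sumr.
    rewrite /lacunary_down term_shift addNr; congr (_ + _).
    by apply: eq_bigr => i _; rewrite /lacunary_down term_shift -[in LHS]natr1 opprD addrNK.
  by apply: cvgMr; apply: cvgD; [exact: cvg_down|exact: cvg_cst].
apply: (etrans (f_equal2 +%R E1 E2)).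
by rewrite -mulrDr addrACA addNr addr0.
Qed.

Let le_phi l l' : 0 <= l -> l <= l' -> phi l <= phi l'.
Proof.
move=> l0 ll'; have l'0 := le_trans l0 ll'.
apply: (lerD (lim_series_le (cvg_up l0) (cvg_up l'0) _)
  (lim_series_le (cvg_down l0) (cvg_down l'0) _)) => i; exact: le_term.
Qed.

Lemma lacunary_ge0 l : 0 <= l -> 0 <= phi l.
Proof.
move=> l0; apply: addr_ge0.
  apply: limr_ge; first exact: cvg_up.
  by apply: nearW => n; apply: sumr_ge0 => i _; exact: term_ge0.
apply: limr_ge; first exact: cvg_down.
by apply: nearW => n; apply: sumr_ge0 => i _; exact: term_ge0.
Qed.

Lemma lacunary1_gt0 : 0 < phi 1.
Proof.
apply: ltr_pwDl; last first.
  apply: limr_ge; first exact: cvg_down.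
  by apply: nearW => n; apply: sumr_ge0 => i _; exact: term_ge0.
apply: (@lt_le_trans _ _ (series (up 1) 1)).
  rewrite /series/= big_nat1 /lacunary_up /lacunary_term mulr0 oppr0 !powRr0 !mul1r subr_gt0.
  by rewrite expR_lt1 oppr_lt0.
apply: nondecreasing_cvgn_le; last exact: cvg_up.
by apply: nondecreasing_series => i _ _; exact: term_ge0.
Qed.

Let phi0 : phi 0 = 0.
Proof.
have t0 k : term k 0 = 0 by rewrite /lacunary_term mulr0 oppr0 expR0 subrr mulr0.
rewrite /lacunary; have -> : series (up 0) = cst 0.
  by apply/funext => n; rewrite /series /= big1// => i _; exact: t0.
have -> : series (down 0) = cst 0.
  by apply/funext => n; rewrite /series /= big1// => i _; exact: t0.
by rewrite !lim_cst// addr0.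
Qed.

Let phi_shiftn l m : 0 <= l -> phi (q ^+ m * l) = (q ^+ m) `^ s * phi l.
Proof.
move=> l0; elim: m => [|m IH]; first by rewrite !expr0 powR1 !mul1r.
have qm0 : 0 <= q ^+ m by rewrite exprn_ge0// ltW.
rewrite exprS -mulrA phi_shift ?mulr_ge0// IH.
by rewrite mulrA -powRM// ltW.
Qed.

(** On one period, monotonicity and scaling give [phi 1 <= phi l <= phi q = q^s phi 1], while [l^s]
    itself lies in [[1, q^s]]. *)
Let phi_base l : 1 <= l <= q -> q `^ (- s) * l `^ s <= phi l / phi 1 <= q `^ s * l `^ s.
Proof.
move=> /andP[l1 lq]; have l0 : 0 <= l by apply: le_trans l1.
have p1 : phi 1 <= phi l by exact: le_phi.
have p2 : phi l <= q `^ s * phi 1.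
  by rewrite -phi_shift// mulr1; exact: le_phi.
have s0' := ltW s0.
have ls1 : 1 <= l `^ s.
  by have := ge0_ler_powR s0' ler01 l0 l1; rewrite powR1.
have lsq : l `^ s <= q `^ s by exact: (ge0_ler_powR s0' l0 (ltW q0) lq).
apply/andP; split.
  apply: (@le_trans _ _ 1); last by rewrite ler_pdivlMr ?lacunary1_gt0// mul1r.
  by rewrite powRN mulrC ler_pdivrMr ?powR_gt0// mul1r.
rewrite ler_pdivrMr ?lacunary1_gt0//; apply: le_trans p2 _; rewrite mulrAC ler_peMr//.
by rewrite mulr_ge0 ?powR_ge0// ltW// lacunary1_gt0.
Qed.

Let exists_scale l : 0 < l -> exists m, l <= q ^+ m.
Proof.
move=> l0; have q10 : 0 < q - 1 by rewrite subr_gt0.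
have := archi_boundP (ltW (divr_gt0 l0 q10)); set m := Num.bound _ => /ltW h.
exists m; move: h; rewrite ler_pdivrMr// => h; apply: le_trans h _.
have : forall k, 1 + k%:R * (q - 1) <= q ^+ k.
  elim=> [|k IH]; first by rewrite mul0r addr0.
  rewrite exprS; apply: le_trans (_ : q * (1 + k%:R * (q - 1)) <= _); last by rewrite ler_pM2l.
  have : 0 <= k%:R :> R by []. rewrite -natr1; move: k%:R => a a0; rewrite -subr_ge0.
  have -> : q * (1 + a * (q - 1)) - (1 + (a + 1) * (q - 1)) = a * (q - 1) ^+ 2 by ring.
  by rewrite mulr_ge0// sqr_ge0.
by move=> /(_ m); lra.
Qed.

Lemma lacunary_sandwich l : 0 <= l ->
  q `^ (- s) * l `^ s <= phi l / phi 1 <= q `^ s * l `^ s.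
Proof.
rewrite le_eqVlt => /predU1P[<-|l0].
  by rewrite phi0 powR0 ?gt_eqF// !mulr0 mul0r lexx.
(* push [l] above 1 by a power of q, then pull it down into [1, q] *)
have scale m l' : 0 < l' -> (q `^ (- s) * l' `^ s <= phi l' / phi 1 <= q `^ s * l' `^ s) =
    (q `^ (- s) * (q ^+ m * l') `^ s <= phi (q ^+ m * l') / phi 1 <= q `^ s * (q ^+ m * l') `^ s).
  move=> l'0; have qm0 : 0 < q ^+ m by rewrite exprn_gt0.
  rewrite phi_shiftn ?(ltW l'0)// powRM ?(ltW l'0) ?(ltW qm0)//.
  have a0 : 0 < (q ^+ m) `^ s by rewrite powR_gt0.
  move: ((q ^+ m) `^ s) a0 => a a0.
  by rewrite [q `^ (- s) * (a * _)]mulrCA [q `^ s * (a * _)]mulrCA -[a * phi l' / _]mulrA !ler_pM2l.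
have base l' : 1 <= l' -> q `^ (- s) * l' `^ s <= phi l' / phi 1 <= q `^ s * l' `^ s.
  move=> l'1; have l'0 : 0 < l' by apply: lt_le_trans l'1.
  have [m] := exists_scale l'0.
  elim: m l' l'1 l'0 => [|m IH] l' l'1 l'0 h.
    by apply: phi_base; rewrite l'1 (le_trans h)// ltW.
  have [lq|ql] := leP l' q; first by apply: phi_base; rewrite l'1.
  have -> : l' = q ^+ 1 * (l' / q) by rewrite expr1 mulrCA divff ?mulr1// gt_eqF.
  rewrite -scale ?divr_gt0//; apply: IH.
  - by rewrite ler_pdivlMr// mul1r ltW.
  - by rewrite divr_gt0.
  - by rewrite ler_pdivrMr// mulrC -exprS.
have [m hm] := @exists_scale l^-1 (ltac:(by rewrite invr_gt0)).
rewrite (scale m)//; apply: base.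
by rewrite -ler_pdivrMr// mul1r.
Qed.

(** Partial sums give finite products of Poisson factors, all bounded by 1. The absolute value makes
    the profile a limit of measurable functions on the whole line, since the series need not
    converge for negative [l]. *)
Lemma pos_def_profile_lacunary n (c : R) : 0 <= c ->
  pos_def_profile n (fun l : R => expR (- (c * phi `|l|))).
Proof.
move=> c0.
pose S k l := series (up l) k + series (down l) k.
have Scvg l : 0 <= l -> S k l @[k --> \oo] --> phi l.
  by move=> l0; apply: cvgD; [exact: cvg_up|exact: cvg_down].
have mS k : measurable_fun setT (fun l : R => expR (- (c * S k `|l|)) : R).
  have mt a : measurable_fun setT (fun l : R => term a `|l|).
    apply: measurable_funM => //; apply: measurable_funB => //; apply: measurableT_comp => //.
    by apply: measurable_funN => //; apply: measurable_funM.
  apply: measurableT_comp => //; apply: measurable_funN => //; apply: measurable_funM => //.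
  by apply: measurable_funD; apply: measurable_sum => i; exact: mt.
apply: (@pos_def_profile_lim _ _ (fun k l => expR (- (c * S k l))) _ 1).
- apply: (@measurable_fun_cvg _ _ R setT (fun k (l : R) => expR (- (c * S k `|l|)))
    (fun l : R => expR (- (c * phi `|l|))) mS).
  move=> l _; apply: (continuous_cvg _ (@continuous_expR R _)).
  by apply: cvgN; apply: cvgMr; exact: Scvg.
- move=> k; have cp a : 0 <= c * q `^ a by rewrite mulr_ge0// powR_ge0.
  have tp a : 0 <= q `^ a by exact: powR_ge0.
  have := pos_def_profile_poisson_sum k (fun i => cp (- (s * - i.+1%:R))) (fun i => tp (- i.+1%:R))
    (pos_def_profile_poisson_sum k (fun i => cp (- (s * i%:R))) (fun i => tp i%:R) (pos_def_profile1 R n)).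
  congr pos_def_profile; apply/funext => l.
  rewrite mul1r -expRD -opprD /S /series /= mulrDr !mulr_sumr.
  apply: (f_equal (fun z => expR (- z))); apply: f_equal2; apply: eq_bigr => i _.
    by rewrite -mulrA /lacunary_up /lacunary_term.
  by rewrite -mulrA /lacunary_down /lacunary_term.
- move=> k l l0; rewrite ger0_norm ?expR_ge0// -[leRHS]expR0 ler_expR oppr_le0 mulr_ge0//.
  by apply: addr_ge0; apply: sumr_ge0 => i _; exact: term_ge0.
- move=> l l0; apply: (continuous_cvg _ (@continuous_expR R _)).
  by apply: cvgN; apply: cvgMr; rewrite ger0_norm//; exact: Scvg.
Qed.

End fixed_ratio.

Lemma pos_def_profile_stable n (c : R) : 0 <= c ->
  pos_def_profile n (fun l => expR (- (c * `|l| `^ s))).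
Proof.
move=> c0.
pose q k : R := 1 + k.+1%:R^-1.
have q1 k : 1 < q k by rewrite ltrDl invr_gt0.
have q0 k : 0 < q k by exact: lt_trans (q1 k).
have cq : q k @[k --> \oo] --> (1 : R).
  rewrite -[X in _ --> X]addr0; apply: cvgD; first exact: cvg_cst.
  exact: cvg_harmonic.
have cqr r : q k `^ r @[k --> \oo] --> (1 : R).
  rewrite -[X in _ --> X](congr1 (@^~ r) (powR1 R)).
  have ca : {for (1 : R), continuous (fun x : R => x `^ r)}.
    apply: differentiable_continuous; apply/derivable1_diffP; apply: derivable_powR.
    by rewrite in_itv/= ltr01.
  exact: (continuous_cvg _ ca cq).
have pcvg l : 0 <= l -> lacunary (q k) l / lacunary (q k) 1 @[k --> \oo] --> l `^ s.
  move=> l0; apply: (@squeeze_cvgr _ _ _ _ (fun k => q k `^ (- s) * l `^ s) (fun k => q k `^ s * l `^ s)).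
  - by apply: nearW => k; exact: lacunary_sandwich.
  - by rewrite -[X in _ --> X]mul1r; apply: cvgMl; exact: cqr.
  - by rewrite -[X in _ --> X]mul1r; apply: cvgMl; exact: cqr.
have dge0 k : 0 <= c / lacunary (q k) 1 by rewrite divr_ge0// ltW// lacunary1_gt0.
apply: (@pos_def_profile_lim _ _ (fun k l => expR (- ((c / lacunary (q k) 1) * lacunary (q k) `|l|))) _ 1).
- apply: measurableT_comp => //; apply: measurable_funN => //; apply: measurable_funM => //.
  by apply: (measurableT_comp (measurable_powR s)).
- by move=> k; exact: pos_def_profile_lacunary.
- move=> k l l0; rewrite ger0_norm ?expR_ge0// -[leRHS]expR0 ler_expR oppr_le0 mulr_ge0//.
  exact: lacunary_ge0.
- move=> l l0; apply: (continuous_cvg _ (@continuous_expR R _)).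
  apply: cvgN; rewrite ger0_norm//.
  under eq_fun do rewrite -mulrA [_^-1 * _]mulrC.
  by apply: cvgMr; exact: pcvg.
Qed.

End stable_profile.

(** * The convolution semigroup *)

Section product_integrability.
Context d1 d2 (T1 : measurableType d1) (T2 : measurableType d2) (R : realType).
Context (m1 : {sigma_finite_measure set T1 -> \bar R})
  (m2 : {sigma_finite_measure set T2 -> \bar R}).

Lemma integrable_prod_dominated (f1 : T1 -> R) (f2 : T2 -> R) (F : T1 * T2 -> R) :
  m1.-integrable setT (EFin \o f1) -> m2.-integrable setT (EFin \o f2) ->
  measurable_fun setT F -> (forall z, `|F z| <= `|f1 z.1| * `|f2 z.2|) ->
  (m1 \x m2)%E.-integrable setT (EFin \o F).
Proof.
move=> i1 i2 mF Ff.
have mF1 : measurable_fun setT (fun x => `|f1 x|).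
  by apply: measurableT_comp => //; apply/measurable_EFinP; exact: measurable_int i1.
have mF2 : measurable_fun setT (fun x => `|f2 x|).
  by apply: measurableT_comp => //; apply/measurable_EFinP; exact: measurable_int i2.
have mG : measurable_fun setT (fun z : T1 * T2 => (`|f1 z.1| * `|f2 z.2|)%:E).
  apply/measurable_EFinP; apply: measurable_funM; first exact: (measurableT_comp mF1).
  exact: (measurableT_comp mF2).
have iG : (m1 \x m2)%E.-integrable setT (fun z : T1 * T2 => (`|f1 z.1| * `|f2 z.2|)%:E).
  apply/integrable12ltyP => //.
  under eq_integral => x _.
    under eq_integral => y _.
      rewrite /= ger0_norm ?mulr_ge0// EFinM.
      over.
    rewrite ge0_integralZl//=; last exact/measurable_EFinP.
    over.
  have /integrableP[_ i1'] := i1; have /integrableP[_ i2'] := i2.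
  rewrite /= ge0_integralZr//=; last 2 first.
  - exact/measurable_EFinP.
  - by apply: integral_ge0 => y _; rewrite lee_fin.
  apply: lte_mul_pinfty => //.
  - by apply: integral_ge0 => y _; rewrite lee_fin.
  - by rewrite ge0_fin_numE//; apply: integral_ge0 => y _; rewrite lee_fin.
apply: (le_integrable measurableT _ _ iG); first exact/measurable_EFinP.
move=> z _ /=; rewrite lee_fin [leRHS]ger0_norm ?mulr_ge0//.
Qed.

Lemma EFin_Rintegral (f : T1 -> R) : m1.-integrable setT (EFin \o f) ->
  ((\int[m1]_x f x)%:E = \int[m1]_x (f x)%:E)%E.
Proof. by move=> fi; rewrite /Rintegral fineK//; exact: (integrable_fin_num _ fi). Qed.

End product_integrability.

Section Rintegral_Fubini.
Context d1 d2 (T1 : measurableType d1) (T2 : measurableType d2) (R : realType).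
Context (m1 : {sigma_finite_measure set T1 -> \bar R})
  (m2 : {sigma_finite_measure set T2 -> \bar R}).
Context (F : T1 * T2 -> R).
Context (iF : (m1 \x m2)%E.-integrable setT (EFin \o F)).
Context (iF1 : forall x, m2.-integrable setT (EFin \o (fun y => F (x, y)))).
Context (iF2 : forall y, m1.-integrable setT (EFin \o (fun x => F (x, y)))).

Lemma integrable_Rintegral_section :
  m1.-integrable setT (EFin \o (fun x => \int[m2]_y F (x, y))).
Proof.
have := integrable_fubini_F iF; congr (integrable _ _); apply/funext => x.
by rewrite /fubini_F /= (EFin_Rintegral (iF1 x)).
Qed.

Lemma Rintegral_Fubini : \int[m1]_x \int[m2]_y F (x, y) = \int[m2]_y \int[m1]_x F (x, y).
Proof.
rewrite {1}/Rintegral [RHS]/Rintegral; congr fine.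
under eq_integral do rewrite (EFin_Rintegral (iF1 _)).
under [RHS]eq_integral do rewrite (EFin_Rintegral (iF2 _)).
exact: (Fubini iF).
Qed.

End Rintegral_Fubini.

(** Tonelli applies to the positive and negative parts separately, and the integral is their
    difference by definition. No integrability is involved, so the kernel is jointly measurable even
    across times [t <= 0]. *)
Lemma measurable_integral_param d1 d2 (T1 : measurableType d1) (T2 : measurableType d2)
    (R : realType) (m2 : {sigma_finite_measure set T2 -> \bar R}) (F : T1 * T2 -> R) :
  measurable_fun setT F -> measurable_fun setT (fun x => \int[m2]_y F (x, y)).
Proof.
move=> mF; apply: measurableT_comp => //.
have mE : measurable_fun setT (EFin \o F) by exact/measurable_EFinP.
have mp : measurable_fun setT (fubini_F m2 (EFin \o F)^\+%E).
  exact: (measurable_fun_fubini_tonelli_F _ (measurable_funepos mE) (fun x => funepos_ge0 _ x)).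
have mn : measurable_fun setT (fubini_F m2 (EFin \o F)^\-%E).
  exact: (measurable_fun_fubini_tonelli_F _ (measurable_funeneg mE) (fun x => funeneg_ge0 _ x)).
rewrite (_ : (fun x => _) = fubini_F m2 (EFin \o F)^\+%E \- fubini_F m2 (EFin \o F)^\-%E)%E.
  exact: emeasurable_funB.
apply/funext => x; rewrite integralE.
by rewrite /fubini_F; congr (_ - _)%E; apply: eq_integral => y _; rewrite ?funeposE ?funenegE.
Qed.

Lemma ler_norm_cos_expR (R : realType) (m u w : R) : 0 <= w ->
  `|m * cos u * expR (- w)| <= `|m|.
Proof.
move=> w0; rewrite -mulrA normrM ler_piMr// normrM -[leRHS]mulr1 ler_pM//.
  by rewrite ler_norml cos_geN1 cos_le1.
by rewrite ger0_norm ?expR_ge0// -[leRHS]expR0 ler_expR oppr_le0.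
Qed.

Lemma cvg_quarter_harmonic (R : realType) : (4 * k.+1%:R)^-1 @[k --> \oo] --> (0 : R).
Proof.
under eq_fun do rewrite invfM; rewrite -(mulr0 4^-1); apply: cvgMr.
exact: cvg_harmonic.
Qed.

(** * Mass, transform and semigroup law of the kernel *)

Section kernel.
Context (R : realType) (N : nat) (s : R) (s0 : 0 < s) (s1 : s < 1).
Notation mu := (lebesgueRn R N).
Implicit Types (t a b c : R) (x y z xi eta : Rn R N).

Definition mixed_symbol t xi : R := expR (- t * (normRn xi ^+ 2 + normRn xi `^ (2 * s))).

Lemma mixed_kernelE t x : mixed_kernel s t x =
  (2 * pi) ^- N * \int[mu]_xi (cos (dotRn x xi) * mixed_symbol t xi).
Proof. by []. Qed.

Lemma mixed_symbolE t xi : mixed_symbol t xi =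
  expR (- (t * dotRn xi xi)) * expR (- (t * `|dotRn xi xi| `^ s)).
Proof.
rewrite -expRD /mixed_symbol; congr expR.
rewrite /normRn sqr_sqrtr ?dotRn_ge0// -powR12_sqrt ?dotRn_ge0// -powRrM.
rewrite mulrA mulVf// mul1r ger0_norm ?dotRn_ge0//; ring.
Qed.

Lemma mixed_symbol_gt0 t xi : 0 < mixed_symbol t xi.
Proof. exact: expR_gt0. Qed.

Lemma mixed_symbol_le_gauss t xi : 0 <= t -> mixed_symbol t xi <= expR (- (t * dotRn xi xi)).
Proof.
move=> t0; rewrite mixed_symbolE ler_piMr ?expR_ge0//.
by rewrite -[leRHS]expR0 ler_expR oppr_le0 mulr_ge0// powR_ge0.
Qed.

Lemma mixed_symbol_le1 t xi : 0 <= t -> mixed_symbol t xi <= 1.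
Proof.
move=> t0; rewrite (le_trans (mixed_symbol_le_gauss _ t0))//.
by rewrite -[leRHS]expR0 ler_expR oppr_le0 mulr_ge0// dotRn_ge0.
Qed.

Lemma mixed_symbolD a b xi : mixed_symbol (a + b) xi = mixed_symbol a xi * mixed_symbol b xi.
Proof. by rewrite /mixed_symbol opprD mulrDl expRD. Qed.

Lemma measurable_mixed_symbol_comp d (T : measurableType d) (f : T -> R) (g : T -> Rn R N) :
  measurable_fun setT f -> measurable_fun setT g ->
  measurable_fun setT (fun p => mixed_symbol (f p) (g p)).
Proof.
move=> mf mg; under eq_fun do rewrite mixed_symbolE.
have mD : measurable_fun setT (fun p => dotRn (g p) (g p)) by exact: measurable_dotRn_comp.
apply: measurable_funM; apply: measurableT_comp => //; apply: measurable_funN => //.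
  exact: measurable_funM.
apply: measurable_funM => //; apply: (measurableT_comp (measurable_powR s)).
exact: measurableT_comp.
Qed.

Lemma measurable_mixed_symbol t : measurable_fun setT (mixed_symbol t).
Proof. by apply: measurable_mixed_symbol_comp. Qed.

Lemma integrable_mixed_symbol t : 0 < t -> mu.-integrable setT (EFin \o mixed_symbol t).
Proof.
move=> t0; apply: (integrable_gauss_dominated_Rn t0 ler01); first exact: measurable_mixed_symbol.
by move=> xi; rewrite ger0_norm ?(ltW (mixed_symbol_gt0 _ _))// mul1r mixed_symbol_le_gauss// ltW.
Qed.

Lemma cvg_mixed_symbol t eta : mixed_symbol t xi @[xi --> nbhsRn eta] --> mixed_symbol t eta.
Proof.
under eq_fun do rewrite mixed_symbolE; rewrite mixed_symbolE.
have cd := @cvg_normsq_nbhsRn R N eta.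
apply: cvgM; apply: (continuous_cvg _ (@continuous_expR R _)); apply: cvgN; apply: cvgMr => //.
by apply: powR_continuous_ge0 => //; exact: cvg_norm.
Qed.

Lemma integrable_cos_mixed_symbol t x : 0 < t ->
  mu.-integrable setT (EFin \o (fun xi => cos (dotRn x xi) * mixed_symbol t xi)).
Proof.
move=> t0; apply: (le_integrable measurableT _ _ (integrable_mixed_symbol t0)).
  apply/measurable_EFinP; apply: measurable_funM; last exact: measurable_mixed_symbol.
  exact: measurable_cos_dotRn0.
move=> xi _ /=; rewrite lee_fin normrM ler_piMl//.
by rewrite ler_norml cos_geN1 cos_le1.
Qed.

(** The symbol is the stable profile with [c = t] times the Gaussian factor with [a = t]. *)
Lemma mixed_kernel_ge0 t x : 0 < t -> 0 <= mixed_kernel s t x.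
Proof.
move=> t0; rewrite mixed_kernelE mulr_ge0//.
  by rewrite invr_ge0 exprn_ge0// mulr_ge0// pi_ge0.
have [_ _ /(_ t x t0)] := pos_def_profile_stable s0 s1 N (ltW t0).
by under eq_Rintegral do rewrite -mixed_symbolE.
Qed.

Lemma measurable_mixed_kernel_comp d (T : measurableType d) (f : T -> R) (g : T -> Rn R N) :
  measurable_fun setT f -> measurable_fun setT g ->
  measurable_fun setT (fun p => mixed_kernel s (f p) (g p)).
Proof.
move=> mf mg; apply: measurable_funM => //.
apply: (@measurable_integral_param _ _ _ _ _ mu (fun p => cos (dotRn (g p.1) p.2) * mixed_symbol (f p.1) p.2)).
apply: measurable_funM.
  apply: measurableT_comp; first exact: measurable_cos.
  by apply: measurable_dotRn_comp => //; exact: (measurableT_comp mg).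
by apply: measurable_mixed_symbol_comp => //; exact: (measurableT_comp mf).
Qed.

Lemma mixed_kernel_le0 t x : 0 < t -> mixed_kernel s t x <= (2 * pi) ^- N * \int[mu]_xi mixed_symbol t xi.
Proof.
move=> t0; rewrite mixed_kernelE ler_wpM2l//.
  by rewrite invr_ge0 exprn_ge0// mulr_ge0// pi_ge0.
apply: le_Rintegral => //; [exact: integrable_cos_mixed_symbol|exact: integrable_mixed_symbol|].
by move=> xi _; rewrite ler_piMl ?(ltW (mixed_symbol_gt0 _ _))// cos_le1.
Qed.

Lemma mixed_kernel_subC t x y : mixed_kernel s t (subRn x y) = mixed_kernel s t (subRn y x).
Proof.
rewrite !mixed_kernelE; congr (_ * _); apply: eq_Rintegral => xi _.
by rewrite !dotRnBl -cosN opprB.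
Qed.

Definition oppRn x : Rn R N := [tuple - (tnth x i : R) | i < N].

Lemma dotRnN x y : dotRn x (oppRn y) = - dotRn x y.
Proof. by rewrite /dotRn -sumrN; apply: eq_bigr => i _; rewrite tnth_mktuple mulrN. Qed.

Lemma mixed_symbolN t x : mixed_symbol t (oppRn x) = mixed_symbol t x.
Proof. by rewrite !mixed_symbolE dotRnN dotRnC dotRnN opprK. Qed.

Lemma measurable_cos_sub_dotRn c z : measurable_fun setT (fun xi => cos (c - dotRn z xi) : R).
Proof.
have md : measurable_fun setT (fun xi => dotRn z xi).
  exact: (measurable_dotRn_comp (measurable_cst z) (@measurable_id _ _ setT)).
apply: measurableT_comp; first exact: measurable_cos.
exact: (measurable_funB (measurable_cst c) md).
Qed.

(* The Gaussian factor makes Fubini applicable before the kernel is known to be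
   integrable; it is removed once the total mass has been computed. *)
Lemma mixed_kernel_gauss_transform t z eta c k : 0 < t ->
  \int[mu]_y (mixed_kernel s t (subRn y z) *
     (cos (dotRn y eta + c) * expR (- ((4 * k.+1%:R)^-1 * dotRn y y)))) =
  2^-1 * ((Num.sqrt (pi / k.+1%:R) ^+ N)^-1 * \int[mu]_xi
       (mixed_symbol t xi * cos (c - dotRn z xi) *
          expR (- (k.+1%:R * dotRn (subRn xi (oppRn eta)) (subRn xi (oppRn eta))))))
  + 2^-1 * ((Num.sqrt (pi / k.+1%:R) ^+ N)^-1 * \int[mu]_xi
       (mixed_symbol t xi * cos (- c - dotRn z xi) *
          expR (- (k.+1%:R * dotRn (subRn xi eta) (subRn xi eta))))).
Proof.
move=> t0; set a : R := k.+1%:R; set e := (4 * a)^-1.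
have a0 : 0 < a by [].
have e0 : 0 < e by rewrite invr_gt0 mulr_gt0.
pose g y := cos (dotRn y eta + c) * expR (- (e * dotRn y y)).
have ig : mu.-integrable setT (EFin \o g) by exact: integrable_cos_gauss_Rn.
have mg : measurable_fun setT g by apply/measurable_EFinP; exact: measurable_int ig.
pose F (p : Rn R N * Rn R N) := (cos (dotRn (subRn p.1 z) p.2) * mixed_symbol t p.2) * g p.1.
have mF : measurable_fun setT F.
  apply: measurable_funM; last exact: (measurableT_comp mg).
  apply: measurable_funM; last exact: (measurable_mixed_symbol_comp).
  apply: measurableT_comp; first exact: measurable_cos.
  by apply: measurable_dotRn_comp => //; apply: measurable_subRn_comp.
have iF : (mu \x mu)%E.-integrable setT (EFin \o F).
  apply: (integrable_prod_dominated ig (integrable_mixed_symbol t0)) => //.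
  move=> p; rewrite /F normrM [leRHS]mulrC ler_wpM2r// normrM ler_piMl//.
  by rewrite ler_norml cos_geN1 cos_le1.
(* The product of the two cosines splits into cosines of the sum and of the difference. Integrated
   in [y] against [exp (- e |y|^2)], they become Gaussians in [xi] centred at [- eta] and [eta], of
   parameter [1 / (4 e) = a]. *)
pose A (w : R) (v xi : Rn R N) := mixed_symbol t xi * cos (w - dotRn z xi) *
  expR (- (a * dotRn (subRn xi v) (subRn xi v))).
pose G xi := Num.sqrt (pi / e) ^+ N * 2^-1 * (A c (oppRn eta) xi + A (- c) eta xi).
have E2 xi : \int[mu]_y F (y, xi) = G xi.
  rewrite /Rintegral -[RHS]/(fine (G xi)%:E); congr fine.
  pose u1 y := cos (dotRn y (subRn xi (oppRn eta)) + (c - dotRn z xi)) * expR (- (e * dotRn y y)).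
  pose u2 y := cos (dotRn y (subRn xi eta) + (- c - dotRn z xi)) * expR (- (e * dotRn y y)).
  have i1 : mu.-integrable setT (EFin \o u1) by exact: integrable_cos_gauss_Rn.
  have i2 : mu.-integrable setT (EFin \o u2) by exact: integrable_cos_gauss_Rn.
  rewrite (eq_integral (fun y => (mixed_symbol t xi * 2^-1)%:E * ((EFin \o u1) \+ (EFin \o u2)) y)%E); last first.
    move=> y _; rewrite -[RHS]/((mixed_symbol t xi * 2^-1 * (u1 y + u2 y))%:E); congr _%:E.
    rewrite /F /g /u1 /u2 /= -mulrDl dotRnBl !dotRnBr dotRnN.
    have -> : dotRn y xi - - dotRn y eta + (c - dotRn z xi) =
      (dotRn y xi - dotRn z xi) + (dotRn y eta + c) by ring.
    have -> : dotRn y xi - dotRn y eta + (- c - dotRn z xi) =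
      (dotRn y xi - dotRn z xi) - (dotRn y eta + c) by ring.
    move: (dotRn y xi - dotRn z xi) (dotRn y eta + c) => P Q.
    by rewrite cosD cosB; field.
  rewrite (integralZl measurableT (integrableD measurableT i1 i2)).
  rewrite (integralD measurableT i1 i2).
  have v1 := integral_cos_gauss_Rn (c - dotRn z xi) (subRn xi (oppRn eta)) e0.
  have v2 := integral_cos_gauss_Rn (- c - dotRn z xi) (subRn xi eta) e0.
  apply: (etrans (f_equal (fun v => (_ * v)%E) (f_equal2 (fun v w => (v + w)%E) v1 v2))).
  rewrite -EFinD -EFinM; congr _%:E.
  have h4 u : u / (4 * e) = a * u by rewrite /e; field; exact: lt0r_neq0.
  by rewrite !h4 /G /A; ring.
have iA w v : mu.-integrable setT (EFin \o A w v).
  apply: (le_integrable measurableT _ _ (integrable_mixed_symbol t0)).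
    apply/measurable_EFinP; apply: measurable_funM; last exact: measurable_gauss_Rn.
    apply: measurable_funM; first exact: measurable_mixed_symbol.
    exact: measurable_cos_sub_dotRn.
  move=> xi _; rewrite lee_fin; apply: ler_norm_cos_expR.
  by apply: mulr_ge0; [exact: ltW|exact: dotRn_ge0].
pose H y := \int[mu]_xi F (y, xi).
have iFy y : mu.-integrable setT (EFin \o (fun xi => F (y, xi))).
  have := integrableZl measurableT (g y) (integrable_cos_mixed_symbol (subRn y z) t0).
  by congr (integrable _ _); apply/funext => xi; rewrite /= -EFinM mulrC.
have iFxi xi : mu.-integrable setT (EFin \o (fun y => F (y, xi))).
  apply: (le_integrable measurableT _ _ ig).
    have mFy : measurable_fun setT (fun y => F (y, xi)).
      exact: (measurableT_comp mF (pair2_measurable xi)).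
    exact/measurable_EFinP.
  move=> y _; rewrite lee_fin /F /= mulrC -[leRHS]mulr1 normrM ler_wpM2l//.
  rewrite normrM -[leRHS]mulr1 ler_pM//; first by rewrite ler_norml cos_geN1 cos_le1.
  by rewrite ger0_norm ?mixed_symbol_le1 ?ltW// mixed_symbol_gt0.
have iH := integrable_Rintegral_section iF iFy.
have KE y : mixed_kernel s t (subRn y z) * g y = (2 * pi) ^- N * H y.
  rewrite mixed_kernelE -mulrA; congr (_ * _).
  by rewrite /H /F /= RintegralZr//; exact: integrable_cos_mixed_symbol.
under eq_Rintegral do rewrite KE.
rewrite RintegralZl//.
rewrite (Rintegral_Fubini iF iFy iFxi).
under eq_Rintegral do rewrite E2.
rewrite /G RintegralZl//; last exact: (integrableD measurableT (iA _ _) (iA _ _)).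
rewrite (RintegralD measurableT (iA _ _) (iA _ _)).
rewrite -!mulrDr mulrA mulrA mulrA; congr (_ * _).
have pia : 0 < pi / a :> R by rewrite divr_gt0// pi_gt0.
have sa0 : Num.sqrt (pi / a) != 0 by rewrite lt0r_neq0// sqrtr_gt0.
(* Since [e = 1 / (4 a)], the two square roots multiply to [2 pi], which cancels the normalization
   of the kernel and leaves that of the approximate identity. *)
have -> : Num.sqrt (pi / e) = (2 * pi) / Num.sqrt (pi / a).
  apply: (mulIf sa0); rewrite divfK// -sqrtrM; last by rewrite divr_ge0// ?pi_ge0// ltW.
  have -> : pi / e * (pi / a) = (2 * pi) ^+ 2.
    by rewrite /e; field; exact: lt0r_neq0.
  by rewrite sqrtr_sqr ger0_norm// mulr_ge0// pi_ge0.
rewrite expr_div_n.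
have : (2 * pi : R) ^+ N != 0 by rewrite expf_neq0// mulf_neq0// lt0r_neq0// pi_gt0.
have : Num.sqrt (pi / a) ^+ N != 0 by rewrite expf_neq0.
move: ((2 * pi) ^+ N) (Num.sqrt (pi / a) ^+ N) => P Q Q0 P0.
by field; rewrite P0 Q0.
Qed.

(** The two terms concentrate at [- eta] and at [eta]; symbol and cosine being even, each
    contributes half of the limit. *)
Lemma cvg_mixed_kernel_gauss_transform t z eta c : 0 < t ->
  \int[mu]_y (mixed_kernel s t (subRn y z) *
     (cos (dotRn y eta + c) * expR (- ((4 * k.+1%:R)^-1 * dotRn y y)))) @[k --> \oo] -->
  cos (dotRn z eta + c) * mixed_symbol t eta.
Proof.
move=> t0; under eq_fun do rewrite mixed_kernel_gauss_transform//.
have H (w : R) v : (Num.sqrt (pi / k.+1%:R) ^+ N)^-1 * \int[mu]_xi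
       (mixed_symbol t xi * cos (w - dotRn z xi) *
          expR (- (k.+1%:R * dotRn (subRn xi v) (subRn xi v)))) @[k --> \oo] -->
     mixed_symbol t v * cos (w - dotRn z v).
  apply: (@gauss_approx_identity _ _ (fun xi => mixed_symbol t xi * cos (w - dotRn z xi)) 1).
  - apply: measurable_funM; first exact: measurable_mixed_symbol.
    exact: measurable_cos_sub_dotRn.
  - move=> xi; rewrite normrM -[leRHS]mulr1 ler_pM//.
      by rewrite ger0_norm ?mixed_symbol_le1 ?ltW// mixed_symbol_gt0.
    by rewrite ler_norml cos_geN1 cos_le1.
  - apply: cvgM; first exact: cvg_mixed_symbol.
    apply: (continuous_cvg _ (@continuous_cos R _)); apply: cvgB; first exact: cvg_cst.
    exact: cvg_dotRnl_nbhsRn.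
have -> : cos (dotRn z eta + c) * mixed_symbol t eta =
   2^-1 * (mixed_symbol t (oppRn eta) * cos (c - dotRn z (oppRn eta))) +
   2^-1 * (mixed_symbol t eta * cos (- c - dotRn z eta)).
  by rewrite mixed_symbolN dotRnN opprK -opprD cosN [c + _]addrC; field.
by apply: cvgD; apply: cvgMr; exact: H.
Qed.

Lemma measurable_mixed_kernel_shift t z : measurable_fun setT (fun y => mixed_kernel s t (subRn y z)).
Proof.
by apply: measurable_mixed_kernel_comp => //; exact: measurable_subRn_comp.
Qed.

(** The Gaussian weights increase to 1, so positivity alone identifies the mass with the limit of
    the weighted transforms at frequency 0, where the symbol is 1. *)
Lemma mixed_kernel_mass t z : 0 < t ->
  (\int[mu]_y (mixed_kernel s t (subRn y z))%:E = 1)%E.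
Proof.
move=> t0.
pose e k : R := (4 * k.+1%:R)^-1.
have e0 k : 0 < e k by rewrite invr_gt0 mulr_gt0.
pose g k y := mixed_kernel s t (subRn y z) * expR (- (e k * dotRn y y)).
have mK := measurable_mixed_kernel_shift t z.
have mg k : measurable_fun setT (g k).
  by apply: measurable_funM => //; exact: measurable_gauss0_Rn.
have K0 y : 0 <= mixed_kernel s t (subRn y z) by exact: mixed_kernel_ge0.
have g0 k y : 0 <= g k y by rewrite mulr_ge0// expR_ge0.
have ig k : mu.-integrable setT (EFin \o g k).
  pose B := (2 * pi) ^- N * \int[mu]_xi mixed_symbol t xi.
  have B0 : 0 <= B by apply: le_trans (mixed_kernel_le0 (subRn z z) t0); exact: mixed_kernel_ge0.
  apply: (integrable_gauss_dominated_Rn (e0 k) B0 (mg k)).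
  by move=> y; rewrite ger0_norm// /g ler_pM2r ?expR_gt0// mixed_kernel_le0.
have cg : (\int[mu]_y (g k y)%:E)%E @[k --> \oo] --> (\int[mu]_y (mixed_kernel s t (subRn y z))%:E)%E.
  have -> : (\int[mu]_y (mixed_kernel s t (subRn y z))%:E = \int[mu]_y (limn (fun k => (g k y)%:E)))%E.
    apply: eq_integral => y _; apply/esym/cvg_lim => //; apply/cvg_EFin; first exact: nearW.
    rewrite -[X in _ --> X]mulr1; apply: cvgMr.
    rewrite -expR0; apply: (continuous_cvg _ (@continuous_expR R _)).
    rewrite -oppr0; apply: cvgN; rewrite -(mul0r (dotRn y y)); apply: cvgMl.
    exact: cvg_quarter_harmonic.
  apply: cvg_monotone_convergence => //.
  - by move=> k; apply/measurable_EFinP.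
  - by move=> k y _; rewrite lee_fin.
  - move=> y _ j k jk; rewrite lee_fin ler_wpM2l// ler_expR lerN2 ler_wpM2r ?dotRn_ge0//.
    by rewrite lef_pV2 ?posrE ?mulr_gt0// ler_pM2l// ler_nat.
have H0 : (\int[mu]_y (g k y)%:E)%E @[k --> \oo] --> 1%E.
  (* [oppRn (subRn z z)] is the zero frequency. *)
  have := @cvg_mixed_kernel_gauss_transform t z (oppRn (subRn z z)) 0 t0.
  have dz y : dotRn y (oppRn (subRn z z)) = 0 by rewrite dotRnN dotRnBr subrr oppr0.
  rewrite dz addr0 cos0 mul1r mixed_symbolN mixed_symbolE dotRnBl subrr normr0 powR0 ?gt_eqF//.
  rewrite !mulr0 oppr0 expR0 mul1r.
  under eq_fun => k.
    under eq_Rintegral do rewrite dz addr0 cos0 mul1r -/(g k _).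
    over.
  move=> H1; apply: cvg_EFin; last exact: H1.
  by apply: nearW => k; exact: (integrable_fin_num _ (ig k)).
exact: (cvg_unique _ cg H0).
Qed.

Lemma integrable_mixed_kernel t z : 0 < t ->
  mu.-integrable setT (EFin \o (fun y => mixed_kernel s t (subRn y z))).
Proof.
move=> t0; apply/integrableP; split.
  by apply/measurable_EFinP; exact: measurable_mixed_kernel_shift.
under eq_integral do rewrite /= ger0_norm ?mixed_kernel_ge0//.
by rewrite mixed_kernel_mass// ltry.
Qed.

Lemma mixed_kernel_transform t z eta c : 0 < t ->
  \int[mu]_y (mixed_kernel s t (subRn y z) * cos (dotRn y eta + c)) =
  cos (dotRn z eta + c) * mixed_symbol t eta.
Proof.
move=> t0; have iK := integrable_mixed_kernel z t0.
have K0 y : 0 <= mixed_kernel s t (subRn y z) by exact: mixed_kernel_ge0.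
have mK := measurable_mixed_kernel_shift t z.
pose e k : R := (4 * k.+1%:R)^-1.
have e0 k : 0 < e k by rewrite invr_gt0 mulr_gt0.
pose g k y := mixed_kernel s t (subRn y z) * (cos (dotRn y eta + c) * expR (- (e k * dotRn y y))).
pose h y := mixed_kernel s t (subRn y z) * cos (dotRn y eta + c).
have mh : measurable_fun setT h.
  by apply: measurable_funM => //; exact: measurable_cos_dotRn.
have mg k : measurable_fun setT (g k).
  apply: measurable_funM => //; apply: measurable_funM; first exact: measurable_cos_dotRn.
  exact: measurable_gauss0_Rn.
have gK k y : `|g k y| <= mixed_kernel s t (subRn y z).
  rewrite /g mulrA; apply: le_trans (ler_norm_cos_expR _ _ _) _; last by rewrite ger0_norm.
  by apply: mulr_ge0; [exact: ltW|exact: dotRn_ge0].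
have hK y : `|h y| <= mixed_kernel s t (subRn y z).
  rewrite /h normrM ger0_norm// ler_piMr//.
  by rewrite ler_norml cos_geN1 cos_le1.
have ih : mu.-integrable setT (EFin \o h).
  apply: (le_integrable measurableT _ _ iK); first exact/measurable_EFinP.
  by move=> y _; rewrite lee_fin [leRHS]ger0_norm.
have ig k : mu.-integrable setT (EFin \o g k).
  apply: (le_integrable measurableT _ _ iK); first exact/measurable_EFinP.
  by move=> y _; rewrite lee_fin [leRHS]ger0_norm.
have [] := @dominated_convergence _ _ _ mu setT measurableT (fun k => EFin \o g k) (EFin \o h)
  (EFin \o (fun y => mixed_kernel s t (subRn y z))).
- by move=> k; apply/measurable_EFinP.
- exact/measurable_EFinP.
- apply: aeW => y _; apply/cvg_EFin; first exact: nearW.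
  rewrite /g /h; apply: cvgMr; rewrite -[X in _ --> X]mulr1; apply: cvgMr.
  rewrite -expR0; apply: (continuous_cvg _ (@continuous_expR R _)).
  rewrite -oppr0; apply: cvgN; rewrite -(mul0r (dotRn y y)); apply: cvgMl.
  exact: cvg_quarter_harmonic.
- exact: iK.
- by apply: aeW => y k _; rewrite lee_fin.
move=> _ _ H1.
have H2 : (\int[mu]_y (g k y)%:E)%E @[k --> \oo] --> (cos (dotRn z eta + c) * mixed_symbol t eta)%:E.
  apply: cvg_EFin; last exact: (@cvg_mixed_kernel_gauss_transform t z eta c t0).
  by apply: nearW => k; exact: (integrable_fin_num _ (ig k)).
have E : (\int[mu]_y (h y)%:E = (cos (dotRn z eta + c) * mixed_symbol t eta)%:E)%E.
  exact: (cvg_unique _ H1 H2).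
by rewrite /Rintegral E.
Qed.

(** Only the first kernel is replaced by its cosine integral; integrating the second one in [y]
    against that cosine is its transform, which multiplies the two symbols. *)
Lemma mixed_kernel_semigroup a b x z : 0 < a -> 0 < b ->
  (\int[mu]_y (mixed_kernel s a (subRn x y) * mixed_kernel s b (subRn y z))%:E =
  (mixed_kernel s (a + b) (subRn x z))%:E)%E.
Proof.
move=> a0 b0; have iK := integrable_mixed_kernel z b0.
have K0 y : 0 <= mixed_kernel s b (subRn y z) by exact: mixed_kernel_ge0.
have mK := measurable_mixed_kernel_shift b z.
pose F (p : Rn R N * Rn R N) := mixed_kernel s b (subRn p.1 z) * (cos (dotRn (subRn x p.1) p.2) * mixed_symbol a p.2).
have cle u : `|cos u : R| <= 1 by rewrite ler_norml cos_geN1 cos_le1.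
have mF : measurable_fun setT F.
  apply: measurable_funM; first exact: (measurableT_comp mK).
  apply: measurable_funM; last exact: measurable_mixed_symbol_comp.
  apply: measurableT_comp; first exact: measurable_cos.
  by apply: measurable_dotRn_comp => //; exact: measurable_subRn_comp.
have iF : (mu \x mu)%E.-integrable setT (EFin \o F).
  apply: (integrable_prod_dominated iK (integrable_mixed_symbol a0)) => //.
  by move=> p; rewrite /F normrM ler_wpM2l// normrM ler_piMl.
have iF1 y : mu.-integrable setT (EFin \o (fun xi => F (y, xi))).
  exact: (integrableZl measurableT (mixed_kernel s b (subRn y z)) (integrable_cos_mixed_symbol (subRn x y) a0)).
have iF2 xi : mu.-integrable setT (EFin \o (fun y => F (y, xi))).
  apply: (le_integrable measurableT _ _ iK).
    have mFy : measurable_fun setT (fun y => F (y, xi)).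
      exact: (measurableT_comp mF (pair2_measurable xi)).
    exact/measurable_EFinP.
  move=> y _; rewrite lee_fin /F /= normrM ler_piMr// normrM -[leRHS]mulr1 ler_pM//.
  by rewrite ger0_norm ?mixed_symbol_le1 ?ltW// mixed_symbol_gt0.
have KE y : mixed_kernel s a (subRn x y) * mixed_kernel s b (subRn y z) =
    (2 * pi) ^- N * \int[mu]_xi F (y, xi).
  rewrite mixed_kernelE -mulrA; congr (_ * _); rewrite mulrC.
  by rewrite /F /= RintegralZl//; exact: integrable_cos_mixed_symbol.
have iH := integrable_Rintegral_section iF iF1.
under eq_integral do rewrite KE.
rewrite -EFin_Rintegral; last exact: (integrableZl measurableT _ iH).
congr _%:E; rewrite RintegralZl//; rewrite (Rintegral_Fubini iF iF1 iF2) mixed_kernelE; congr (_ * _).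
apply: eq_Rintegral => xi _.
have -> : \int[mu]_y F (y, xi) = \int[mu]_y (mixed_kernel s b (subRn y z) * cos (dotRn y xi - dotRn x xi)) * mixed_symbol a xi.
  rewrite -RintegralZr//.
    by apply: eq_Rintegral => y _; rewrite /F /= dotRnBl -cosN opprB mulrA.
  apply: (le_integrable measurableT _ _ iK).
    apply/measurable_EFinP; apply: measurable_funM => //; exact: measurable_cos_dotRn.
  by move=> y _; rewrite lee_fin /= normrM ler_piMr.
by rewrite mixed_kernel_transform// -mulrA -mixed_symbolD dotRnBl -cosN opprB [b + a]addrC.
Qed.

End kernel.

(** * Kernel bounds *)

Section scalar_estimates.
Context (R : realType).
Implicit Types (r x v : R).
Notation mu := (@lebesgue_measure R).

Lemma integral_cauchy_density r : 0 < r ->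
  (\int[mu]_x ((1 + (r * x) ^+ 2)^-1)%:E = (pi / r)%:E)%E.
Proof.
move=> r0; pose f x := (1 + (r * x) ^+ 2)^-1.
have f0 x : 0 <= f x by rewrite invr_ge0 addr_ge0// sqr_ge0.
have cf : continuous f.
  move=> x; apply: cvgV; first by rewrite gt_eqF// ltr_pwDl// sqr_ge0.
  apply: cvgD; first exact: cvg_cst.
  by rewrite expr2; apply: cvgM; apply: cvgMr; exact: cvg_id.
have dF x : is_derive x 1 (fun x => atan (r * x) / r) (f x).
  apply: is_derive_eq; rewrite /f /GRing.scale/=; field.
  by rewrite !gt_eqF// ltr_pwDl// sqr_ge0.
rewrite (ge0_symfun_integralT f0 cf); last by move=> x; rewrite /f/= mulrN sqrrN.
rewrite -set_itvcy.
rewrite (@ge0_continuous_FTC2y R f (fun x => atan (r * x) / r) 0 (pi / 2 / r)).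
- by rewrite mulr0 atan0 mul0r sube0 -EFinM; congr _%:E; field; exact: lt0r_neq0.
- by move=> x _.
- exact: continuous_subspaceT.
- apply: cvgMl; apply: (@cvg_comp _ _ _ (fun x => r * x) (@atan R) _ (+oo)); last exact: cvgy_atan.
  exact: gt0_cvgMry.
- by move=> x _; exact: ex_derive.
- have ca : {for 0, continuous (fun x : R => atan (r * x) / r)}.
    by apply: differentiable_continuous; apply/derivable1_diffP; exact: ex_derive.
  by apply: cvg_at_right_filter; exact: ca.
- by move=> x _; rewrite derive1E; exact: derive_val.
Qed.

(** With [s (k + 1) >= n], the Taylor term of order [k + 1] of [exp (v^s)] dominates
    [v^n / (k + 1)!] for [v >= 1]; the factor [2^n] passes from [v] to [1 + v]. *)
Lemma expR_neg_powR_le (s : R) (n : nat) : 0 < s -> exists2 M : R, 0 < M &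
  forall v, 0 <= v -> expR (- v `^ s) <= M / (1 + v) ^+ n.
Proof.
move=> s0; have := archi_boundP (divr_ge0 (ler0n R n) (ltW s0)).
set k := Num.bound _ => kn.
have kn' : n%:R <= s * k.+1%:R.
  rewrite mulrC -ler_pdivrMr// (le_trans (ltW kn))// ler_nat//.
exists (2 ^+ n * k.+1`!%:R); first by rewrite mulr_gt0// ltr0n fact_gt0.
move=> v v0; rewrite expRN ler_pdivlMr; last by rewrite exprn_gt0// ltr_pwDl.
rewrite mulrC ler_pdivrMr ?expR_gt0//.
have [v1|v1] := leP v 1.
  apply: (@le_trans _ _ (2 ^+ n)).
    by rewrite lerXn2r ?nnegrE ?addr_ge0//; lra.
  rewrite -mulrA ler_peMr ?exprn_ge0// -[leLHS]mulr1 ler_pM//.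
    by rewrite ler1n fact_gt0.
  by rewrite -expR0 ler_expR powR_ge0.
apply: (@le_trans _ _ ((2 * v) ^+ n)).
  by rewrite lerXn2r ?nnegrE ?addr_ge0 ?mulr_ge0//; lra.
rewrite exprMn -mulrA ler_pM2l ?exprn_gt0//.
have f0 : 0 < k.+1`!%:R :> R by rewrite ltr0n fact_gt0.
have : (v `^ s) ^+ k.+1 / k.+1`!%:R <= expR (v `^ s).
  by have := expR_ge1Dxn k (powR_ge0 v s); lra.
rewrite ler_pdivrMr// mulrC; apply: le_trans.
rewrite -(powR_mulrn n v0) -(powR_mulrn k.+1 (powR_ge0 v s)) -powRrM.
by rewrite ler_powR// ltW.
Qed.

Lemma prodr_1D_le n (a : 'I_n -> R) v : (forall i, 0 <= a i <= v) ->
  \prod_(i < n) (1 + a i) <= (1 + v) ^+ n.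
Proof.
move=> av; rewrite -[X in _ ^+ X]card_ord -prodr_const; apply: ler_prod => i _.
by have /andP[a0 a1] := av i; rewrite addr_ge0//= lerD2l.
Qed.

Lemma cos_ge_cos1 x : `|x| <= 1 -> cos 1 <= cos x :> R.
Proof.
move=> x1; have -> : cos x = cos `|x| by have [_|_] := ger0P x; rewrite ?cosN.
have /orP[/eqP ->//|x1'] : (`|x| == 1) || (`|x| < 1) by rewrite -le_eqVlt.
have pi2 := pi_ge2 R.
rewrite ltW// ltr_cos// in_itv/= ?normr_ge0/= ?ler01/=; last lra.
by rewrite (le_trans x1)//; lra.
Qed.

(** A Taylor term of order [k + 1] with [k >= b] leaves a spare factor [T], which absorbs the
    constant [D]. *)
Lemma expR_le_powRN (a b C : R) : 0 < a -> 0 <= b -> 0 <= C ->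
  exists2 T0 : R, 1 <= T0 & forall T, T0 <= T -> C * expR (- (a * T)) <= T `^ (- b).
Proof.
move=> a0 b0 C0; set k := Num.bound b; have bk : b <= k%:R by rewrite ltW// archi_boundP.
pose D : R := C * k.+1`!%:R / a ^+ k.+1.
have f0 : 0 < k.+1`!%:R :> R by rewrite ltr0n fact_gt0.
have ak0 : 0 < a ^+ k.+1 by rewrite exprn_gt0.
have D0 : 0 <= D by exact: (divr_ge0 (mulr_ge0 C0 (ltW f0)) (ltW ak0)).
exists (1 + D) => [|T TT0]; first by rewrite lerDl.
have T1 : 1 <= T by lra.
have T0 : 0 < T by lra.
rewrite powRN expRN ler_pdivrMr ?expR_gt0// ler_pdivlMl ?powR_gt0//.
apply: (@le_trans _ _ ((a * T) ^+ k.+1 / k.+1`!%:R)); last first.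
  by have := expR_ge1Dxn k (ltW (mulr_gt0 a0 T0)); lra.
rewrite ler_pdivlMr// exprMn -ler_pdivrMl//.
apply: (@le_trans _ _ (T ^+ k * D)).
  have : T `^ b <= T ^+ k by rewrite -powR_mulrn ?ler_powR// ltW.
  have -> : (a ^+ k.+1)^-1 * (T `^ b * C * k.+1`!%:R) = T `^ b * D.
    by rewrite /D; field; exact: lt0r_neq0.
  by move=> h; rewrite ler_wpM2r.
by rewrite exprSr ler_wpM2l ?exprn_ge0//; lra.
Qed.

End scalar_estimates.

Section kernel_bounds.
Context (R : realType) (N : nat) (s : R) (s0 : 0 < s) (s1 : s < 1).
Notation mu := (lebesgueRn R N).
Implicit Types (t : R) (x y z xi : Rn R N).

(** Without its Gaussian factor the symbol is [exp (- (r^2 |xi|^2)^s)] with [r = t^(1 / (2 s))]. It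
    lies below a multiple of the product over the coordinates of [1 / (1 + (r xi_i)^2)], and each
    factor has integral [pi / r]. *)
Lemma mixed_symbol_integral_le : exists2 C : R, 0 < C & forall t, 0 < t ->
  \int[mu]_xi mixed_symbol s t xi <= C * t `^ (- (N%:R / (2 * s))).
Proof.
have [M M0 HM] := expR_neg_powR_le N s0.
exists (M * pi ^+ N) => [|t t0]; first by rewrite mulr_gt0// exprn_gt0// pi_gt0.
pose r := t `^ (2 * s)^-1.
have r0 : 0 < r by exact: powR_gt0.
have rs : (r ^+ 2) `^ s = t.
  rewrite -(powR_mulrn 2 (ltW r0)) /r -!powRrM.
  by rewrite mulVf ?powRr1 ?(ltW t0)// mulf_neq0// lt0r_neq0.
have rN : r ^- N = t `^ (- (N%:R / (2 * s))).
  by rewrite powRN mulrC powRrM powR_mulrn ?(ltW r0).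
pose F (i : 'I_N) (a : R) := (1 + (r * a) ^+ 2)^-1.
have F0 i a : 0 <= F i a by rewrite invr_ge0 addr_ge0// sqr_ge0.
have mF i : measurable_fun setT (F i).
  apply: continuous_measurable_fun => a; apply: cvgV; first by rewrite gt_eqF// ltr_pwDl// sqr_ge0.
  apply: cvgD; first exact: cvg_cst.
  by rewrite expr2; apply: cvgM; apply: cvgMr; exact: cvg_id.
have FI := ge0_integral_prod_Rn mF F0 (fun i => integral_cauchy_density r0).
have bound xi : mixed_symbol s t xi <= M * \prod_(i < N) F i (tnth xi i).
  rewrite mixed_symbolE; apply: (@le_trans _ _ (expR (- (t * `|dotRn xi xi| `^ s)))).
    by rewrite ler_piMl ?expR_ge0// -[leRHS]expR0 ler_expR oppr_le0 mulr_ge0 ?dotRn_ge0// ltW.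
  rewrite ger0_norm ?dotRn_ge0// -{1}rs -powRM ?exprn_ge0 ?dotRn_ge0 ?(ltW r0)//.
  have v0 : 0 <= r ^+ 2 * dotRn xi xi by rewrite mulr_ge0 ?dotRn_ge0 ?exprn_ge0// ltW.
  apply: (le_trans (HM _ v0)); rewrite ler_pM2l//.
  have P0 : 0 < \prod_(i < N) (1 + (r * tnth xi i) ^+ 2).
    by apply: prodr_gt0 => i _; rewrite ltr_pwDl// sqr_ge0.
  have -> : \prod_(i < N) F i (tnth xi i) = (\prod_(i < N) (1 + (r * tnth xi i) ^+ 2))^-1.
    by rewrite -prodfV.
  rewrite lef_pV2 ?posrE ?exprn_gt0//; last by rewrite ltr_pwDl.
  apply: prodr_1D_le => i; rewrite sqr_ge0/= exprMn ler_pM2l ?exprn_gt0//.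
  exact: dotRn_ge_coord.
have mP : measurable_fun setT (fun xi => \prod_(i < N) F i (tnth xi i)).
  by apply: measurable_prod => i _; exact: (measurableT_comp (mF i) (measurable_tnth i)).
rewrite -mulrA -[pi ^+ N * _]mulrC -rN.
have -> : r ^- N * pi ^+ N = (pi / r) ^+ N by rewrite expr_div_n mulrC.
rewrite -lee_fin (EFin_Rintegral (integrable_mixed_symbol _ _ t0))//.
apply: (@le_trans _ _ (\int[mu]_xi (M%:E * (\prod_(i < N) F i (tnth xi i))%:E))%E).
  apply: ge0_le_integral => //.
  - by move=> xi _; rewrite lee_fin ltW// mixed_symbol_gt0.
  - by apply/measurable_EFinP; exact: measurable_mixed_symbol.
  - by apply/measurable_EFinP; apply: measurable_funM.
  - by move=> xi _; rewrite -EFinM lee_fin.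
rewrite ge0_integralZl//.
- by rewrite FI -EFinM lee_fin prodr_const card_ord.
- exact/measurable_EFinP.
- by move=> xi _; rewrite lee_fin prodr_ge0.
- by rewrite lee_fin ltW.
Qed.

Lemma mixed_kernel_upper : exists2 C : R, 0 < C & forall t x, 0 < t ->
  mixed_kernel s t x <= C * t `^ (- (N%:R / (2 * s))).
Proof.
have [C C0 HC] := mixed_symbol_integral_le.
have c0 : 0 < (2 * pi : R) ^- N by rewrite invr_gt0 exprn_gt0// mulr_gt0// pi_gt0.
exists ((2 * pi) ^- N * C) => [|t x t0]; first exact: mulr_gt0.
apply: (le_trans (mixed_kernel_le0 _ _ t0)).
by rewrite -mulrA ler_pM2l// HC.
Qed.

Definition cubeRn (a : R) : set (Rn R N) := [set x | forall i, 0 <= (tnth x i : R) <= a].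

Lemma cubeRn_indicE a x : \1_(cubeRn a) x = \prod_(i < N) (\1_`[0, a] (tnth x i : R) : R).
Proof.
rewrite indicE; have [xa|xa] := pselect (cubeRn a x).
  rewrite mem_set// big1// => i _; rewrite indicE mem_set//= in_itv/=.
  exact: xa.
rewrite memNset//; have /existsNP[i xi] := xa.
by rewrite (bigD1 i)//= indicE memNset ?mul0r//= in_itv.
Qed.

Lemma measurable_cubeRn a : measurable (cubeRn a).
Proof.
have -> : cubeRn a = \bigcap_(i in [set: 'I_N]) ((fun x : Rn R N => tnth x i) @^-1` `[0, a]).
  apply/seteqP; split => x /= h i; first by move=> _; rewrite /= in_itv/=; exact: h.
  by have := h i I; rewrite /= in_itv.
apply: fin_bigcap_measurable => // i _; rewrite -[X in measurable X]setTI.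
by apply: (measurable_tnth i) => //; exact: measurable_itv.
Qed.

Lemma measure_cubeRn a : 0 <= a -> mu (cubeRn a) = (a ^+ N)%:E.
Proof.
move=> a0; transitivity (\int[mu]_x (\1_(cubeRn a) x)%:E)%E.
  by rewrite integral_indic ?setIT//; exact: measurable_cubeRn.
under eq_integral do rewrite cubeRn_indicE.
rewrite (ge0_integral_prod_Rn (f := fun _ => \1_`[0, a]) (c := fun=> a)).
- by rewrite prodr_const card_ord.
- by move=> i; exact: measurable_indic.
- by move=> i x; rewrite indicE.
- by move=> i; rewrite integral_indic//= setIT lebesgue_measure_itv/= lte_fin oppr0 adde0; case: ltgtP a0 => // <-.
Qed.

Lemma lebesgueRn_gt0 : (0 < mu setT)%E.
Proof.
apply: (@lt_le_trans _ _ (mu (cubeRn 1))).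
  by rewrite measure_cubeRn// expr1n.
by apply: le_measure; rewrite ?inE//; exact: measurable_cubeRn.
Qed.

Lemma dotRn_sq_cube a x : 0 <= a -> cubeRn a x -> dotRn x x <= N%:R * a ^+ 2.
Proof.
move=> a0 xa; apply: (@le_trans _ _ (\sum_(i < N) a ^+ 2)).
  apply: ler_sum => i _; have /andP[x0 x1] := xa i.
  by rewrite -expr2 lerXn2r ?nnegrE.
by rewrite sumr_const card_ord mulr_natl.
Qed.

(** Young's inequality with weight [rho] in each coordinate, once for each sign [e] of the
    product. *)
Lemma dotRn_norm_le1 (rho : R) z xi : 0 < rho -> dotRn z z <= rho -> rho * dotRn xi xi <= 1 ->
  `|dotRn z xi| <= 1.
Proof.
move=> rho0 zr xr.
have h (e : R) : e ^+ 2 = 1 -> 2 * (e * dotRn z xi) <= dotRn z z / rho + rho * dotRn xi xi.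
  move=> e1; rewrite /dotRn !mulr_sumr mulr_suml -big_split/=; apply: ler_sum => i _.
  set a : R := tnth z i; set b : R := tnth xi i.
  have : 0 <= (a - e * rho * b) ^+ 2 / rho by rewrite divr_ge0 ?sqr_ge0// ltW.
  have -> : (a - e * rho * b) ^+ 2 / rho = a * a / rho + e ^+ 2 * rho * (b * b) - 2 * (e * (a * b)).
    by field; exact: lt0r_neq0.
  by rewrite e1; lra.
have zr' : dotRn z z / rho <= 1 by rewrite ler_pdivrMr// mul1r.
have h1 := h 1 (expr1n _ _); have h2 := h (- 1) (sqrr_sign _ 1).
by rewrite ler_norml; apply/andP; split; lra.
Qed.

Lemma mixed_kernel_lower (rho : R) : 0 < rho -> exists2 c : R, 0 < c &
  exists2 T0 : R, 1 <= T0 & forall t z, T0 <= t -> dotRn z z <= rho ->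
    c * t `^ (- (N%:R / (2 * s))) <= mixed_kernel s t z.
Proof.
move=> rho0; pose k0 : R := expR (- (N%:R + N%:R `^ s)).
have k00 : 0 < k0 by exact: expR_gt0.
have c10 := cos1_gt0 R.
pose b : R := N%:R / (2 * s).
have b0 : 0 <= b by rewrite divr_ge0// mulr_ge0// ltW.
(* Chosen so that, for large [t], the Gaussian correction [E] below removes at most half of the
   contribution of the cube. *)
pose C := expR rho^-1 * Num.sqrt pi ^+ N * 2 / (cos 1 * k0).
have ck : 0 < cos 1 * k0 by exact: mulr_gt0.
have C0 : 0 <= C by rewrite divr_ge0 ?(ltW ck)// !mulr_ge0 ?expR_ge0 ?exprn_ge0.
have ri : 0 < rho^-1 by rewrite invr_gt0.
have [T1 T11 HT1] := expR_le_powRN ri b0 C0.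
have P0 : 0 < (2 * pi : R) ^- N by rewrite invr_gt0 exprn_gt0// mulr_gt0// pi_gt0.
exists ((2 * pi) ^- N * (cos 1 * k0 / 2)); first by rewrite mulr_gt0// divr_gt0.
exists (T1 + rho * N%:R); first by rewrite (le_trans T11)// lerDl mulr_ge0// ltW.
move=> t z tT zr.
have rN0 : 0 <= rho * N%:R by rewrite mulr_ge0// ltW.
have t1 : 1 <= t by lra.
have t0 : 0 < t by lra.
(* This side gives [t (a^2)^s = 1], and [t a^2 <= 1] because [t >= 1] and [s < 1]. On the cube the
   exponent of the symbol is then at most [N + N^s], whence [k0], and the volume [a^N] is the
   claimed rate. *)
pose a := t `^ (- (2 * s)^-1).
have a0 : 0 <= a by exact: powR_ge0.
have a2 : a ^+ 2 = t `^ (- s^-1).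
  rewrite -powR_mulrn// /a -powRrM; congr (_ `^ _); field; exact: lt0r_neq0.
have aN : a ^+ N = t `^ (- b).
  by rewrite -powR_mulrn// /a -powRrM /b mulNr mulrC.
have ta2 : t * a ^+ 2 <= 1.
  rewrite a2 powRN ler_pdivrMr ?powR_gt0// mul1r -[leLHS](powRr1 (ltW t0)).
  by rewrite ler_powR// -[leLHS]invr1 lef_pV2 ?posrE// ltW.
have a2s : t * (a ^+ 2) `^ s = 1.
  rewrite a2 -powRrM mulNr mulVf ?gt_eqF// powRN powRr1 ?(ltW t0)// divff// gt_eqF//.
have ra2 : rho * (N%:R * a ^+ 2) <= 1.
  apply: le_trans ta2; rewrite mulrA ler_wpM2r ?sqr_ge0//; lra.
have box xi : cubeRn a xi -> k0 <= mixed_symbol s t xi /\ rho * dotRn xi xi <= 1.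
  move=> /(dotRn_sq_cube a0) xa; have d0 := dotRn_ge0 xi; split; last first.
    by apply: le_trans ra2; rewrite ler_pM2l.
  rewrite mixed_symbolE -expRD ler_expR opprD lerD// lerN2.
    apply: (@le_trans _ _ (t * (N%:R * a ^+ 2))); first by rewrite ler_pM2l.
    by rewrite mulrCA ler_piMr.
  rewrite ger0_norm//; apply: (@le_trans _ _ (t * (N%:R * a ^+ 2) `^ s)).
    by rewrite ler_pM2l// ge0_ler_powR ?nnegrE ?mulr_ge0 ?sqr_ge0// ltW.
  by rewrite powRM ?sqr_ge0// mulrCA a2s mulr1.
(* Of [exp (- t |xi|^2)] one unit of time is kept for integrability; the remaining [t - 1] yields
   the factor [E] where [rho |xi|^2 > 1]. *)
pose E := expR (- ((t - 1) / rho)).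
have E0 : 0 <= E by exact: expR_ge0.
(* On the cube of side [a] the phase is at most 1 and the symbol at least [k0];
   the cosine can be negative only where [rho |xi|^2 > 1], and there the symbol
   is exponentially small in [t]. *)
have point xi : cos 1 * k0 * \1_(cubeRn a) xi - E * expR (- (1 * dotRn xi xi)) <=
    cos (dotRn z xi) * mixed_symbol s t xi.
  have m0 := mixed_symbol_gt0 s t xi.
  have g0 : 0 <= E * expR (- (1 * dotRn xi xi)) by rewrite mulr_ge0// expR_ge0.
  have [xr|xr] := leP (rho * dotRn xi xi) 1.
    have cz := cos_ge_cos1 (dotRn_norm_le1 rho0 zr xr).
    apply: (@le_trans _ _ (cos 1 * k0 * \1_(cubeRn a) xi)); first by rewrite gerBl.
    rewrite indicE; have [xa|xa] := pselect (cubeRn a xi).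
      rewrite mem_set// mulr1; have [km _] := box _ xa.
      by rewrite ler_pM// ltW.
    by rewrite memNset// mulr0 mulr_ge0 ?(ltW m0)// (le_trans (ltW c10)).
  rewrite indicE memNset; last by move=> /box[_]; rewrite leNgt xr.
  rewrite mulr0 sub0r lerNl -mulNr.
  apply: (@le_trans _ _ (mixed_symbol s t xi)).
    rewrite ler_piMl ?(ltW m0)//; have := cos_geN1 (dotRn z xi); lra.
  apply: (le_trans (mixed_symbol_le_gauss _ _ (ltW t0))).
  rewrite -expRD ler_expR -opprD lerN2 mul1r.
  have : (t - 1) / rho <= (t - 1) * dotRn xi xi.
    apply: ler_wpM2l; first lra.
    by rewrite -[leLHS]mul1r ler_pdivrMr// mulrC ltW.
  lra.
have mc := measurable_cubeRn a.
have i1 : mu.-integrable setT (EFin \o (\1_(cubeRn a) : Rn R N -> R)).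
  apply/integrableP; split; first by apply/measurable_EFinP; exact: measurable_indic.
  under eq_integral do rewrite /= ger0_norm ?indicE//.
  by rewrite integral_indic//= setIT measure_cubeRn// ltry.
have ii : mu.-integrable setT (EFin \o (fun xi => cos 1 * k0 * \1_(cubeRn a) xi)).
  exact: (integrableZl measurableT (cos 1 * k0) i1).
have ig : mu.-integrable setT (EFin \o (fun xi => E * expR (- (1 * dotRn xi xi)))).
  exact: (integrableZl measurableT E (integrable_gauss_Rn N ltr01)).
rewrite mixed_kernelE -[leLHS]mulrA (ler_pM2l P0).
apply: (@le_trans _ _ (\int[mu]_xi (cos 1 * k0 * \1_(cubeRn a) xi - E * expR (- (1 * dotRn xi xi))))); last first.
  apply: le_Rintegral => //; first exact: (integrableB measurableT ii ig).
  exact: integrable_cos_mixed_symbol.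
rewrite RintegralB// !RintegralZl//; last exact: (integrable_gauss_Rn N ltr01).
rewrite {1}/Rintegral integral_indic//= setIT measure_cubeRn//= aN.
rewrite {1}/Rintegral gauss_integral_Rn//= divr1.
have : C * expR (- (rho^-1 * t)) <= t `^ (- b) by apply: HT1; lra.
have -> : C * expR (- (rho^-1 * t)) = E * Num.sqrt pi ^+ N * 2 / (cos 1 * k0).
  have -> : E = expR rho^-1 * expR (- (rho^-1 * t)).
    by rewrite -expRD /E; congr expR; field; exact: lt0r_neq0.
  by rewrite /C; ring.
rewrite ler_pdivrMr//; lra.
Qed.

End kernel_bounds.

(** * Heat and Duhamel operators *)

(* The library infers no sigma-finite structure on [\x] outside of
   (sub)probabilities, whence this copy of the product measure. *)
Definition lebesgueRRn (R : realType) (N : nat) :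
    set (measurableTypeR R * Rn R N)%type -> \bar R :=
  (@lebesgue_measure R \x lebesgueRn R N)%E.

Arguments lebesgueRRn R N : clear implicits.

HB.instance Definition _ (R : realType) (N : nat) :=
  Measure.copy (lebesgueRRn R N) (@lebesgue_measure R \x lebesgueRn R N)%E.

HB.instance Definition _ (R : realType) (N : nat) :=
  Measure_isSigmaFinite.Build _ _ _ (lebesgueRRn R N)
    (isSigmaFinite.sigma_finiteT
      (lebesgue_integral_fubini.measure_function_Measure_isSigmaFinite__to__measure_function_isSigmaFinite
        (@lebesgue_measure R) (lebesgueRn R N))).

Lemma ge0_integral_RRn (R : realType) (N : nat) (f : measurableTypeR R * Rn R N -> \bar R) :
  measurable_fun setT f -> (forall z, 0 <= f z)%E ->
  (\int[lebesgueRRn R N]_z f z =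
   \int[@lebesgue_measure R]_r \int[lebesgueRn R N]_y f (r, y))%E.
Proof. exact: fubini_tonelli1. Qed.

Section heat.
Context (R : realType) (N : nat) (s : R) (s0 : 0 < s) (s1 : s < 1).
Notation mu := (lebesgueRn R N).
Notation nu := (lebesgueRRn R N).
Notation RRn := (measurableTypeR R * Rn R N)%type.
Implicit Types (t a b : R) (x y z : Rn R N).

(* The inversion formula has no meaning for [t <= 0]; extending the kernel by 0
   makes the time convolutions below integrals over the whole line. *)
Definition kernel0 t z : R := if 0 < t then mixed_kernel s t z else 0.

Definition heat t (f : Rn R N -> \bar R) x : \bar R :=
  (\int[mu]_y ((kernel0 t (subRn x y))%:E * f y))%E.

Definition duhamel (w : RRn -> R) t x : \bar R :=
  (\int[nu]_z (kernel0 (t - z.1) (subRn x z.2) * w z)%:E)%E.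

Lemma kernel0_ge0 t z : 0 <= kernel0 t z.
Proof. by rewrite /kernel0; case: ifPn => // t0; exact: mixed_kernel_ge0. Qed.

Lemma measurable_kernel0_comp d (T : measurableType d) (f : T -> R) (g : T -> Rn R N) :
  measurable_fun setT f -> measurable_fun setT g ->
  measurable_fun setT (fun p => kernel0 (f p) (g p)).
Proof.
move=> mf mg; apply: measurable_fun_ifT => //.
- exact: measurable_fun_ltr.
- exact: measurable_mixed_kernel_comp.
Qed.

Lemma measurable_kernel0_shift t x : measurable_fun setT (fun y => kernel0 t (subRn x y)).
Proof. by apply: measurable_kernel0_comp => //; exact: measurable_subRn_comp. Qed.

Lemma kernel0_mass t x : 0 < t -> (\int[mu]_y (kernel0 t (subRn x y))%:E = 1)%E.
Proof.
move=> t0; under eq_integral do rewrite /kernel0 t0 mixed_kernel_subC.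
exact: mixed_kernel_mass.
Qed.

(** [b] may be any real because it becomes [t - r] with [r] ranging over the whole line in
    [heat_duhamel]. *)
Lemma kernel0_semigroup a b x z : 0 < a ->
  (\int[mu]_y (kernel0 a (subRn x y) * kernel0 b (subRn y z))%:E =
  (if (0 < b)%R then kernel0 (a + b) (subRn x z) else 0%R)%:E)%E.
Proof.
move=> a0; case: ifPn => b0.
  rewrite /kernel0 a0 b0 addr_gt0//; exact: mixed_kernel_semigroup.
under eq_integral do rewrite {2}/kernel0 (negbTE b0) mulr0.
by rewrite integral0.
Qed.

Lemma mixed_semigroupE t (f : Rn R N -> R) x : 0 < t ->
  mixed_semigroup s t f x = heat t (EFin \o f) x.
Proof. by move=> t0; apply: eq_integral => y _; rewrite /kernel0 t0 EFinM. Qed.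

Lemma heat_ge0 t f x : (forall y, 0 <= f y)%E -> (0 <= heat t f x)%E.
Proof.
by move=> f0; apply: integral_ge0 => y _; rewrite mule_ge0// lee_fin kernel0_ge0.
Qed.

Lemma measurable_heat_integrand t f x : measurable_fun setT f ->
  measurable_fun setT (fun y => (kernel0 t (subRn x y))%:E * f y)%E.
Proof.
move=> mf; apply: emeasurable_funM => //.
by apply/measurable_EFinP; exact: measurable_kernel0_shift.
Qed.

Lemma measurable_heat_comp d (T : measurableType d) (f : Rn R N -> \bar R)
    (p : T -> R) (q : T -> Rn R N) : measurable_fun setT f -> (forall y, 0 <= f y)%E ->
  measurable_fun setT p -> measurable_fun setT q ->
  measurable_fun setT (fun i => heat (p i) f (q i)).
Proof.
move=> mf f0 mp mq.
pose F (z : T * Rn R N) := ((kernel0 (p z.1) (subRn (q z.1) z.2))%:E * f z.2)%E.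
have mF : measurable_fun setT F.
  apply: emeasurable_funM; last exact: (measurableT_comp mf).
  apply/measurable_EFinP; apply: measurable_kernel0_comp.
    exact: (measurableT_comp mp).
  by apply: measurable_subRn_comp => //; exact: (measurableT_comp mq).
apply: (measurable_fun_fubini_tonelli_F (m2 := mu) F mF) => z.
by rewrite mule_ge0// lee_fin kernel0_ge0.
Qed.

Lemma measurable_heat t (f : Rn R N -> \bar R) : measurable_fun setT f -> (forall y, 0 <= f y)%E ->
  measurable_fun setT (heat t f).
Proof. by move=> mf f0; exact: (measurable_heat_comp mf f0). Qed.

Lemma ae_le_heat t (f g : Rn R N -> \bar R) x :
  measurable_fun setT f -> (forall y, 0 <= f y)%E ->
  measurable_fun setT g -> (forall y, 0 <= g y)%E ->
  {ae mu, forall y, (f y <= g y)%E} -> (heat t f x <= heat t g x)%E.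
Proof.
move=> mf f0 mg g0 fg; apply: ae_ge0_le_integral => //.
- by move=> y _; rewrite mule_ge0// lee_fin kernel0_ge0.
- exact: measurable_heat_integrand.
- by move=> y _; rewrite mule_ge0// lee_fin kernel0_ge0.
- exact: measurable_heat_integrand.
- by apply: filterS fg => y fgy _; rewrite lee_wpmul2l// lee_fin kernel0_ge0.
Qed.

Lemma ae_eq_heat t (f g : Rn R N -> \bar R) x :
  measurable_fun setT f -> measurable_fun setT g ->
  {ae mu, forall y, f y = g y} -> heat t f x = heat t g x.
Proof.
move=> mf mg fg; apply: ae_eq_integral => //.
- exact: measurable_heat_integrand.
- exact: measurable_heat_integrand.
- by apply: filterS fg => y fgy _; rewrite fgy.
Qed.

Lemma heat_cst t (c : R) x : 0 < t -> 0 <= c -> heat t (fun=> c%:E) x = c%:E.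
Proof.
move=> t0 c0; rewrite /heat ge0_integralZr//.
- by rewrite kernel0_mass// mul1e.
- by apply/measurable_EFinP; exact: measurable_kernel0_shift.
- by move=> y _; rewrite lee_fin kernel0_ge0.
Qed.

Lemma heatD t (f g : Rn R N -> \bar R) x :
  measurable_fun setT f -> (forall y, 0 <= f y)%E ->
  measurable_fun setT g -> (forall y, 0 <= g y)%E ->
  heat t (fun y => f y + g y)%E x = (heat t f x + heat t g x)%E.
Proof.
move=> mf f0 mg g0; rewrite /heat -ge0_integralD//.
- by apply: eq_integral => y _; rewrite ge0_muleDr.
- by move=> y _; rewrite mule_ge0// lee_fin kernel0_ge0.
- exact: measurable_heat_integrand.
- by move=> y _; rewrite mule_ge0// lee_fin kernel0_ge0.
- exact: measurable_heat_integrand.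
Qed.

Lemma heatZ t (c : R) (f : Rn R N -> \bar R) x : 0 <= c ->
  measurable_fun setT f -> (forall y, 0 <= f y)%E ->
  heat t (fun y => c%:E * f y)%E x = (c%:E * heat t f x)%E.
Proof.
move=> c0 mf f0; rewrite /heat -ge0_integralZl//.
- by apply: eq_integral => y _; rewrite muleCA.
- exact: measurable_heat_integrand.
- by move=> y _; rewrite mule_ge0// lee_fin kernel0_ge0.
Qed.

Lemma heat_semigroup a b (f : Rn R N -> \bar R) x : 0 < a -> 0 < b ->
  measurable_fun setT f -> (forall y, 0 <= f y)%E ->
  heat a (heat b f) x = heat (a + b) f x.
Proof.
move=> a0 b0 mf f0.
pose F (z : Rn R N * Rn R N) :=
  ((kernel0 a (subRn x z.1))%:E * ((kernel0 b (subRn z.1 z.2))%:E * f z.2))%E.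
have mF : measurable_fun setT F.
  apply: emeasurable_funM.
    apply/measurable_EFinP; apply: measurable_kernel0_comp => //.
    exact: measurable_subRn_comp.
  apply: emeasurable_funM; last exact: (measurableT_comp mf).
  apply/measurable_EFinP; apply: measurable_kernel0_comp => //.
  exact: measurable_subRn_comp.
have F0 i : (0 <= F i)%E by rewrite !mule_ge0// lee_fin kernel0_ge0.
have -> : heat a (heat b f) x = (\int[mu]_y \int[mu]_z F (y, z))%E.
  apply: eq_integral => y _; rewrite /heat -ge0_integralZl//.
  - exact: measurable_heat_integrand.
  - by move=> z _; rewrite mule_ge0// lee_fin kernel0_ge0.
  - by rewrite lee_fin kernel0_ge0.
rewrite (fubini_tonelli F mF F0).
apply: eq_integral => z _.
under eq_integral => y _ do rewrite /F /= muleA -EFinM.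
rewrite ge0_integralZr//.
- by rewrite kernel0_semigroup// b0.
- apply/measurable_EFinP; apply: measurable_funM; first exact: measurable_kernel0_shift.
  by apply: measurable_kernel0_comp => //; exact: measurable_subRn_comp.
- by move=> y _; rewrite lee_fin mulr_ge0// kernel0_ge0.
Qed.

Lemma heat_le_mass : exists2 C : R, 0 < C & forall t (f : Rn R N -> \bar R) x, 0 < t ->
  measurable_fun setT f -> (forall y, 0 <= f y)%E ->
  (heat t f x <= (C * t `^ (- (N%:R / (2 * s))))%:E * \int[mu]_y f y)%E.
Proof.
have [C C0 HC] := mixed_kernel_upper N s0.
exists C => // t f x t0 mf f0; rewrite -ge0_integralZl//; last first.
  by rewrite lee_fin mulr_ge0 ?powR_ge0// ltW.
apply: ge0_le_integral => //.
- by move=> y _; rewrite mule_ge0// lee_fin kernel0_ge0.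
- exact: measurable_heat_integrand.
- exact: emeasurable_funM.
- by move=> y _; rewrite lee_wpmul2r// lee_fin /kernel0 t0 HC.
Qed.

Lemma measurable_duhamel_integrand (w : RRn -> R) t x : measurable_fun setT w ->
  measurable_fun setT (fun z : RRn => (kernel0 (t - z.1) (subRn x z.2) * w z)%:E).
Proof.
move=> mw; apply/measurable_EFinP; apply: measurable_funM => //.
apply: measurable_kernel0_comp; first exact: measurable_funB.
exact: measurable_subRn_comp.
Qed.

Lemma duhamel_ge0 w t x : (forall z : RRn, 0 <= w z) -> (0 <= duhamel w t x)%E.
Proof.
by move=> w0; apply: integral_ge0 => z _; rewrite lee_fin mulr_ge0// kernel0_ge0.
Qed.

Lemma measurable_duhamel_comp d (T : measurableType d) (w : RRn -> R)
    (p : T -> R) (q : T -> Rn R N) : measurable_fun setT w -> (forall z : RRn, 0 <= w z) ->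
  measurable_fun setT p -> measurable_fun setT q ->
  measurable_fun setT (fun i => duhamel w (p i) (q i)).
Proof.
move=> mw w0 mp mq.
pose F (z : T * RRn) := (kernel0 (p z.1 - z.2.1) (subRn (q z.1) z.2.2) * w z.2)%:E.
have mF : measurable_fun setT F.
  apply/measurable_EFinP; apply: measurable_funM; last exact: (measurableT_comp mw).
  apply: measurable_kernel0_comp.
    apply: measurable_funB; first exact: (measurableT_comp mp).
    exact: (measurableT_comp measurable_fst).
  apply: measurable_subRn_comp; first exact: (measurableT_comp mq).
  exact: (measurableT_comp measurable_snd).
have F0 i : (0 <= F i)%E by rewrite lee_fin mulr_ge0// kernel0_ge0.
have := measurable_fun_fubini_tonelli_F (m2 := nu) F mF F0.
exact.
Qed.

Lemma measurable_duhamel (w : RRn -> R) t : measurable_fun setT w -> (forall z : RRn, 0 <= w z) ->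
  measurable_fun setT (duhamel w t).
Proof. by move=> mw w0; exact: (measurable_duhamel_comp mw w0). Qed.

Lemma le_duhamel (w w' : RRn -> R) t x :
  measurable_fun setT w -> (forall z : RRn, 0 <= w z) ->
  measurable_fun setT w' -> (forall z : RRn, w z <= w' z) ->
  (duhamel w t x <= duhamel w' t x)%E.
Proof.
move=> mw w0 mw' ww'; apply: ge0_le_integral => //.
- by move=> z _; rewrite lee_fin mulr_ge0// kernel0_ge0.
- exact: measurable_duhamel_integrand.
- exact: measurable_duhamel_integrand.
- by move=> z _; rewrite lee_fin ler_wpM2l// kernel0_ge0.
Qed.

Lemma duhamelD (w w' : RRn -> R) t x :
  measurable_fun setT w -> (forall z : RRn, 0 <= w z) ->
  measurable_fun setT w' -> (forall z : RRn, 0 <= w' z) ->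
  duhamel (fun z : RRn => w z + w' z) t x = (duhamel w t x + duhamel w' t x)%E.
Proof.
move=> mw w0 mw' w0'; rewrite /duhamel -ge0_integralD//.
- by apply: eq_integral => z _; rewrite -EFinD mulrDr.
- by move=> z _; rewrite lee_fin mulr_ge0// kernel0_ge0.
- exact: measurable_duhamel_integrand.
- by move=> z _; rewrite lee_fin mulr_ge0// kernel0_ge0.
- exact: measurable_duhamel_integrand.
Qed.

Lemma duhamel_iterated (w : RRn -> R) t x : measurable_fun setT w -> (forall z : RRn, 0 <= w z) ->
  duhamel w t x =
  (\int[lebesgue_measure]_r heat (t - r) (fun y => (w (r, y))%:E) x)%E.
Proof.
move=> mw w0; rewrite /duhamel ge0_integral_RRn.
- by apply: eq_integral => r _; apply: eq_integral => y _; rewrite EFinM.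
- exact: measurable_duhamel_integrand.
- by move=> z; rewrite lee_fin mulr_ge0// kernel0_ge0.
Qed.

(* Only the source before time [t] is seen, because [kernel0] vanishes at
   nonpositive times. *)
Lemma duhamel_causal (w w' : RRn -> R) t x :
  (forall z : RRn, z.1 < t -> w z = w' z) -> duhamel w t x = duhamel w' t x.
Proof.
move=> ww'; apply: eq_integral => z _; congr _%:E.
have [zt|tz] := ltP z.1 t; first by rewrite ww'.
by rewrite /kernel0 subr_gt0 ltNge tz/= !mul0r.
Qed.

(** Sources at times in [[t, a + t)] are invisible to [duhamel w t] but not to [duhamel w (a + t)],
    hence the cut at [t]. The rest is Tonelli and the semigroup law. *)
Lemma heat_duhamel (w : RRn -> R) a t x : 0 < a ->
  measurable_fun setT w -> (forall z : RRn, 0 <= w z) ->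
  heat a (duhamel w t) x = duhamel (fun z : RRn => if z.1 < t then w z else 0) (a + t) x.
Proof.
move=> a0 mw w0.
pose F (z : Rn R N * RRn) :=
  ((kernel0 a (subRn x z.1))%:E * (kernel0 (t - z.2.1) (subRn z.1 z.2.2) * w z.2)%:E)%E.
have mk : measurable_fun setT (fun z : Rn R N * RRn => kernel0 (t - z.2.1) (subRn z.1 z.2.2)).
  apply: measurable_kernel0_comp.
    apply: measurable_funB => //; exact: (measurableT_comp measurable_fst).
  by apply: measurable_subRn_comp => //; exact: (measurableT_comp measurable_snd).
have mF : measurable_fun setT F.
  apply: emeasurable_funM.
    apply/measurable_EFinP; apply: measurable_kernel0_comp => //.
    exact: measurable_subRn_comp.
  apply/measurable_EFinP; apply: measurable_funM => //.
  exact: (measurableT_comp mw).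
have F0 i : (0 <= F i)%E by rewrite mule_ge0// lee_fin ?mulr_ge0 ?kernel0_ge0.
have -> : heat a (duhamel w t) x = (\int[mu]_y \int[nu]_z F (y, z))%E.
  apply: eq_integral => y _; rewrite /duhamel -ge0_integralZl//.
  - exact: measurable_duhamel_integrand.
  - by move=> z _; rewrite lee_fin mulr_ge0// kernel0_ge0.
  - by rewrite lee_fin kernel0_ge0.
rewrite (fubini_tonelli F mF F0).
apply: eq_integral => -[r z] _.
under eq_integral => y _ do rewrite /F /= -EFinM mulrA EFinM.
rewrite ge0_integralZr//=.
- rewrite kernel0_semigroup// subr_gt0 -EFinM addrA.
  by case: ifPn => rt; rewrite ?mulr0 ?mul0r.
- apply/measurable_EFinP; apply: measurable_funM; first exact: measurable_kernel0_shift.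
  by apply: measurable_kernel0_comp => //; exact: measurable_subRn_comp.
- by move=> y _; rewrite lee_fin mulr_ge0// kernel0_ge0.
- by rewrite lee_fin.
Qed.

Lemma cvg_duhamel (w_ : nat -> RRn -> R) (w : RRn -> R) t x :
  (forall n, measurable_fun setT (w_ n)) -> (forall n (z : RRn), 0 <= w_ n z) ->
  (forall z : RRn, nondecreasing_seq (w_ ^~ z)) -> (forall z : RRn, w_ n z @[n --> \oo] --> w z) ->
  duhamel (w_ n) t x @[n --> \oo] --> duhamel w t x.
Proof.
move=> mw w0 ndw cw.
have -> : duhamel w t x = (\int[nu]_z limn (fun n => (kernel0 (t - z.1) (subRn x z.2) * w_ n z)%:E))%E.
  apply: eq_integral => z _; apply/esym/cvg_lim => //.
  by apply/cvg_EFin; [exact: nearW|apply: cvgMr; exact: cw].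
apply: cvg_monotone_convergence => //.
- by move=> n; exact: measurable_duhamel_integrand.
- by move=> n z _; rewrite lee_fin mulr_ge0// kernel0_ge0.
- by move=> z _ m n mn; rewrite lee_fin ler_wpM2l ?kernel0_ge0// ndw.
Qed.

End heat.

(** * Picard iteration *)

Section iteration.
Context (R : realType) (N : nat) (s : R) (s0 : 0 < s) (s1 : s < 1) (p : R) (p1 : 1 < p).
Notation mu := (lebesgueRn R N).
Notation RRn := (measurableTypeR R * Rn R N)%type.
Implicit Types (t a b : R) (x y : Rn R N) (k : R -> R) (v W : RRn -> R).

Definition source k v (z : RRn) : R := k z.1 * v z `^ p.

Lemma source_ge0 k v z : (forall r, 0 <= k r) -> 0 <= source k v z.
Proof. by move=> k0; rewrite mulr_ge0// powR_ge0. Qed.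

Lemma measurable_source k v :
  measurable_fun setT k -> measurable_fun setT v -> measurable_fun setT (source k v).
Proof.
move=> mk mv; apply: measurable_funM.
  exact: (measurableT_comp mk).
exact: (measurableT_comp (measurable_powR p) mv).
Qed.

Lemma le_source k v W z : (forall r, 0 <= k r) -> 0 <= v z -> v z <= W z ->
  source k v z <= source k W z.
Proof.
move=> k0 v0 vW; rewrite ler_wpM2l//; apply: ge0_ler_powR => //.
- exact: ltW (lt_trans ltr01 p1).
- by rewrite nnegrE (le_trans v0).
Qed.

(** Translates the Duhamel term of [mild_solution] into an integral over all of space-time: [k]
    removes the nonpositive times and [kernel0] those from [t] on. *)
Lemma duhamel_source (h k : R -> R) (u : R -> Rn R N -> R) v t x :
  measurable_fun setT k -> (forall r, 0 <= k r) -> measurable_fun setT v ->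
  (forall r, r <= 0 -> k r = 0) -> (forall r, 0 < r -> r < t -> h r = k r) ->
  (forall r y, 0 < r -> r < t -> u r y = v (r, y)) ->
  (\int[lebesgue_measure]_(r in `]0%R, t[)
     ((h r)%:E * mixed_semigroup s (t - r) (fun y => (u r y `^ p)%R) x) =
   duhamel s (source k v) t x)%E.
Proof.
move=> mk k0 mv kneg hk uv.
rewrite duhamel_iterated//; last 2 first.
- exact: measurable_source.
- by move=> z; exact: source_ge0.
rewrite integral_mkcond; apply: eq_integral => r _.
rewrite /patch; case: ifPn.
  rewrite inE/= in_itv/= => /andP[r0 rt].
  rewrite (@mixed_semigroupE _ _ s (t - r)) ?subr_gt0// (hk r r0 rt).
  rewrite -(heatZ s0 s1 (t - r) x (k0 r)).
  - apply: eq_integral => y _; congr (_ * _)%E.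
    by rewrite -EFinM /source/= uv.
  - apply/measurable_EFinP; apply: (measurableT_comp (measurable_powR p)).
    have : measurable_fun setT (fun y => v (r, y)) by exact: (measurableT_comp mv).
    by congr measurable_fun; apply/funext => y; rewrite uv.
  - by move=> y; rewrite lee_fin powR_ge0.
rewrite notin_setE/= in_itv/= => /negP; rewrite negb_and -!leNgt => /orP[r0|tr].
  rewrite /heat; under eq_integral do rewrite /source/= kneg// mul0r mule0.
  by rewrite integral0.
rewrite /heat; under eq_integral do rewrite /kernel0 subr_gt0 ltNge tr/= mul0e.
by rewrite integral0.
Qed.

(* Picard iteration from 0 below the supersolution [W]. *)
Lemma monotone_iteration k (g : RRn -> \bar R) W :
  measurable_fun setT k -> (forall r, 0 <= k r) ->
  measurable_fun setT g -> (forall z, 0 <= g z)%E ->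
  measurable_fun setT W ->
  (forall z : RRn, g z + duhamel s (source k W) z.1 z.2 <= (W z)%:E)%E ->
  exists v : RRn -> R, [/\ measurable_fun setT v, forall z, 0 <= v z, forall z, v z <= W z
    & forall z : RRn, (v z)%:E = (g z + duhamel s (source k v) z.1 z.2)%E].
Proof.
move=> mk k0 mg g0 mW HW.
pose Phi v (z : RRn) : \bar R := (g z + duhamel s (source k v) z.1 z.2)%E.
have mPhi v : measurable_fun setT v -> measurable_fun setT (Phi v).
  move=> mv; apply: emeasurable_funD => //.
  apply: measurable_duhamel_comp => //; first exact: measurable_source.
  by move=> z; exact: source_ge0.
have PhiM v v' z : measurable_fun setT v -> measurable_fun setT v' ->
    (forall z, 0 <= v z) -> (forall z, v z <= v' z) -> (Phi v z <= Phi v' z)%E.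
  move=> mv mv' v0 vv'; rewrite leeD2l//; apply: (le_duhamel s0 s1).
  - exact: measurable_source.
  - by move=> i; exact: source_ge0.
  - exact: measurable_source.
  - by move=> i; exact: le_source.
have Phi0 v z : (0 <= Phi v z)%E.
  by rewrite adde_ge0// duhamel_ge0// => i; exact: source_ge0.
(* [fine] keeps the iterates real valued and loses nothing, since [Phi (v_ n)] stays below the
   finite [W]. *)
pose v_ n := iter n (fun v z => fine (Phi v z)) (fun=> 0).
have vP n : [/\ measurable_fun setT (v_ n), forall z, 0 <= v_ n z & forall z, v_ n z <= W z].
  elim: n => [|n [mv v0 vW]].
    split => //= z; rewrite -lee_fin; apply: le_trans (HW z); exact: Phi0.
  split => [|z|z].
  - by apply: (measurableT_comp (fine_measurable measurableT)); exact: mPhi.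
  - by rewrite fine_ge0.
  - have PW : (Phi (v_ n) z <= (W z)%:E)%E by apply: le_trans (HW z); exact: PhiM.
    by rewrite -lee_fin fineK// ge0_fin_numE// (le_lt_trans PW) ?ltry.
have PhifinW n z : (Phi (v_ n) z <= (W z)%:E)%E.
  by have [mv v0 vW] := vP n; apply: le_trans (HW z); exact: PhiM.
have vS n z : (v_ n.+1 z)%:E = Phi (v_ n) z.
  by rewrite /= fineK// ge0_fin_numE// (le_lt_trans (PhifinW n z)) ?ltry.
have ndv z : nondecreasing_seq (v_ ^~ z).
  apply/nondecreasing_seqP => n; elim: n z => [|n IHn] z.
    by have [_ + _] := vP 1%N; apply.
  have [mv v0 _] := vP n; have [mv' _ _] := vP n.+1.
  by rewrite -lee_fin !vS; exact: (PhiM _ _ _ mv mv' v0 IHn).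
have cv z : cvgn (v_ ^~ z).
  apply: nondecreasing_is_cvgn => //.
  by exists (W z) => _ [n _ <-]; have [_ _] := vP n; apply.
pose v z := limn (v_ ^~ z).
have vlim z : v_ n z @[n --> \oo] --> v z by exact: cv.
have mv : measurable_fun setT v.
  by apply: (@measurable_fun_cvg _ _ _ _ v_) => [n|z _]; [have [] := vP n|exact: vlim].
have v0 z : 0 <= v z.
  by apply: limr_ge => //; apply: nearW => n; have [_ + _] := vP n; apply.
have vW z : v z <= W z.
  by apply: limr_le => //; apply: nearW => n; have [_ _] := vP n; apply.
exists v; split => // z.
have cL : ((v_ n.+1 z)%:E @[n --> \oo] --> (v z)%:E)%E.
  apply/cvg_EFin; first exact: nearW.
  rewrite /comp /=; have := vlim z; rewrite -cvg_shiftS; exact.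
have cR : Phi (v_ n) z @[n --> \oo] --> Phi v z.
  apply: cvgeD; [by apply: ge0_adde_def; rewrite inE ?duhamel_ge0// => i; exact: source_ge0|exact: cvg_cst|].
  apply: cvg_duhamel => //.
  - by move=> n; have [? _ _] := vP n; exact: measurable_source.
  - by move=> n i; exact: source_ge0.
  - move=> i m n mn; apply: le_source => //; last exact: ndv.
    by have [_ + _] := vP m; apply.
  - move=> i; apply: cvgMr; apply: powR_continuous_ge0 => //; first exact: lt_trans p1.
    by move=> n; have [_ + _] := vP n; apply.
have vSE : (fun n => (v_ n.+1 z)%:E) = (fun n => Phi (v_ n) z) by apply/funext => n.
rewrite vSE in cL; exact: (cvg_unique _ cL cR).
Qed.

End iteration.

(** * Power bounds and superlinear growth in time *)

Section real_line.
Context (R : realType).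
Implicit Types (a b c p x : R).

Lemma cvg_powRN (eta : R) : 0 < eta -> x `^ (- eta) @[x --> +oo] --> (0 : R).
Proof.
move=> e0; apply/cvgrPdist_lt => e eps0; exists ((e^-1) `^ eta^-1); split => // x Hx.
have x0 : 0 < x by apply: lt_trans Hx; rewrite powR_gt0// invr_gt0.
rewrite sub0r normrN ger0_norm ?powR_ge0// powRN invf_plt ?posrE ?powR_gt0//.
rewrite -[X in X < _](@powRr1 _ e^-1) ?invr_ge0 ?ltW// -(mulVf (lt0r_neq0 e0)) powRrM.
by apply: gt0_ltr_powR => //; rewrite nnegrE ?powR_ge0 ?ltW.
Qed.

Lemma integral_powR_tail (eta X : R) : 0 < eta -> 0 < X ->
  (\int[lebesgue_measure]_(x in `[X, +oo[) (x `^ (- 1 - eta))%:E = (X `^ (- eta) / eta)%:E)%E.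
Proof.
move=> e0 X0; pose F x := - (x `^ (- eta) / eta).
have dF x : 0 < x -> is_derive x 1 F (x `^ (- 1 - eta)).
  move=> x0; rewrite /F.
  have dP : is_derive x 1 (fun x : R => x `^ (- eta)) (- eta * x `^ (- eta - 1)).
    have xin : x \in `]0, +oo[ by rewrite in_itv/= andbT.
    have -> : - eta * x `^ (- eta - 1) = 'D_1 (fun x : R => x `^ (- eta)) x.
      by rewrite -derive1E powR_derive1.
    by apply/derivableP/derivable_powR.
  have -> : (fun y : R => - (y `^ (- eta) / eta)) = - eta^-1 \*: (fun y : R => y `^ (- eta)).
    by apply/funext => y; rewrite /= /GRing.scale/=; ring.
  have -> : x `^ (- 1 - eta) = - eta^-1 *: (- eta * x `^ (- eta - 1)).
    rewrite /GRing.scale/= (_ : - 1 - eta = - eta - 1); last by ring.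
    by field; rewrite gt_eqF.
  exact: is_deriveZ.
rewrite (@ge0_continuous_FTC2y R _ F X 0).
- by rewrite /F sub0e -EFinN opprK.
- by move=> x _; exact: powR_ge0.
- apply: continuous_in_subspaceT => x; rewrite inE/= in_itv/= andbT => Xx.
  apply: differentiable_continuous; apply/derivable1_diffP; apply: derivable_powR.
  by rewrite in_itv/= andbT (lt_le_trans X0).
- rewrite -oppr0 -[X in _ --> - X](mul0r eta^-1); apply: cvgN; apply: cvgMl.
  exact: cvg_powRN.
- by move=> x Xx; apply: ex_derive; apply: dF; exact: lt_trans Xx.
- apply: cvg_at_right_filter; apply: differentiable_continuous; apply/derivable1_diffP.
  by apply: ex_derive; exact: dF.
- move=> x; rewrite in_itv/= andbT => Xx; rewrite derive1E.
  by have ? := dF x (lt_trans X0 Xx); exact: derive_val.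
Qed.

(** For [x > 1] the limit can be multiplied by [ln x > 0] and exponentiated. The loss [e] in the
    exponent is affordable because [p] is strictly on one side of the critical value. *)
Lemma classM_bounds (gamma : R) (h : R -> R) (e : R) : classM gamma h -> 0 < e ->
  exists2 X, 1 < X & forall x, X <= x -> x `^ (gamma - e) <= h x <= x `^ (gamma + e).
Proof.
case=> h0 _ _ hlim e0.
have [M [_ HM]] := (cvgrPdist_lt _ _).1 hlim _ e0.
exists (Num.max M 1 + 1); first by rewrite ltr_pwDr// le_max lexx orbT.
move=> x Xx; have Mx : M < x.
  by apply: lt_le_trans Xx; rewrite ltr_pwDr// le_max lexx.
have x1 : 1 < x by apply: lt_le_trans Xx; rewrite ltr_pwDr// le_max lexx orbT.
have x0 : 0 < x by exact: lt_trans x1.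
have lx : 0 < ln x by exact: ln_gt0.
have := HM x Mx; rewrite /= distrC ltr_distl => /andP[].
rewrite ltr_pdivlMr// ltr_pdivrMr// => l1 l2.
by rewrite /powR gt_eqF// -[h x]lnK ?posrE ?h0// !ler_expR !ltW.
Qed.

(** The lifespan estimate for [G' >= k G^p], in integrated form because only increments of [G] are
    controlled. The constant is the sum of the geometric series of ratio [2^(1 - p)]. *)
Lemma superlinear_growth_time (k A a b p : R) (G : R -> R) :
  0 < k -> 0 < A -> 1 < p ->
  (forall t t', a <= t -> t <= t' -> t' < b -> G t + k * (t' - t) * G t `^ p <= G t') ->
  A <= G a -> k * (b - a) * A `^ (p - 1) <= (1 - 2 `^ (1 - p))^-1.
Proof.
move=> k0 A0 p1 HG AG; rewrite leNgt; apply/negP => Hlt.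
set rho : R := 2 `^ (1 - p) in Hlt.
have rho0 : 0 < rho by exact: powR_gt0.
have rho1 : rho < 1.
  rewrite /rho -opprB powRN invf_lt1 ?powR_gt0//.
  have : 1 `^ (p - 1) < 2 `^ (p - 1) :> R.
    by apply: gt0_ltr_powR; rewrite ?subr_gt0 ?nnegrE// ltr1n.
  by rewrite powR1.
set d := A `^ (1 - p) / k.
have d0 : 0 < d by rewrite divr_gt0// powR_gt0.
have rho1' : 0 < 1 - rho by rewrite subr_gt0.
(* [G] doubles between [t_ n] and [t_ n.+1], and these steps form a convergent
   geometric series. *)
pose t_ n := a + d * (1 - rho ^+ n) / (1 - rho).
(* The limit of the times [t_ n]. If the claim fails, then [tl < b], and the real number [G tl]
   would exceed [2^n A] for every [n]. *)
pose tl := a + d / (1 - rho).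
have tlb : tl < b.
  rewrite /tl /d -ltrBrDl ltr_pdivrMr// ltr_pdivrMr//.
  move: Hlt; rewrite -(ltr_pM2r rho1') mulVf ?gt_eqF// -(ltr_pM2r (powR_gt0 (1 - p) A0)) mul1r.
  have -> : k * (b - a) * A `^ (p - 1) * (1 - rho) * A `^ (1 - p) =
     (b - a) * (1 - rho) * k * (A `^ (p - 1) * A `^ (1 - p)) by ring.
  have -> : A `^ (p - 1) * A `^ (1 - p) = 1.
    rewrite -powRD; last by rewrite (gt_eqF A0) implybT.
    by rewrite (_ : p - 1 + (1 - p) = 0) ?powRr0//; ring.
  by rewrite mulr1.
have t_tl n : t_ n <= tl.
  by rewrite lerD2l ler_pM2r ?invr_gt0// ler_piMr ?(ltW d0)// gerBl exprn_ge0// ltW.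
have at_ n : a <= t_ n.
  by rewrite lerDl divr_ge0 ?(ltW rho1')// mulr_ge0 ?(ltW d0)// subr_ge0 exprn_ile1// ltW.
have tS n : t_ n.+1 - t_ n = d * rho ^+ n.
  by rewrite /t_ exprS; field; rewrite gt_eqF.
have Gt n : 2 ^+ n * A <= G (t_ n).
  elim: n => [|n IHn]; first by rewrite /t_ expr0 subrr mulr0 mul0r addr0 mul1r.
  set B := 2 ^+ n * A in IHn.
  have B0 : 0 < B by rewrite mulr_gt0// exprn_gt0.
  have tn : t_ n <= t_ n.+1 by rewrite -subr_ge0 tS mulr_ge0 ?ltW// exprn_gt0.
  apply: le_trans (HG _ _ (at_ n) tn (le_lt_trans (t_tl _) tlb)).
  rewrite exprS -mulrA -/B (_ : 2 * B = B + B); last by ring.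
  apply: lerD => //; rewrite tS.
  have -> : k * (d * rho ^+ n) = B `^ (1 - p).
    have rhon : (2 ^+ n : R) `^ (1 - p) = rho ^+ n.
      by rewrite -[2 ^+ n]powR_mulrn// -powRrM mulrC powRrM powR_mulrn// ltW.
    rewrite /B powRM ?exprn_ge0 ?ltW// rhon /d.
    by field; rewrite gt_eqF.
  have {1}-> : B = B `^ (1 - p) * B `^ p.
    rewrite -powRD; last by rewrite (gt_eqF B0) implybT.
    by rewrite subrK powRr1// ltW.
  rewrite ler_wpM2l ?powR_ge0// ge0_ler_powR ?nnegrE ?(ltW (lt_trans ltr01 p1)) ?(ltW B0)//.
  exact: le_trans (ltW B0) IHn.
have Gl n : 2 ^+ n * A <= G tl.
  apply: le_trans (Gt n) _; apply: le_trans (HG _ _ (at_ n) (t_tl n) tlb).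
  by rewrite lerDl mulr_ge0 ?powR_ge0// mulr_ge0 ?subr_ge0// ltW.
have GA0 : 0 <= G tl / A.
  by rewrite divr_ge0 ?(ltW A0)// (le_trans _ (Gl 0%N))// mulr_ge0// ltW.
have := Gl (Num.bound (G tl / A)); rewrite leNgt -ltr_pdivrMr// => /negP; apply.
apply: lt_le_trans (archi_boundP GA0) _.
by rewrite -natrX ler_nat ltnW// ltn_expl.
Qed.

End real_line.

(** * Mild solutions as functions on the whole space-time *)

Section mild_solutions.
Context (R : realType) (N : nat) (s : R) (s0 : 0 < s) (s1 : s < 1) (p : R) (p1 : 1 < p).
Notation mu := (lebesgueRn R N).
Notation RRn := (measurableTypeR R * Rn R N)%type.
Implicit Types (t a b : R) (x y : Rn R N) (h k c : R -> R).

(** The assumptions on [h] concern nonnegative times; the extension by zero lets the time integral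
    run over the whole line. *)
Definition pos_time h (r : R) : R := if 0 < r then h r else 0.

Lemma pos_time_ge0 h r : (forall r, 0 <= r -> 0 <= h r) -> 0 <= pos_time h r.
Proof. by move=> h0; rewrite /pos_time; case: ifPn => // /ltW/h0. Qed.

Lemma pos_time_le0 h r : r <= 0 -> pos_time h r = 0.
Proof. by move=> r0; rewrite /pos_time ltNge r0. Qed.

Lemma measurable_pos_time h : measurable_fun (`]0, +oo[ : set R) h ->
  measurable_fun setT (pos_time h).
Proof.
move=> mh; have -> : pos_time h = h \_ `]0, +oo[.
  apply/funext => r; rewrite /pos_time /patch.
  by have -> : (r \in (`]0, +oo[%classic : set R)) = (0 < r) by rewrite mem_setE in_itv/= andbT.
by apply/(measurable_restrict h (measurable_itv _) measurableT); rewrite setTI.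
Qed.

Lemma measurable_time_window (T : \bar R) :
  measurable [set z : RRn | (0 < z.1)%R /\ (z.1%:E < T)%E].
Proof.
have mT : measurable [set r : measurableTypeR R | (0 < r)%R /\ (r%:E < T)%E].
  have -> : [set r : measurableTypeR R | (0 < r)%R /\ (r%:E < T)%E] =
      (`]0, +oo[ : set R) `&` (EFin @^-1` [set y | (y < T)%E]).
    by apply/seteqP; split => r /=; rewrite in_itv/= andbT.
  apply: measurableI; first exact: measurable_itv.
  rewrite -[X in measurable X]setTI; apply: (EFin_measurable measurableT) => //.
  rewrite (_ : [set y | (y < T)%E] = `]-oo, T[%classic); first exact: emeasurable_itv.
  by apply/seteqP; split => y /=; rewrite in_itv.
rewrite -[X in measurable X]setTI; exact: (measurable_fst measurableT _ mT).
Qed.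

Lemma mild_of_total h (u0 : Rn R N -> R) (T : \bar R) (v : RRn -> R) :
  measurable_fun (`]0, +oo[ : set R) h -> (forall r, 0 <= r -> 0 <= h r) ->
  (0 < T)%E -> measurable_fun setT v -> (forall z, 0 <= v z) ->
  (forall t, 0 < t -> (t%:E < T)%E -> {ae mu, forall x, (v (t, x))%:E =
     (heat s t (EFin \o u0) x + duhamel s (source p (pos_time h) v) t x)%E}) ->
  mild_solution s p h u0 T (fun t x => v (t, x)).
Proof.
move=> mh h0 T0 mv v0 veq; split => //.
- have -> : (fun z : RRn => v (z.1, z.2)) = v by apply/funext => -[].
  exact: measurable_funTS.
- move=> t t0 tT; apply: filterS (veq t t0 tT) => x ->.
  rewrite mixed_semigroupE// (@duhamel_source _ _ s s0 s1 p h (pos_time h) (fun t x => v (t, x)) v)//.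
  + exact: measurable_pos_time.
  + by move=> r; exact: pos_time_ge0.
  + by move=> r; exact: pos_time_le0.
  + by move=> r r0 _; rewrite /pos_time r0.
Qed.

(** A mild solution is measurable and nonnegative on its time window only. Extended by zero it
    becomes a function on which [duhamel] acts, and by causality the equation inside the window is
    unchanged. *)
Lemma total_of_mild h (u0 : Rn R N -> R) (T : \bar R) (u : R -> Rn R N -> R) :
  measurable_fun (`]0, +oo[ : set R) h -> (forall r, 0 <= r -> 0 <= h r) ->
  mild_solution s p h u0 T u ->
  exists v : RRn -> R, [/\ measurable_fun setT v, forall z, 0 <= v z,
    forall t x, 0 < t -> (t%:E < T)%E -> v (t, x) = u t x
    & forall t, 0 < t -> (t%:E < T)%E -> {ae mu, forall x, (v (t, x))%:E =
     (heat s t (EFin \o u0) x + duhamel s (source p (pos_time h) v) t x)%E}].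
Proof.
move=> mh h0 [T0 mu_ u_ge0 ueq].
pose D := [set z : RRn | (0 < z.1)%R /\ (z.1%:E < T)%E].
pose v := (fun z : RRn => u z.1 z.2) \_ D.
have vu t x : 0 < t -> (t%:E < T)%E -> v (t, x) = u t x.
  by move=> t0 tT; rewrite /v /patch mem_set.
have mv : measurable_fun setT v.
  by apply/(measurable_restrict _ (measurable_time_window T) measurableT); rewrite setTI.
have v0 z : 0 <= v z.
  by rewrite /v /patch; case: ifPn => //; rewrite inE => -[? ?]; exact: u_ge0.
exists v; split => // t t0 tT; apply: filterS (ueq t t0 tT) => x; rewrite vu// => ->.
rewrite mixed_semigroupE// (@duhamel_source _ _ s s0 s1 p h (pos_time h) u v)//.
- exact: measurable_pos_time.
- by move=> r; exact: pos_time_ge0.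
- by move=> r; exact: pos_time_le0.
- by move=> r r0 _; rewrite /pos_time r0.
- by move=> r y r0 rt; rewrite vu// (lt_trans _ tT)// lte_fin.
Qed.

(* Twice the free evolution is a supersolution once the data are small. *)
Lemma heat_supersolution k (u0 : Rn R N -> R) (m : R -> R) (d J : R) :
  measurable_fun setT k -> (forall r, 0 <= k r) -> (forall r, r <= 0 -> k r = 0) ->
  measurable_fun setT u0 -> (forall x, 0 <= u0 x) ->
  measurable_fun setT m -> (forall r, 0 <= m r) -> 0 <= d ->
  (forall r y, 0 < r -> (heat s r (EFin \o u0) y <= (d * m r)%:E)%E) ->
  (\int[lebesgue_measure]_r (k r * m r `^ (p - 1))%:E <= J%:E)%E ->
  2 `^ p * d `^ (p - 1) * J <= 1 ->
  exists v : RRn -> R, [/\ measurable_fun setT v, forall z, 0 <= v z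
    & forall z : RRn, (v z)%:E =
        (heat s z.1 (EFin \o u0) z.2 + duhamel s (source p k v) z.1 z.2)%E].
Proof.
move=> mk k0 kneg mu0 u00 mm m0 d0 Hm HJ HdJ.
pose H t x := heat s t (EFin \o u0) x.
have u0E x : (0 <= (EFin \o u0) x)%E by rewrite lee_fin.
have mu0E : measurable_fun setT (EFin \o u0) by exact/measurable_EFinP.
have H0 t x : (0 <= H t x)%E by exact: heat_ge0.
have Hle0 t x : t <= 0 -> H t x = 0%E.
  move=> t0; rewrite /H /heat; under eq_integral do rewrite /kernel0 ltNge t0/= mul0e.
  by rewrite integral0.
have Hfin t x : H t x \is a fin_num.
  have [t0|t0] := ltP 0 t; last by rewrite Hle0.
  by rewrite ge0_fin_numE// (le_lt_trans (Hm t x t0)) ?ltry.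
have mH : measurable_fun setT (fun z : RRn => H z.1 z.2).
  exact: (measurable_heat_comp s0 s1 mu0E u0E measurable_fst measurable_snd).
have mfH : measurable_fun setT (fun z : RRn => fine (H z.1 z.2)).
  exact: (measurableT_comp (fine_measurable measurableT)).
pose W z := 2 * fine (H z.1 z.2).
have mW : measurable_fun setT (W : RRn -> R) by exact: measurable_funM.
have W0 z : 0 <= W z by rewrite mulr_ge0// fine_ge0.
(* From [H <= d m] follows [(2 H)^p <= 2^p (d m)^(p - 1) H], so the source of [W] is at most the
   free evolution times a function of time alone. *)
pose c r := 2 `^ p * d `^ (p - 1) * (k r * m r `^ (p - 1)).
have c0 r : 0 <= c r by rewrite !mulr_ge0 ?powR_ge0.
have mJ : measurable_fun setT (fun r => k r * m r `^ (p - 1)).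
  by apply: measurable_funM => //; exact: (measurableT_comp (measurable_powR _)).
have mc : measurable_fun setT c by exact: measurable_funM.
pose w z := c z.1 * fine (H z.1 z.2).
have mw : measurable_fun setT (w : RRn -> R).
  by apply: measurable_funM => //; exact: (measurableT_comp mc).
have w0 z : 0 <= w z by rewrite mulr_ge0// fine_ge0.
have sWw (z : RRn) : source p k W z <= w z.
  rewrite /source /w /c; have [z0|z0] := ltP 0 z.1; last first.
    by rewrite kneg// !(mul0r, mulr0).
  set f := fine _; have f0 : 0 <= f by rewrite fine_ge0.
  have fle : f <= d * m z.1 by rewrite -lee_fin fineK// Hm.
  rewrite /W powRM// -/f.
  have fp : f `^ p <= d `^ (p - 1) * m z.1 `^ (p - 1) * f.
    have -> : f `^ p = f `^ (p - 1) * f.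
      have [->|fn0] := eqVneq f 0; first by rewrite mulr0 powR0// gt_eqF// (lt_trans _ p1).
      rewrite -{3}(powRr1 f0) -powRD; last by rewrite fn0 implybT.
      by rewrite subrK.
    rewrite ler_wpM2r// -powRM// ge0_ler_powR ?nnegrE ?mulr_ge0//.
    by rewrite subr_ge0 ltW.
  apply: le_trans (_ : k z.1 * (2 `^ p * (d `^ (p - 1) * m z.1 `^ (p - 1) * f)) <= _).
    by rewrite ler_wpM2l// ler_wpM2l// powR_ge0.
  by rewrite le_eqVlt; apply/orP; left; apply/eqP; ring.
have dW t x : (duhamel s (source p k W) t x <= H t x)%E.
  apply: (le_trans (le_duhamel s0 s1 t x (measurable_source p mk mW) _ mw sWw)).
    by move=> z; exact: source_ge0.
  rewrite duhamel_iterated//.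
  have -> : (\int[lebesgue_measure]_r heat s (t - r) (fun y => (w (r, y))%:E) x =
      \int[lebesgue_measure]_r (if (r < t)%R then (c r)%:E * H t x else 0))%E.
    apply: eq_integral => r _; case: ifPn => [rt|]; last first.
      rewrite -leNgt => tr; rewrite /heat.
      under eq_integral do rewrite /kernel0 subr_gt0 ltNge tr/= mul0e.
      by rewrite integral0.
    have [r0|r0] := ltP 0 r; last first.
      have cr : c r = 0 by rewrite /c kneg// mul0r mulr0.
      rewrite cr mul0e /heat; under eq_integral do rewrite /w/= cr mul0r mule0.
      by rewrite integral0.
    (* By the semigroup law every source time [r] yields the same [H t x], which then leaves the
       time integral. *)
    have -> : H t x = heat s (t - r) (H r) x.
      have tr0 : 0 < t - r by rewrite subr_gt0.
      have := @heat_semigroup R N s s0 s1 (t - r) r (EFin \o u0) x tr0 r0 mu0E u0E.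
      by rewrite subrK => /esym.
    rewrite -(heatZ s0 s1 (t - r) x (c0 r)).
    - by apply: eq_integral => y _; rewrite /w/= EFinM fineK.
    - exact: measurable_heat.
    - by [].
  apply: (@le_trans _ _ (\int[lebesgue_measure]_r ((c r)%:E * H t x))%E).
    apply: ge0_le_integral => //.
    - by move=> r _; case: ifPn => // _; rewrite mule_ge0// lee_fin.
    - apply: measurable_fun_ifT => //; first exact: measurable_fun_ltr.
      by apply: emeasurable_funM => //; exact/measurable_EFinP.
    - by apply: emeasurable_funM => //; exact/measurable_EFinP.
    - by move=> r _; case: ifPn => // _; rewrite mule_ge0// lee_fin.
  rewrite ge0_integralZr//; last 2 first.
  - exact/measurable_EFinP.
  - by move=> r _; rewrite lee_fin.
  rewrite -[leRHS]mul1e lee_wpmul2r//.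
  rewrite /c; under eq_integral do rewrite EFinM.
  rewrite ge0_integralZl//; last 3 first.
  - exact/measurable_EFinP.
  - by move=> r _; rewrite lee_fin mulr_ge0// powR_ge0.
  - by rewrite lee_fin mulr_ge0// powR_ge0.
  apply: le_trans (_ : ((2 `^ p * d `^ (p - 1))%:E * J%:E <= _)%E).
    by rewrite lee_wpmul2l// lee_fin mulr_ge0// powR_ge0.
  by rewrite -EFinM lee_fin.
have HW (z : RRn) : (H z.1 z.2 + duhamel s (source p k W) z.1 z.2 <= (W z)%:E)%E.
  apply: (@le_trans _ _ (H z.1 z.2 + H z.1 z.2)%E); first by rewrite leeD2l.
  by rewrite /W mulr2n mulrDl !mul1r EFinD fineK.
have [v [mv v0 _ veq]] := monotone_iteration s0 s1 p1 mk k0 mH (fun z => H0 z.1 z.2) mW HW.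
by exists v.
Qed.

End mild_solutions.

(** * Global solutions for small data *)

(** Up to [X] the function [h] is bounded and the minimum is at most 1; beyond [X] the powers
    combine to the integrable [r^(- 1 - eta)]. *)
Lemma decay_profile_integral (R : realType) (gamma p q C : R) (h : R -> R) :
  classM gamma h -> 1 < p -> 0 < C -> gamma + 1 < q * (p - 1) ->
  exists2 J : R, 0 < J & (\int[lebesgue_measure]_r
    (pos_time h r * (Num.min 1 (C * r `^ (- q))) `^ (p - 1))%:E <= J%:E)%E.
Proof.
move=> hM p1 C0 gq; have [h0 mh hb _] := hM.
(* Half of the gap is spent on the upper bound of [h], the other half on convergence at infinity. *)
pose eta := (q * (p - 1) - (gamma + 1)) / 2.
have eta0 : 0 < eta by rewrite divr_gt0// subr_gt0.
have [X X1 HX] := classM_bounds hM eta0.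
have X0 : 0 < X by exact: lt_trans X1.
have [M0 HM0] := hb X; pose M := Num.max M0 1.
have M0' : 0 < M by rewrite lt_max ltr01 orbT.
have p10 : 0 < p - 1 by rewrite subr_gt0.
pose m r := Num.min 1 (C * r `^ (- q)).
have m0 r : 0 <= m r by rewrite le_min ler01 mulr_ge0 ?powR_ge0// ltW.
have mm : measurable_fun setT m.
  apply: measurable_minr => //; apply: measurable_funM => //.
have k0 r : 0 <= pos_time h r.
  by rewrite /pos_time; case: ifPn => // r0; rewrite ltW// h0.
pose f1 (r : R) := (M%:E * (\1_`[0, X] r)%:E)%E.
pose f2 (r : R) := ((C `^ (p - 1))%:E * ((fun r => (r `^ (- 1 - eta))%:E) \_ `[X, +oo[) r)%E.
have mf2 : measurable_fun setT ((fun r : R => (r `^ (- 1 - eta))%:E) \_ `[X, +oo[).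
  apply/(measurable_restrict _ (measurable_itv _) measurableT); rewrite setTI.
  by apply/measurable_EFinP; apply: measurable_funTS; exact: measurable_powR.
have f20 r : (0 <= ((fun r : R => (r `^ (- 1 - eta))%:E) \_ `[X, +oo[) r)%E.
  by rewrite /patch; case: ifPn => // _; rewrite lee_fin powR_ge0.
have m1 : measurable_fun setT (fun r : R => (\1_`[0, X] r : R)%:E).
  by apply/measurable_EFinP; exact: measurable_indic.
have If : (\int[lebesgue_measure]_r (f1 r + f2 r) =
    (M * X + C `^ (p - 1) * (X `^ (- eta) / eta))%:E)%E.
  rewrite ge0_integralD//; last 4 first.
  - by move=> r _; rewrite mule_ge0// lee_fin// ltW.
  - exact: emeasurable_funM.
  - by move=> r _; rewrite mule_ge0// lee_fin powR_ge0.
  - exact: emeasurable_funM.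
  rewrite EFinD; congr (_ + _)%E.
    rewrite ge0_integralZl//; last by rewrite lee_fin ltW.
    rewrite integral_indic//= setIT EFinM; congr (_ * _)%E.
    by rewrite lebesgue_measure_itv/= lte_fin X0 oppr0 adde0.
  rewrite ge0_integralZl//; last by rewrite lee_fin powR_ge0.
  by rewrite -integral_mkcond integral_powR_tail.
exists (M * X + C `^ (p - 1) * (X `^ (- eta) / eta)).
  by rewrite ltr_wpDr ?mulr_gt0// mulr_ge0 ?powR_ge0// divr_ge0 ?powR_ge0// ltW.
rewrite -If; apply: ge0_le_integral => //.
- by move=> r _; rewrite lee_fin mulr_ge0// powR_ge0.
- apply/measurable_EFinP; apply: measurable_funM; first exact: measurable_pos_time.
  exact: (measurableT_comp (measurable_powR _) mm).
- by apply: emeasurable_funD; exact: emeasurable_funM.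
move=> r _; have [r0|r0] := leP r 0.
  rewrite pos_time_le0// mul0r adde_ge0// mule_ge0// lee_fin ?powR_ge0// ltW//.
rewrite /pos_time r0; have [rX|Xr] := leP r X.
  apply: (@le_trans _ _ (f1 r)); last first.
    by rewrite leeDl// mule_ge0// lee_fin powR_ge0.
  rewrite /f1 indicE mem_set; last by rewrite /= in_itv/= (ltW r0) rX.
  rewrite -EFinM mulr1 lee_fin -[leRHS]mulr1 ler_pM ?powR_ge0//.
  - by rewrite ltW// h0.
  - by rewrite le_max HM0// r0 rX.
  - apply: le_trans (_ : 1 `^ (p - 1) <= _); last by rewrite powR1.
    rewrite ge0_ler_powR ?nnegrE ?(ltW p10) ?m0// .
    by rewrite ge_min lexx.
apply: (@le_trans _ _ (f2 r)); last first.
  by rewrite leeDr// mule_ge0// lee_fin// ltW.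
rewrite /f2 /patch mem_set; last by rewrite /= in_itv/= (ltW Xr).
have /andP[_ hr] := HX r (ltW Xr).
rewrite -EFinM lee_fin.
apply: (@le_trans _ _ (r `^ (gamma + eta) * (C * r `^ (- q)) `^ (p - 1))).
  apply: ler_pM; rewrite ?powR_ge0//; first by rewrite ltW// h0.
  rewrite ge0_ler_powR ?nnegrE ?(ltW p10) ?m0//.
    by rewrite mulr_ge0 ?powR_ge0// ltW.
  by rewrite ge_min lexx orbT.
rewrite powRM ?powR_ge0 ?(ltW C0)// mulrCA -powRrM -powRD; last by rewrite (gt_eqF r0) implybT.
rewrite (_ : gamma + eta + - q * (p - 1) = - 1 - eta)//.
by rewrite /eta; field.
Qed.

Section small_data.
Context (R : realType) (N : nat) (s : R) (s0 : 0 < s) (s1 : s < 1) (p gamma : R) (p1 : 1 < p).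
Notation mu := (lebesgueRn R N).

(** The sup norm bounds the free evolution near time 0 and the [L^1] norm makes it decay; together
    they give the profile [m] of [decay_profile_integral]. *)
Lemma small_data_global (h : R -> R) :
  (forall r, 0 <= r -> 0 <= h r) -> classM gamma h ->
  gamma + 1 < N%:R / (2 * s) * (p - 1) ->
  exists2 d : R, 0 < d & forall u0 : Rn R N -> R,
    measurable_fun setT u0 -> (forall x, 0 <= u0 x) ->
    ('N[mu]_1[EFin \o u0] <= d%:E)%E -> ('N[mu]_+oo[EFin \o u0] <= d%:E)%E ->
    exists u : R -> Rn R N -> R, global_mild_solution s p h u0 u.
Proof.
move=> h0 hM gq; have [_ mh _ _] := hM.
have [C C0 HC] := @heat_le_mass R N s s0 s1.
have [J J0 HJ] := decay_profile_integral hM p1 C0 gq.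
have p10 : 0 < p - 1 by rewrite subr_gt0.
set q := N%:R / (2 * s) in gq HC HJ.
pose m (r : R) := Num.min 1 (C * r `^ (- q)).
(* The solution of [2^p d^(p - 1) J = 1], which is the limit case of the smallness required by
   [heat_supersolution]. *)
pose d := ((2 `^ p * J)^-1) `^ ((p - 1)^-1).
have B0 : 0 < 2 `^ p * J by rewrite mulr_gt0 ?powR_gt0.
have d0 : 0 < d by rewrite powR_gt0// invr_gt0.
have dJ : 2 `^ p * d `^ (p - 1) * J <= 1.
  rewrite /d -powRrM mulVf ?gt_eqF// powRr1 ?invr_ge0 ?(ltW B0)//.
  by rewrite mulrAC divff// gt_eqF.
exists d => // u0 mu0 u00 N1 Ny.
have mE : measurable_fun setT (EFin \o u0) by exact/measurable_EFinP.
have E0 x : (0 <= (EFin \o u0) x)%E by rewrite lee_fin.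
have mass : (\int[mu]_y (u0 y)%:E <= d%:E)%E.
  move: N1; rewrite Lnorm1; under eq_integral do rewrite /= ger0_norm//.
  by [].
have aed : {ae mu, forall x, (u0 x)%:E <= d%:E}%E.
  move: Ny; rewrite unlock lebesgueRn_gt0 => /ess_supP.
  by apply: filterS => x; rewrite /= ger0_norm.
have Hm r y : 0 < r -> (heat s r (EFin \o u0) y <= (d * m r)%:E)%E.
  move=> r0; rewrite minr_pMr ?(ltW d0)// mulr1 EFin_min le_min; apply/andP; split.
    rewrite -(heat_cst s0 s1 y r0 (ltW d0)).
    by apply: (ae_le_heat s0 s1) => //=; move=> ?; rewrite lee_fin ltW.
  apply: le_trans (HC r _ y r0 mE E0) _.
  rewrite (mulrC d) [leRHS]EFinM lee_wpmul2l// lee_fin mulr_ge0 ?powR_ge0// ltW//.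
have [v [mv v0 veq]] : exists v : measurableTypeR R * Rn R N -> R,
    [/\ measurable_fun setT v, forall z, 0 <= v z
    & forall z, (v z)%:E =
        (heat s z.1 (EFin \o u0) z.2 + duhamel s (source p (pos_time h) v) z.1 z.2)%E].
  apply: (@heat_supersolution R N s s0 s1 p p1 (pos_time h) u0 m d J) => //.
  - exact: measurable_pos_time.
  - by move=> r; exact: pos_time_ge0.
  - by move=> r; exact: pos_time_le0.
  - apply: measurable_minr => //; apply: measurable_funM => //.
  - by move=> r; rewrite le_min ler01 mulr_ge0 ?powR_ge0// ltW.
  - exact: ltW.
exists (fun t x => v (t, x)).
apply: (mild_of_total s0 s1) => //.
by move=> t t0 _; apply: aeW => x; exact: veq.
Qed.

End small_data.

(** * Nonexistence of global solutions *)

(** Young's inequality for [f] and [A^(p - 1)] with exponents [p] and [p / (p - 1)]; rearranged, it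
    says that [f^p] lies above its tangent at [A]. *)
Lemma tangent_powR (R : realType) (p f A : R) : 1 < p -> 0 <= f -> 0 <= A ->
  p * A `^ (p - 1) * f <= f `^ p + (p - 1) * A `^ p.
Proof.
move=> p1 f0 A0; have p0 : 0 < p by exact: lt_trans p1.
have p10 : 0 < p - 1 by rewrite subr_gt0.
have q0 : 0 < p / (p - 1) by rewrite divr_gt0.
have pq : p^-1 + (p / (p - 1))^-1 = 1.
  by field; rewrite !gt_eqF.
have := conjugate_powR f0 (powR_ge0 A (p - 1)) p0 q0 pq.
rewrite -powRrM (_ : (p - 1) * (p / (p - 1)) = p); last by field; rewrite gt_eqF.
rewrite -(ler_pM2l p0) => H; apply: le_trans (_ : p * (f * A `^ (p - 1)) <= _).
  by rewrite le_eqVlt; apply/orP; left; apply/eqP; ring.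
apply: le_trans H _; rewrite le_eqVlt; apply/orP; left; apply/eqP.
by field; rewrite !gt_eqF.
Qed.

Section growth.
Context (R : realType) (N : nat) (s : R) (s0 : 0 < s) (s1 : s < 1) (p : R) (p1 : 1 < p).
Notation mu := (lebesgueRn R N).
Notation RRn := (measurableTypeR R * Rn R N)%type.
Implicit Types (t a : R) (x y : Rn R N).

(* Jensen for the probability kernel, by integrating the tangent line of
   [f `^ p] at the mean value. *)
Lemma heat_powR_jensen (f : Rn R N -> R) a x : 0 < a ->
  measurable_fun setT f -> (forall y, 0 <= f y) ->
  heat s a (EFin \o f) x \is a fin_num ->
  ((fine (heat s a (EFin \o f) x) `^ p)%:E <= heat s a (fun y => (f y `^ p)%:E) x)%E.
Proof.
move=> a0 mf f0 fin; set A := fine _.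
have f0E y : (0 <= (EFin \o f) y)%E by rewrite lee_fin.
have mfE : measurable_fun setT (EFin \o f) by exact/measurable_EFinP.
have fp0 y : (0 <= (f y `^ p)%:E)%E by rewrite lee_fin powR_ge0.
have mfp : measurable_fun setT (fun y => (f y `^ p)%:E).
  by apply/measurable_EFinP; exact: (measurableT_comp (measurable_powR p) mf).
have A0 : 0 <= A by rewrite fine_ge0// heat_ge0.
have p10 : 0 <= p - 1 by rewrite subr_ge0 ltW.
have c0 : 0 <= p * A `^ (p - 1) by rewrite mulr_ge0 ?powR_ge0// ltW// (lt_trans _ p1).
have d0 : 0 <= (p - 1) * A `^ p by rewrite mulr_ge0// powR_ge0.
have : (heat s a (fun y => (p * A `^ (p - 1))%:E * (EFin \o f) y) x <=
        heat s a (fun y => (f y `^ p)%:E + ((p - 1) * A `^ p)%:E) x)%E.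
  apply: (ae_le_heat s0 s1) => //.
  - exact: emeasurable_funM.
  - by move=> y; rewrite mule_ge0.
  - exact: emeasurable_funD.
  - by move=> y; rewrite adde_ge0.
  - by apply: aeW => y; rewrite /= -EFinM -EFinD lee_fin tangent_powR.
rewrite (heatZ s0 s1)// (heatD s0 s1)// (heat_cst s0 s1)// -[heat s a _ _ in leLHS](fineK fin) -/A -EFinM.
have -> : p * A `^ (p - 1) * A = A `^ p + (p - 1) * A `^ p.
  have -> : A `^ p = A `^ (p - 1) * A.
    have [->|An0] := eqVneq A 0; first by rewrite mulr0 powR0// gt_eqF// (lt_trans _ p1).
    by rewrite -{3}(powRr1 A0) -powRD ?subrK// An0 implybT.
  by ring.
by rewrite EFinD leeD2rE.
Qed.

Lemma measurable_heat_slices (w : RRn -> R) t x :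
  measurable_fun setT w -> (forall z : RRn, 0 <= w z) ->
  measurable_fun setT (fun r : measurableTypeR R => heat s (t - r) (fun y => (w (r, y))%:E) x).
Proof.
move=> mw w0.
pose F (z : RRn) := (kernel0 s (t - z.1) (subRn x z.2) * w z)%:E.
have F0 z : (0 <= F z)%E by rewrite lee_fin mulr_ge0// kernel0_ge0.
have mF : measurable_fun setT F by exact: measurable_duhamel_integrand.
have := measurable_fun_fubini_tonelli_F (m2 := mu) F mF F0.
by congr measurable_fun; apply/funext => r; apply: eq_integral => y _; rewrite EFinM.
Qed.

Context (k : R -> R) (u0 : Rn R N -> R) (v : RRn -> R) (tau : R).
Context (mk : measurable_fun setT k) (k0 : forall r, 0 <= k r).
Context (mu0 : measurable_fun setT u0) (u00 : forall x, 0 <= u0 x).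
Context (mv : measurable_fun setT v) (v0 : forall z : RRn, 0 <= v z).
Context (veq : forall t, 0 < t -> t < tau -> {ae mu, forall x, (v (t, x))%:E =
  (heat s t (EFin \o u0) x + duhamel s (source p k v) t x)%E}).

Definition time_slice t := fun y => (v (t, y))%:E.

Lemma measurable_time_slice t : measurable_fun setT (time_slice t).
Proof. by apply/measurable_EFinP; exact: (measurableT_comp mv). Qed.

Lemma time_slice_ge0 t y : (0 <= time_slice t y)%E.
Proof. by rewrite lee_fin. Qed.

Lemma measurable_time_cut (A : R -> bool) : measurable_fun setT A ->
  measurable_fun setT (fun z : RRn => if A z.1 then source p k v z else 0).
Proof.
move=> mA; apply: measurable_fun_ifT => //; last exact: measurable_source.
exact: (measurableT_comp mA).
Qed.

Lemma time_cut_ge0 (A : R -> bool) (z : RRn) : 0 <= (if A z.1 then source p k v z else 0).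
Proof. by case: ifPn => // _; exact: source_ge0. Qed.

(** The free evolution from [t] to [b] transports the sources before [t] and adds none, so changing
    [t] only moves the cut. The null set in the equation at time [t] is invisible to [heat]. *)
Lemma heat_time_slice t (b : R) x : 0 < t -> t < tau -> t < b ->
  heat s (b - t) (time_slice t) x = (heat s b (EFin \o u0) x +
    duhamel s (fun z : RRn => if (z.1 < t)%R then source p k v z else 0%R) b x)%E.
Proof.
move=> t0 tt tb; have bt : 0 < b - t by rewrite subr_gt0.
have u0E y : (0 <= (EFin \o u0) y)%E by rewrite lee_fin.
have mu0E : measurable_fun setT (EFin \o u0) by exact/measurable_EFinP.
have src0 (z : RRn) : 0 <= source p k v z by exact: source_ge0.
have msrc : measurable_fun setT (source p k v) by exact: measurable_source.
have mh : measurable_fun setT (heat s t (EFin \o u0)) by exact: measurable_heat.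
have md : measurable_fun setT (duhamel s (source p k v) t) by exact: measurable_duhamel.
have h0 y : (0 <= heat s t (EFin \o u0) y)%E by exact: heat_ge0.
have d0 y : (0 <= duhamel s (source p k v) t y)%E by exact: duhamel_ge0.
have -> : heat s (b - t) (time_slice t) x =
    heat s (b - t) (fun y => heat s t (EFin \o u0) y + duhamel s (source p k v) t y)%E x.
  apply: ae_eq_heat => //; [exact: measurable_time_slice|exact: emeasurable_funD|].
  exact: veq.
apply: etrans (@heatD R N s s0 s1 (b - t) _ _ x mh h0 md d0) _.
have hs := @heat_semigroup R N s s0 s1 (b - t) t _ x bt t0 mu0E u0E.
have hd := @heat_duhamel R N s s0 s1 (source p k v) (b - t) t x bt msrc src0.
by rewrite subrK in hs hd; apply: f_equal2.
Qed.

Lemma heat_time_slice_le t (t' : R) x : 0 < t -> t <= t' -> t' < tau ->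
  (heat s (tau - t) (time_slice t) x <= heat s (tau - t') (time_slice t') x)%E.
Proof.
move=> t0 tt' t'tau; rewrite !heat_time_slice ?(le_lt_trans tt')//; last exact: lt_le_trans tt'.
rewrite leeD2l//; apply: (le_duhamel s0 s1).
- by apply: (@measurable_time_cut (fun r => r < t)); exact: measurable_fun_ltr.
- exact: (@time_cut_ge0 (fun r => r < t)).
- by apply: (@measurable_time_cut (fun r => r < t')); exact: measurable_fun_ltr.
- move=> z; case: ifPn => [zt|_]; first by rewrite (lt_le_trans zt).
  by case: ifPn => // _; exact: source_ge0.
Qed.

(** The increment is the Duhamel integral over [[t, t')]. Finiteness at [t'] spreads to earlier
    times by monotonicity, so Jensen applies at each [r] of the window, and monotonicity again
    replaces the value at [r] by the one at [t]. *)
Lemma heat_time_slice_growth t (t' kappa : R) x : 0 < t -> t <= t' -> t' < tau ->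
  0 <= kappa -> (forall r, t <= r -> r < t' -> kappa <= k r) ->
  (heat s (tau - t') (time_slice t') x < +oo)%E ->
  (heat s (tau - t) (time_slice t) x +
     (kappa * (t' - t) * fine (heat s (tau - t) (time_slice t) x) `^ p)%:E <=
   heat s (tau - t') (time_slice t') x)%E.
Proof.
move=> t0 tt' t'tau kap0 kapk Gfin.
have t'0 : 0 < t' by exact: lt_le_trans tt'.
have ttau : t < tau by exact: le_lt_trans t'tau.
pose win (z : RRn) := if (t <= z.1) && (z.1 < t') then source p k v z else 0.
have mwin : measurable_fun setT win.
  apply: (@measurable_time_cut (fun r => (t <= r) && (r < t'))).
  by apply: measurable_and; [exact: measurable_fun_ler|exact: measurable_fun_ltr].
have win0 z : 0 <= win z by exact: (@time_cut_ge0 (fun r => (t <= r) && (r < t'))).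
have -> : heat s (tau - t') (time_slice t') x =
    (heat s (tau - t) (time_slice t) x + duhamel s win tau x)%E.
  rewrite (heat_time_slice x t'0 t'tau t'tau) (heat_time_slice x t0 ttau ttau).
  rewrite -[RHS]addeA; congr (_ + _)%E.
  rewrite -(duhamelD s0 s1)//.
  - apply: eq_integral => z _; congr (_ * _)%:E; rewrite /win.
    have [zt|tz]/= := ltP z.1 t; first by rewrite (lt_le_trans zt)// addr0.
    by rewrite add0r.
  - by apply: (@measurable_time_cut (fun r => r < t)); exact: measurable_fun_ltr.
  - exact: (@time_cut_ge0 (fun r => r < t)).
rewrite leeD2l// duhamel_iterated//.
have Gle r : t <= r -> r <= t' -> heat s (tau - r) (time_slice r) x \is a fin_num.
  move=> tr rt'; rewrite ge0_fin_numE; last by rewrite heat_ge0// => ?; exact: time_slice_ge0.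
  by apply: le_lt_trans Gfin; apply: heat_time_slice_le => //; exact: lt_le_trans tr.
set g := fine _.
have -> : (kappa * (t' - t) * g `^ p)%:E =
   (\int[@lebesgue_measure R]_r ((kappa * g `^ p)%:E * (\1_`[t, t'[ r)%:E))%E.
  rewrite ge0_integralZl//.
  - rewrite integral_indic//= setIT lebesgue_measure_itv/= lte_fin.
    have [tt|] := ltP t t'; first by rewrite -EFinB -EFinM; congr _%:E; ring.
    by move=> t't; rewrite (le_anti (introT andP (conj tt' t't))) subrr mulr0 mul0r mule0.
  - by apply/measurable_EFinP; exact: measurable_indic.
  - by rewrite lee_fin mulr_ge0// powR_ge0.
apply: ge0_le_integral => //.
- by move=> r _; rewrite mule_ge0// lee_fin mulr_ge0// powR_ge0.
- by apply: emeasurable_funM => //; apply/measurable_EFinP; exact: measurable_indic.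
- exact: measurable_heat_slices.
move=> r _; rewrite indicE.
have [rin|rin] := boolP (r \in `[t, t'[%classic); last first.
  by rewrite mule0 heat_ge0// => y; rewrite lee_fin.
rewrite mule1; move: rin; rewrite mem_setE in_itv/= => /andP[tr rt'].
have r0 : 0 < r by exact: lt_le_trans tr.
have rtau : r < tau by exact: lt_trans t'tau.
have -> : heat s (tau - r) (fun y => (win (r, y))%:E) x =
   heat s (tau - r) (fun y => (k r)%:E * (v (r, y) `^ p)%:E)%E x.
  by apply: eq_integral => y _; rewrite /win/= tr rt' EFinM.
rewrite (heatZ s0 s1)//; last 2 first.
- apply/measurable_EFinP; apply: (measurableT_comp (measurable_powR p)).
  exact: (measurableT_comp mv).
- by move=> y; rewrite lee_fin powR_ge0.
have heat0 a : 0 <= fine (heat s (tau - a) (time_slice a) x).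
  by apply: fine_ge0; apply: (heat_ge0 s0 s1) => y; exact: time_slice_ge0.
have ggr : g <= fine (heat s (tau - r) (time_slice r) x).
  apply: fine_le; [exact: Gle|by apply: Gle => //; exact: ltW|exact: heat_time_slice_le].
apply: (@le_trans _ _ ((k r)%:E * (fine (heat s (tau - r) (time_slice r) x) `^ p)%:E)%E).
  rewrite -EFinM lee_fin; apply: ler_pM; [exact: kap0|exact: powR_ge0|exact: kapk|].
  apply: ge0_ler_powR; last exact: ggr.
  - exact: (ltW (lt_trans ltr01 p1)).
  - by rewrite nnegrE; exact: heat0.
  - by rewrite nnegrE; exact: heat0.
rewrite lee_wpmul2l ?lee_fin//; apply: heat_powR_jensen => //.
- by rewrite subr_gt0.
- exact: (measurableT_comp mv).
- by apply: Gle => //; exact: ltW.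
Qed.

End growth.

Section nonexistence.
Context (R : realType) (N : nat) (s : R) (s0 : 0 < s) (s1 : s < 1).
Notation mu := (lebesgueRn R N).
Notation RRn := (measurableTypeR R * Rn R N)%type.
Implicit Types (x y : Rn R N).

Lemma dotRn_subRn_le x y :
  dotRn (subRn x y) (subRn x y) <= 2 * (dotRn x x + dotRn y y).
Proof.
rewrite /dotRn -big_split/= mulr_sumr; apply: ler_sum => i _.
rewrite tnth_mktuple; set a := tnth x i : R; set b := tnth y i : R.
by rewrite -subr_ge0 (_ : _ - _ = (a + b) ^+ 2) ?sqr_ge0//; ring.
Qed.

Definition ballRn (n : nat) : set (Rn R N) := [set y | dotRn y y <= n%:R].

Lemma measurable_ballRn n : measurable (ballRn n).
Proof.
rewrite (_ : ballRn n = setT `&` (fun y => dotRn y y) @^-1` `]-oo, n%:R]%classic).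
  by apply: (@measurable_normRnsq R N) => //; exact: measurable_itv.
by rewrite setTI; apply/seteqP; split => y; rewrite /ballRn/= in_itv.
Qed.

Lemma nontrivial_ball_mass (f : Rn R N -> R) : measurable_fun setT f -> (forall y, 0 <= f y) ->
  ~ {ae mu, forall y, f y = 0} ->
  exists n, exists2 a : R, 0 < a & (a%:E <= \int[mu]_(y in ballRn n) (f y)%:E)%E.
Proof.
move=> mf f0 fn0; apply: contrapT => Hno; apply: fn0.
have mfE n : measurable_fun (ballRn n) (EFin \o f).
  by apply: measurable_funTS; exact/measurable_EFinP.
have I0 n : (\int[mu]_(y in ballRn n) `|(EFin \o f) y| = 0)%E.
  have -> : (\int[mu]_(y in ballRn n) `|(EFin \o f) y| = \int[mu]_(y in ballRn n) (f y)%:E)%E.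
    by apply: eq_integral => y _; rewrite /= ger0_norm.
  apply/eqP; rewrite eq_le integral_ge0 ?andbT; last by move=> y _; rewrite lee_fin.
  rewrite leNgt; apply/negP => Ipos; apply: Hno; exists n.
  case E : (\int[mu]_(y in ballRn n) (f y)%:E)%E Ipos => [a| |]// Ipos.
    by exists a.
  by exists 1 => //; rewrite leey.
have H n : {ae mu, forall y, ballRn n y -> (EFin \o f) y = cst 0 y}%E.
  exact/(ae_eq_integral_abs mu (measurable_ballRn n) (mfE n)).1.
apply: filterS (ae_foralln H) => y Hy.
have yb : 0 <= dotRn y y by exact: dotRn_ge0.
have := Hy (Num.bound (dotRn y y)) (ltW (archi_boundP yb)).
by case.
Qed.

Lemma heat_lower (f : Rn R N -> R) : measurable_fun setT f -> (forall y, 0 <= f y) ->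
  ~ {ae mu, forall y, f y = 0} ->
  exists2 c : R, 0 < c & exists2 T0 : R, 1 <= T0 & forall a x, T0 <= a -> cubeRn 1 x ->
    ((c * a `^ (- (N%:R / (2 * s))))%:E <= heat s a (EFin \o f) x)%E.
Proof.
move=> mf f0 fn0; have [n [m m0 Hm]] := nontrivial_ball_mass mf f0 fn0.
(* For [x] in the unit cube and [y] in the ball, [|x - y|^2 <= 2 (N + n)]; the added 1 makes [rho]
   positive in every case. *)
pose rho : R := 2 * (N%:R + n%:R) + 1.
have rho0 : 0 < rho by rewrite ltr_wpDl// mulr_ge0// addr_ge0.
have [c c0 [T0 T1 Hc]] := mixed_kernel_lower N s0 s1 rho0.
exists (c * m); first by rewrite mulr_gt0.
exists T0 => // a x Ta xc; have a0 : 0 < a by rewrite (lt_le_trans _ Ta)// (lt_le_trans _ T1).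
have mfE : measurable_fun setT (EFin \o f) by exact/measurable_EFinP.
have q0 : 0 <= c * a `^ (- (N%:R / (2 * s))) by rewrite mulr_ge0 ?powR_ge0// ltW.
apply: (@le_trans _ _ (\int[mu]_(y in ballRn n) ((kernel0 s a (subRn x y))%:E * (f y)%:E))%E); last first.
  apply: ge0_subset_integral => //; first exact: measurable_ballRn.
    exact: measurable_heat_integrand.
  by move=> y _; rewrite mule_ge0// lee_fin// kernel0_ge0.
apply: (@le_trans _ _ ((c * a `^ (- (N%:R / (2 * s))))%:E * \int[mu]_(y in ballRn n) (f y)%:E)%E).
  apply: (@le_trans _ _ ((c * a `^ (- (N%:R / (2 * s))))%:E * m%:E)%E).
    by rewrite -EFinM mulrAC.
  by rewrite lee_wpmul2l.
have mB := measurable_ballRn n.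
rewrite -ge0_integralZl//; last 2 first.
- by apply: measurable_funTS.
- by move=> y _; rewrite lee_fin.
apply: ge0_le_integral => //.
- by move=> y _; rewrite mule_ge0// lee_fin.
- by apply: emeasurable_funM => //; apply: measurable_funTS.
- by apply: measurable_funTS; exact: measurable_heat_integrand.
move=> y yb; rewrite lee_wpmul2r ?lee_fin// /kernel0 a0; apply: Hc => //.
apply: le_trans (dotRn_subRn_le x y) _; rewrite /rho.
apply: le_trans (_ : 2 * (N%:R + n%:R) <= _); last by rewrite lerDl.
rewrite ler_pM2l// lerD//.
by have := dotRn_sq_cube ler01 xc; rewrite expr1n mulr1.
Qed.

Lemma ae_meets_cube (P : Rn R N -> Prop) : {ae mu, forall x, P x} -> exists2 x, cubeRn 1 x & P x.
Proof.
move=> [A [mA A0 PA]]; apply: contrapT => Hno.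
have : (mu (cubeRn 1) <= mu A)%E.
  apply: le_measure; rewrite ?inE//; first exact: measurable_cubeRn.
  by move=> x xc; apply: PA => Px; apply: Hno; exists x.
by rewrite A0 measure_cubeRn// expr1n lee_fin ler10.
Qed.

(** The exponent has either sign in the application, so the minimum over [[t / 2, t]] may be at
    either end. *)
Lemma powR_half_ge (a : R) : exists2 c : R, 0 < c & forall t r : R,
  0 < t -> t / 2 <= r -> r <= t -> c * t `^ a <= r `^ a.
Proof.
exists (Num.min 1 (2^-1 `^ a)); first by rewrite lt_min ltr01 powR_gt0.
move=> t r t0 hr rt; have r0 : 0 < r by apply: lt_le_trans hr; rewrite divr_gt0.
have -> : r = r / t * t by rewrite divfK// gt_eqF.
rewrite powRM ?(ltW t0) ?(ltW (divr_gt0 r0 t0))//; apply: ler_wpM2r; first exact: powR_ge0.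
have rt1 : 0 < r / t <= 1 by rewrite divr_gt0// ler_pdivrMr// mul1r.
have [a0|a0] := leP 0 a.
  rewrite ge_min; apply/orP; right; apply: ge0_ler_powR; rewrite ?nnegrE ?invr_ge0//.
    by rewrite ltW// divr_gt0.
  by rewrite ler_pdivlMr// mulrC.
by rewrite ge_min -(powRr0 (r / t)); apply/orP; left; apply: ger_powR => //; exact: ltW.
Qed.

Lemma global_solution_trivial (p gamma : R) (h : R -> R) (u0 : Rn R N -> R) (v : RRn -> R) :
  1 < p -> (forall r, 0 <= r -> 0 <= h r) -> classM gamma h ->
  N%:R / (2 * s) * (p - 1) < gamma + 1 ->
  measurable_fun setT u0 -> (forall x, 0 <= u0 x) ->
  measurable_fun setT v -> (forall z : RRn, 0 <= v z) ->
  (forall t : R, 0 < t -> {ae mu, forall x, (v (t, x))%:E =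
    (heat s t (EFin \o u0) x + duhamel s (source p (pos_time h) v) t x)%E}) ->
  forall t : R, 0 < t -> {ae mu, forall x, v (t, x) = 0}.
Proof.
move=> p1 h0 hM gq mu0 u00 mv v0 veq t1 t10; apply: contrapT => vn0.
have [_ mh _ _] := hM.
have mk := measurable_pos_time mh.
have k0 r : 0 <= pos_time h r by exact: pos_time_ge0.
set q := N%:R / (2 * s) in gq.
pose e := (gamma + 1 - q * (p - 1)) / 2.
have e0 : 0 < e by rewrite divr_gt0// subr_gt0.
have [X X1 HX] := classM_bounds hM e0.
have mv1 : measurable_fun setT (fun y => v (t1, y)) by exact: (measurableT_comp mv).
have [c c0 [T0 T01 Hc]] := heat_lower mv1 (fun y => v0 (t1, y)) vn0.
have [c1 c10 Hc1] := powR_half_ge (gamma - e).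
have p10 : 0 < p - 1 by rewrite subr_gt0.
pose L := (1 - 2 `^ (1 - p) : R)^-1.
have cc0 : 0 < c1 * c `^ (p - 1) / 2 by rewrite divr_gt0// mulr_gt0// powR_gt0.
pose B := Num.max 0 (L / (c1 * c `^ (p - 1) / 2)) + 1.
have B0 : 0 < B by rewrite ltr_wpDl// le_max lexx.
(* The first summand puts [X] and [t1] below [tau / 2] and [T0] below [tau - t1]; the second gives
   [tau^e >= B], beyond what the lifespan estimate allows. *)
pose tau := 2 * (X + t1 + T0) + B `^ e^-1.
have X0 : 0 < X by exact: lt_trans X1.
have T00 : 0 < T0 by exact: lt_le_trans T01.
have S0 : 0 < X + t1 + T0 by rewrite !addr_gt0.
have tau2 : X + t1 + T0 <= tau / 2.
  by rewrite ler_pdivlMr// mulrC lerDl powR_ge0.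
have tau0 : 0 < tau by rewrite ltr_wpDr ?powR_ge0// mulr_gt0.
have th0 : 0 < tau / 2 by rewrite divr_gt0.
have ht : tau / 2 < tau by rewrite ltr_pdivrMr// mulr_natr mulr2n ltrDl.
have Xt : X <= tau / 2 by apply: le_trans tau2; rewrite -addrA lerDl addr_ge0// ltW.
have t1t : t1 <= tau / 2.
  by apply: le_trans tau2; rewrite addrAC lerDr addr_ge0// ltW.
have T0t : T0 <= tau - t1.
  rewrite lerBrDr; apply: le_trans (ltW ht); apply: le_trans tau2.
  by rewrite addrC -addrA lerDr ltW.
(* Membership in the cube serves the lower bound [Hc], the equation at time [tau] the finiteness of
   [H]. *)
have [x xc veqx] := ae_meets_cube (veq tau tau0).
have veq' t : 0 < t -> t < tau -> {ae mu, forall x, (v (t, x))%:E =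
    (heat s t (EFin \o u0) x + duhamel s (source p (pos_time h) v) t x)%E}.
  by move=> t0 _; exact: veq.
pose H t := heat s (tau - t) (time_slice v t) x.
have H0 t : (0 <= H t)%E by apply: (heat_ge0 s0 s1) => y; exact: time_slice_ge0.
have Hlt t : 0 < t -> t < tau -> (H t < +oo)%E.
  move=> t0 ttau; apply: le_lt_trans (ltry (v (tau, x))).
  rewrite /H (heat_time_slice s0 s1 mk k0 mu0 u00 mv veq' x t0 ttau ttau) veqx leeD2l//.
  apply: (le_duhamel s0 s1).
  - by apply: (@measurable_time_cut _ _ _ _ _ mk mv (fun r => r < t)); exact: measurable_fun_ltr.
  - by move=> z; case: ifPn => // _; exact: source_ge0.
  - exact: measurable_source.
  - by move=> z; case: ifPn => // _; exact: source_ge0.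
have Hfin t : 0 < t -> t < tau -> H t \is a fin_num.
  by move=> t0 ttau; rewrite ge0_fin_numE// Hlt.
pose kap := c1 * tau `^ (gamma - e).
have kap0 : 0 < kap by rewrite mulr_gt0// powR_gt0.
have kapk r : tau / 2 <= r -> r < tau -> kap <= pos_time h r.
  move=> hr rtau; have r0 : 0 < r by exact: lt_le_trans hr.
  rewrite /pos_time r0; have /andP[+ _] := HX r (le_trans Xt hr).
  by apply: le_trans; apply: Hc1 => //; exact: ltW.
have q0 : 0 <= q by rewrite divr_ge0// mulr_ge0// ltW.
have A0 : 0 < c * tau `^ (- q) by rewrite mulr_gt0// powR_gt0.
have growth t t' : tau / 2 <= t -> t <= t' -> t' < tau ->
    fine (H t) + kap * (t' - t) * fine (H t) `^ p <= fine (H t').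
  move=> ht_ tt' t'tau.
  have t0 : 0 < t by exact: lt_le_trans ht_.
  have t'0 : 0 < t' by exact: lt_le_trans tt'.
  rewrite -lee_fin EFinD !fineK ?Hfin ?(le_lt_trans tt')//.
  apply: (heat_time_slice_growth s0 s1 p1 mk k0 mu0 u00 mv v0 veq') => //.
  - exact: ltW.
  - by move=> r tr rt'; apply: kapk; [exact: le_trans tr|exact: lt_trans t'tau].
  - exact: Hlt.
(* The lower bound is available at [t1], where the slice is nontrivial; monotonicity carries it to
   [tau / 2], and [tau - t1 <= tau] simplifies the rate. *)
have start : c * tau `^ (- q) <= fine (H (tau / 2)).
  rewrite -lee_fin fineK ?Hfin//.
  apply: le_trans (heat_time_slice_le s0 s1 mk k0 mu0 u00 mv veq' x t10 t1t ht).
  apply: le_trans (Hc _ _ T0t xc); rewrite lee_fin ler_pM2l// !powRN lef_pV2 ?posrE ?powR_gt0//; last first.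
    by exact: lt_le_trans T0t.
  rewrite ge0_ler_powR ?nnegrE ?(ltW tau0)//; last by rewrite gerBl ltW.
  exact: le_trans (ltW T00) T0t.
have := superlinear_growth_time kap0 A0 p1 growth start.
rewrite -/L (_ : tau - tau / 2 = tau / 2); last by field.
rewrite leNgt => /negP; apply.
(* The exponents add up to [gamma - e + 1 - q (p - 1) = e], positive exactly in the subcritical
   case. *)
have -> : kap * (tau / 2) * (c * tau `^ (- q)) `^ (p - 1) = c1 * c `^ (p - 1) / 2 * tau `^ e.
  rewrite powRM ?powR_ge0 ?(ltW c0)// -powRrM /kap.
  have -> : tau `^ e = tau `^ (gamma - e) * tau * tau `^ (- q * (p - 1)).
    rewrite -{3}(powRr1 (ltW tau0)) -!powRD ?(gt_eqF tau0) ?implybT//.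
    by congr (_ `^ _); rewrite /e; field.
  by ring.
rewrite -ltr_pdivrMl// mulrC.
apply: (@lt_le_trans _ _ B).
  by rewrite /B ltr_pwDr// le_max lexx orbT.
rewrite -[B](powRr1 (ltW B0)) -(mulVf (lt0r_neq0 e0)) powRrM.
rewrite ge0_ler_powR ?nnegrE ?powR_ge0 ?(ltW tau0) ?(ltW e0)//.
by rewrite /tau lerDr mulr_ge0// ltW.
Qed.

End nonexistence.

(** * Continuation of bounded solutions *)

Section extension.
Context (R : realType) (N : nat) (s : R) (s0 : 0 < s) (s1 : s < 1) (p : R) (p1 : 1 < p).
Notation mu := (lebesgueRn R N).
Notation RRn := (measurableTypeR R * Rn R N)%type.
Implicit Types (x y : Rn R N).

Lemma bounded_near_left (f : R -> Rn R N -> R) (b : R) : 0 < b ->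
  limf_esup (fun t : R => 'N[mu]_+oo[EFin \o f t])%E b^'- <> +oo%E ->
  exists M : R, exists2 a : R, 0 < a < b & forall t, a < t -> t < b ->
    {ae mu, forall x, f t x <= M}.
Proof.
move=> b0 Hlim.
have : (limf_esup (fun t : R => 'N[mu]_+oo[EFin \o f t])%E b^'- < +oo)%E by rewrite ltey; exact/eqP.
rewrite limf_esupE => /ereal_inf_lt[_ [A FA <-]] HA.
have [M HM] : exists M : R, forall t, A t -> ('N[mu]_+oo[EFin \o f t] <= M%:E)%E.
  case E : (ereal_sup _) HA => [M| |]// _.
    by exists M => t At; rewrite -E; apply: ereal_sup_ubound; exists t.
  by exists 0 => t At; apply: le_trans (leNye _); rewrite -E; apply: ereal_sup_ubound; exists t.
have /nbhs_ballP[e /= e0 He] : nbhs b (fun t => t < b -> A t) by exact: FA.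
exists M; exists (Num.max (b / 2) (b - e)).
  by rewrite lt_max divr_gt0//= gt_max ltr_pdivrMr// mulr_natr mulr2n ltrDl b0 ltrBlDr ltrDl.
move=> t; rewrite gt_max => /andP[_ bet] tb.
have At : A t.
  have bt : `|b - t| < e.
    by rewrite ger0_norm ?subr_ge0; [rewrite ltrBlDr -ltrBlDl|exact: ltW].
  exact: (He t bt tb).
move: (HM t At); rewrite unlock lebesgueRn_gt0 => /ess_supP.
by apply: filterS => x; rewrite /= lee_fin; apply: le_trans; exact: ler_norm.
Qed.

(** [heat] preserves constants, so each instant of the window contributes at most [K] and the other
    instants nothing. *)
Lemma duhamel_window_le (w : RRn -> R) (a c K t : R) x :
  measurable_fun setT w -> (forall z : RRn, 0 <= w z) -> a <= c -> 0 <= K ->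
  (forall r y, ~~ (a <= r < c) -> w (r, y) = 0) ->
  (forall r, a <= r -> r < c -> {ae mu, forall y, w (r, y) <= K}) ->
  (duhamel s w t x <= (K * (c - a))%:E)%E.
Proof.
move=> mw w0 ac K0 wout wK; rewrite duhamel_iterated//.
have -> : (K * (c - a))%:E = (\int[@lebesgue_measure R]_r (K%:E * (\1_`[a, c[ r)%:E))%E.
  rewrite ge0_integralZl//.
  - rewrite integral_indic//= setIT lebesgue_measure_itv/= lte_fin.
    have [ac'|] := ltP a c; first by rewrite -EFinB -EFinM.
    by move=> ca; rewrite (le_anti (introT andP (conj ac ca))) subrr mulr0 mule0.
  - by apply/measurable_EFinP; exact: measurable_indic.
apply: ge0_le_integral => //.
- by move=> r _; apply: (heat_ge0 s0 s1) => y; rewrite lee_fin.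
- exact: measurable_heat_slices.
- by apply: emeasurable_funM => //; apply/measurable_EFinP; exact: measurable_indic.
move=> r _; rewrite indicE.
have [rin|rin] := boolP (a <= r < c); last first.
  rewrite /heat; under eq_integral do rewrite wout// mule0.
  by rewrite integral0 mule_ge0// lee_fin.
rewrite mem_set; last by rewrite /= in_itv.
rewrite mule1; have [tr|rt] := leP t r.
  rewrite /heat; under eq_integral do rewrite /kernel0 subr_gt0 ltNge tr/= mul0e.
  by rewrite integral0.
have tr0 : 0 < t - r by rewrite subr_gt0.
rewrite -(heat_cst s0 s1 x tr0 K0).
apply: (ae_le_heat s0 s1) => //.
- by apply/measurable_EFinP; exact: (measurableT_comp mw).
- by move=> y; rewrite lee_fin.
- by have /andP[ar rc] := rin; apply: filterS (wK r ar rc) => y; rewrite lee_fin.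
Qed.

Context (k : R -> R) (u0 : Rn R N -> R).
Context (mk : measurable_fun setT k) (k0 : forall r, 0 <= k r).
Context (kb : forall b : R, exists M : R, forall r : R, r <= b -> k r <= M).
Context (mu0 : measurable_fun setT u0) (u00 : forall x, 0 <= u0 x).

Definition solves_at (v : RRn -> R) (t : R) := {ae mu, forall x, (v (t, x))%:E =
  (heat s t (EFin \o u0) x + duhamel s (source p k v) t x)%E}.

(* The Duhamel formula is restarted at time [b]: all that came before enters as
   the bounded datum [g], and a constant is a supersolution on a short interval. *)
Lemma bounded_solution_extends (v : RRn -> R) (b a M : R) :
  measurable_fun setT v -> (forall z : RRn, 0 <= v z) -> 0 < a < b ->
  (forall t, 0 < t -> t < b -> solves_at v t) ->
  (forall t, a < t -> t < b -> {ae mu, forall x, v (t, x) <= M}) ->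
  exists2 d : R, 0 < d & exists v' : RRn -> R,
    [/\ measurable_fun setT v', forall z, 0 <= v' z,
        forall t x, t < b -> v' (t, x) = v (t, x)
      & forall t, 0 < t -> t < b + d -> solves_at v' t].
Proof.
move=> mv v0 /andP[a0 ab] vsol vM.
pose tm := (a + b) / 2.
have atm : a < tm by rewrite ltr_pdivlMr// mulr_natr mulr2n ltrD2l.
have tmb : tm < b by rewrite ltr_pdivrMr// mulr_natr mulr2n ltrD2r.
have tm0 : 0 < tm by exact: lt_trans atm.
have u0E y : (0 <= (EFin \o u0) y)%E by rewrite lee_fin.
have mu0E : measurable_fun setT (EFin \o u0) by exact/measurable_EFinP.
have M0 : 0 <= M.
  by have [x _ vx] := ae_meets_cube (vM tm atm tmb); apply: le_trans vx.
have [K0 HK0] := kb (b + 1); pose K := Num.max K0 0.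
have KK0 : 0 <= K by rewrite le_max lexx orbT.
have HK r : r <= b + 1 -> k r <= K by move=> rb; rewrite le_max HK0.
pose src := source p k v.
have src0 (z : RRn) : 0 <= src z by exact: source_ge0.
have msrc : measurable_fun setT src by exact: measurable_source.
pose wb (z : RRn) := if z.1 < b then src z else 0.
have mwb : measurable_fun setT wb.
  by apply: (@measurable_time_cut _ _ _ _ _ mk mv (fun r => r < b)); exact: measurable_fun_ltr.
have wb0 (z : RRn) : 0 <= wb z by rewrite /wb; case: ifPn.
pose B0 := M + K * M `^ p * (b - tm).
have B00 : 0 <= B0 by rewrite addr_ge0// !mulr_ge0 ?powR_ge0// subr_ge0 ltW.
pose G (z : RRn) := (heat s z.1 (EFin \o u0) z.2 + duhamel s wb z.1 z.2)%E.
have G0 z : (0 <= G z)%E.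
  by apply: adde_ge0; [exact: (heat_ge0 s0 s1)|exact: duhamel_ge0].
have mG : measurable_fun setT G.
  apply: emeasurable_funD.
  - exact: (measurable_heat_comp s0 s1 mu0E u0E measurable_fst measurable_snd).
  - exact: (measurable_duhamel_comp s0 s1 mwb wb0 measurable_fst measurable_snd).
have GB (z : RRn) : b <= z.1 -> (G z <= B0%:E)%E.
  case: z => t x /= bt; have tmt : tm < t by exact: lt_le_trans bt.
  pose w1 (z : RRn) := if z.1 < tm then src z else 0.
  pose w2 (z : RRn) := if (tm <= z.1) && (z.1 < b) then src z else 0.
  have mw1 : measurable_fun setT w1.
    by apply: (@measurable_time_cut _ _ _ _ _ mk mv (fun r => r < tm)); exact: measurable_fun_ltr.
  have mw2 : measurable_fun setT w2.
    apply: (@measurable_time_cut _ _ _ _ _ mk mv (fun r => (tm <= r) && (r < b))).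
    by apply: measurable_and; [exact: measurable_fun_ler|exact: measurable_fun_ltr].
  have w10 (z : RRn) : 0 <= w1 z by rewrite /w1; case: ifPn.
  have w20 (z : RRn) : 0 <= w2 z by rewrite /w2; case: ifPn.
  (* Neither the datum nor the sources before [a] are bounded. The slice at [tm] sums up all of them
     and is at most [M]; the sources in [[tm, b)] account for the rest of [B0]. *)
  have -> : G (t, x) = (heat s (t - tm) (time_slice v tm) x + duhamel s w2 t x)%E.
    rewrite (heat_time_slice s0 s1 mk k0 mu0 u00 mv vsol x tm0 tmb tmt).
    rewrite -[RHS]addeA; congr (_ + _)%E.
    rewrite -(duhamelD s0 s1 t x mw1 w10 mw2 w20).
    apply: eq_integral => z _; congr (_ * _)%:E; rewrite /wb /w1 /w2.
    have [zt|tz]/= := ltP z.1 tm; first by rewrite (lt_trans zt)// addr0.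
    by rewrite add0r.
  have tmt0 : 0 < t - tm by rewrite subr_gt0.
  rewrite /B0 EFinD; apply: leeD.
    rewrite -(heat_cst s0 s1 x tmt0 M0); apply: (ae_le_heat s0 s1) => //.
    - exact: measurable_time_slice.
    - by move=> y; exact: time_slice_ge0.
    - by apply: filterS (vM tm atm tmb) => y; rewrite lee_fin.
  apply: duhamel_window_le => //.
  - exact: ltW.
  - by rewrite mulr_ge0// powR_ge0.
  - by move=> r y rout; rewrite /w2/= (negbTE rout).
  - move=> r tmr rb; have ar : a < r by exact: lt_le_trans tmr.
    apply: filterS (vM r ar rb) => y vy; rewrite /w2/= tmr rb /src/source/=.
    apply: ler_pM; rewrite ?powR_ge0//; first by rewrite HK// ltW// (lt_trans rb)// ltrDl.
    by rewrite ge0_ler_powR ?nnegrE// ltW// (lt_trans _ p1).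
pose K1 := K * (B0 + 1) `^ p.
have K10 : 0 <= K1 by rewrite mulr_ge0// powR_ge0.
(* Over a time [d] the source of the constant [B0 + 1] adds at most [K1 d <= 1]; and [d <= 1] keeps
   the times below [b + 1], where [K] bounds [k]. *)
pose d := (K1 + 1)^-1.
have d0 : 0 < d by rewrite invr_gt0 ltr_wpDl.
have d1 : d <= 1 by rewrite invf_le1 ?ltr_wpDl// lerDr.
have K1d : K1 * d <= 1 by rewrite ler_pdivrMr ?ltr_wpDl// mul1r lerDl.
pose kbd (r : R) := if (b <= r) && (r < b + d) then k r else 0.
have mkbd : measurable_fun setT kbd.
  apply: measurable_fun_ifT => //.
  by apply: measurable_and; [exact: measurable_fun_ler|exact: measurable_fun_ltr].
have kbd0 r : 0 <= kbd r by rewrite /kbd; case: ifPn.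
(* [G] is bounded only from [b] on; cutting it there makes the constant a supersolution at all
   times. *)
pose g (z : RRn) := if b <= z.1 then G z else 0%E.
have mg : measurable_fun setT g.
  by apply: measurable_fun_ifT => //; exact: measurable_fun_ler.
have g0 z : (0 <= g z)%E by rewrite /g; case: ifPn.
have gB z : (g z <= B0%:E)%E.
  by rewrite /g; case: ifPn => [bz|_]; [exact: GB|rewrite lee_fin].
have mW : measurable_fun setT ((fun=> B0 + 1) : RRn -> R) by [].
have HW (z : RRn) : (g z + duhamel s (source p kbd (fun=> B0 + 1)%R) z.1 z.2 <= (B0 + 1)%:E)%E.
  rewrite EFinD; apply: leeD => //.
  apply: (@le_trans _ _ (K1 * (b + d - b))%:E); last by rewrite lee_fin (addrC b) addrK.
  apply: duhamel_window_le => //.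
  - exact: measurable_source.
  - by move=> i; exact: source_ge0.
  - by rewrite lerDl ltW.
  - by move=> r y rout; rewrite /source/kbd/= (negbTE rout) mul0r.
  - move=> r br rbd; apply: aeW => y; rewrite /source/kbd/= br rbd ler_wpM2r ?powR_ge0//.
    by rewrite HK// ltW// (lt_le_trans rbd)// lerD2l.
have [vb [mvb vb0 _ vbeq]] := monotone_iteration s0 s1 p1 mkbd kbd0 mg g0 mW HW.
exists d => //; pose v' (z : RRn) := if z.1 < b then v z else vb z.
have mv' : measurable_fun setT v'.
  by apply: measurable_fun_ifT => //; exact: measurable_fun_ltr.
exists v'; split => //.
- by move=> z; rewrite /v'; case: ifPn.
- by move=> t x tb; rewrite /v'/= tb.
move=> t t0 tbd; have [tb|bt] := ltP t b.
  apply: filterS (vsol t t0 tb) => x; rewrite /v'/= tb => ->; congr (_ + _)%E.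
  by apply: duhamel_causal => z zt; rewrite /source (lt_trans zt).
apply: aeW => x; rewrite /v'/= ltNge bt/= vbeq /g/= bt /G/= -addeA; congr (_ + _)%E.
have sb0 (z : RRn) : 0 <= source p kbd vb z by exact: source_ge0.
have msb : measurable_fun setT (source p kbd vb) by exact: measurable_source.
rewrite -(duhamelD s0 s1 t x mwb wb0 msb sb0); apply: duhamel_causal => z zt.
rewrite /wb /src /source /kbd; have [zb|bz]/= := ltP z.1 b; first by rewrite mul0r addr0.
by rewrite (lt_trans zt)// add0r.
Qed.

End extension.

(** * Blow-up of maximal solutions and conclusion *)

Theorem maximal_solution_blowup (R : realType) (N : nat) (s p gamma : R) (h : R -> R)
    (u0 : Rn R N -> R) (T : \bar R) (u : R -> Rn R N -> R) :
  0 < s -> s < 1 -> 1 < p -> (forall t : R, 0 <= t -> 0 <= h t) -> classM gamma h ->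
  N%:R / (2 * s) * (p - 1) < gamma + 1 ->
  measurable_fun setT u0 -> (forall x, 0 <= u0 x) ->
  maximal_mild_solution s p h u0 T u -> nontrivial_on T u ->
  blows_up_in_finite_time T u.
Proof.
move=> s0 s1 p1 h0 hM gq mu0 u00 [usol umax] [t1 [t10 t1T unt]].
have [hpos mh hb _] := hM.
have T0 : (0 < T)%E by case: usol.
have [v [mv v0 vu veq]] := total_of_mild s0 s1 mh h0 usol.
case: T usol umax t1T T0 vu veq => [b| |]// usol umax t1T T0 vu veq; last first.
  exfalso; apply: unt.
  have veq' t : 0 < t -> {ae lebesgueRn R N, forall x, (v (t, x))%:E =
     (heat s t (EFin \o u0) x + duhamel s (source p (pos_time h) v) t x)%E}.
    by move=> t0; apply: veq => //; exact: ltry.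
  have := global_solution_trivial s0 s1 p1 h0 hM gq mu0 u00 mv v0 veq' t10.
  by apply: filterS => x; rewrite vu// ltry.
exists b => //; apply: contrapT => Hlim.
rewrite lte_fin in T0.
have [M [a ab uM]] := bounded_near_left T0 Hlim.
have mk := measurable_pos_time mh.
have k0 r : 0 <= pos_time h r by exact: pos_time_ge0.
have kb c : exists K : R, forall r : R, r <= c -> pos_time h r <= K.
  have [K HK] := hb c; exists (Num.max K 0) => r rc; rewrite /pos_time.
  by case: ifPn => r0; rewrite le_max ?lexx ?orbT// HK// r0.
have vsol t : 0 < t -> t < b -> solves_at s p (pos_time h) u0 v t.
  by move=> t0 tb; apply: veq => //; rewrite lte_fin.
have /andP[a0 _] := ab.
have vM t : a < t -> t < b -> {ae lebesgueRn R N, forall x, v (t, x) <= M}.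
  move=> at_ tb; apply: filterS (uM t at_ tb) => x; rewrite vu ?lte_fin//.
  exact: lt_trans at_.
have [d d0 [v' [mv' v'0 v'v v'sol]]] :=
  bounded_solution_extends s0 s1 p1 mk k0 kb mu0 u00 mv v0 ab vsol vM.
(* A solution on [(0, b + d)] that agrees with [u] before [b] contradicts maximality. *)
apply: (umax (b + d)%:E (fun t x => v' (t, x))).
- by rewrite lte_fin ltrDl.
- apply: (@mild_of_total R N s s0 s1 p h u0 (b + d)%:E v') => //.
  by rewrite lte_fin addr_gt0.
- by move=> t t0 tb; apply: aeW => x; rewrite v'v -?lte_fin// vu.
Qed.

Unset Implicit Arguments.
Set Strict Implicit.
Set Printing Implicit Defensive.

Theorem theorem1p2 (R : realType) (N : nat) (s p gamma : R) (h : R -> R)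
  (hN : (1 <= N)%N)
  (hs0 : 0 < s) (hs1 : s < 1)
  (hp : 1 < p)
  (hcont : {within `[0, +oo[, continuous h})
  (hge0 : forall t : R, 0 <= t -> 0 <= h t)
  (hgamma : -1 < gamma)
  (hM : classM gamma h) :
  (p < 1 + 2 * s * (gamma + 1) / N%:R ->
     forall (u0 : Rn R N -> R) (T : \bar R) (u : R -> Rn R N -> R),
       measurable_fun setT u0 ->
       (forall x, 0 <= u0 x) ->
       maximal_mild_solution s p h u0 T u ->
       nontrivial_on T u ->
       blows_up_in_finite_time T u)
  /\
  (1 + 2 * s * (gamma + 1) / N%:R < p ->
     exists2 delta : R, 0 < delta &
       forall u0 : Rn R N -> R,
         measurable_fun setT u0 ->
         (forall x, 0 <= u0 x) ->
         ('N[lebesgueRn R N]_1[EFin \o u0] <= delta%:E)%E ->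
         ('N[lebesgueRn R N]_+oo[EFin \o u0] <= delta%:E)%E ->
         exists u : R -> Rn R N -> R, global_mild_solution s p h u0 u).
Proof.
have N0 : 0 < (N%:R : R) by rewrite ltr0n.
have s20 : 0 < 2 * s by rewrite mulr_gt0.
(* In terms of the decay rate [q = N / (2 s)] of the kernel, the critical exponent is where
   [q (p - 1) = gamma + 1]. *)
have critE : 2 * s * (gamma + 1) / N%:R = (gamma + 1) / (N%:R / (2 * s)).
  by field; rewrite !gt_eqF.
have q0 : 0 < N%:R / (2 * s) by rewrite divr_gt0.
split => [pcrit u0 T u mu0 u00 umax unt|pcrit].
- apply: (maximal_solution_blowup hs0 hs1 hp hge0 hM _ mu0 u00 umax unt).
  by rewrite mulrC -ltr_pdivlMr// ltrBlDl -critE.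
- apply: (small_data_global hs0 hs1 hp hge0 hM).
  by rewrite mulrC -ltr_pdivrMr// ltrBrDl -critE.
Qed.
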